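(* Let $X_1,\dots,X_m$ be vector fields on $\mathbb{R}^n$ of class $\mathcal{A}_s$ satisfying the Hörmander condition of step $s$. There are $r_0>0$ and $\varepsilon_0>0$ depending on the constants $L$ and $\nu$, and a constant $C>0$, such that if for some $\eta\in(0,1)$, $I\in\mathcal S$, $x\in K$ and $r<r_0$ the triple $(I,x,r)$ is $\eta$-maximal, then for every $y\in B(x,\eta\varepsilon_0 r)$: $$|\lambda_I(y)-\lambda_I(x)|\le\tfrac12|\lambda_I(x)|\qquad\text{and}\qquad |\lambda_I(y)|r^{\ell(I)}>C^{-1}\eta\,\Lambda(y,r).$$
   Context: Vector fields $X_j=\sum_k f_j^k\partial_k$, $j=1,\dots,m$. For a word $w=j_1\cdots j_\ell$ ($j_i\in\{1,\dots,m\}$, $|w|=\ell$), $X_w=[X_{j_1},[\dots,[X_{j_{\ell-1}},X_{j_\ell}]\dots]]=f_w\cdot\nabla$. Class $\mathcal A_s$ ($s\ge2$): all Euclidean derivatives of order $\le s-2$ of the $f_j$ are locally Lipschitz, and for every word $w$ with $|w|=s-1$ and all $j,k$, $X_kf_w$ exists and is continuous and the distributional derivative $X_j(X_kf_w)$ exists in $L^\infty_{loc}$. Hörmander condition of step $s$: $\{X_w(x):|w|\le s\}$ spans $\mathbb{R}^n$ everywhere. Fix bounded connected open $\Omega'\subset\subset\Omega$, $K=\overline{\Omega'}$. Let $L=\max_{j,\,|D|\le s-2}\sup_\Omega|Df_j|+\max_{j,\,|D|=s-1}\operatorname{ess\,sup}_\Omega|Df_j|+\max_{j,k,\,|w|=s-1}\operatorname{ess\,sup}_\Omega|X_kX_jf_w|$,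 with $D$ Euclidean derivatives. $Y_1,\dots,Y_q$ enumerate all $X_w$ with $|w|\le s$, $\ell_i$ the length of $Y_i$; $\mathcal S=\{1,\dots,q\}^n$; for $I=(i_1,\dots,i_n)$, $\lambda_I(x)=\det(Y_{i_1}(x),\dots,Y_{i_n}(x))$, $\ell(I)=\sum_k\ell_{i_k}$, $\Lambda(x,r)=\max_{J\in\mathcal S}|\lambda_J(x)|r^{\ell(J)}$, $\nu=\inf_{x\in\Omega}\Lambda(x,1)>0$. $(I,x,r)$ is $\eta$-maximal if $|\lambda_I(x)|r^{\ell(I)}>\eta\Lambda(x,r)$. Control distance: $d(x,y)$ is the infimum of $r>0$ such that there is a Lipschitz $\gamma:[0,1]\to\mathbb{R}^n$, $\gamma(0)=x$, $\gamma(1)=y$, $\dot\gamma=\sum_{j=1}^mb_j(t)X_j(\gamma)$ a.e. with measurable $|b_j|\le r$; $B(x,r)$ denotes its balls. *)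

(* Defs.v *)
From HB Require Import structures.
From mathcomp Require Import all_boot all_order all_algebra.
From mathcomp Require Import all_classical all_reals all_analysis.
Set Implicit Arguments. Unset Strict Implicit. Unset Printing Implicit Defensive.
Import Order.TTheory GRing.Theory Num.Theory.
Import numFieldNormedType.Exports.
Local Open Scope classical_set_scope.
Local Open Scope ring_scope.

Section Defs.
Context {R : realType} {n m : nat}.

Notation pt := 'rV[R]_n.

Definition ebase (i : 'I_n) : pt := delta_mx 0 i.

Definition enorm (v : pt) : R := Num.sqrt (\sum_(i < n) (v 0 i) ^+ 2).

Definition Dop {V : normedModType R} (l : seq 'I_n) (g : pt -> V) : pt -> V :=
  foldr (fun i h => fun x => 'D_(ebase i) h x) g l.

Definition nullRn (N : set pt) : Prop :=
  forall e : R, 0 < e -> exists a b : nat -> pt,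
    (forall p i, a p 0 i <= b p 0 i) /\
    (forall x, N x -> exists p, forall i, a p 0 i <= x 0 i <= b p 0 i) /\
    (forall P : nat, \sum_(p < P) \prod_(i < n) (b p 0 i - a p 0 i) <= e).

Definition ae_on (A : set pt) (P : pt -> Prop) : Prop :=
  exists N, nullRn N /\ forall x, A x -> ~ N x -> P x.

Definition set_coord (x : pt) (k : nat) (t : R) : pt :=
  \row_(i < n) (if nat_of_ord i == k then t else x 0 i).
Fixpoint iter_int (k : nat) (F : pt -> R) (x : pt) : R :=
  match k with
  | 0 => F x
  | k'.+1 => Rintegral lebesgue_measure setT (fun t => iter_int k' F (set_coord x k' t))
  end.
Definition intRn (F : pt -> R) : R := iter_int n F 0.

Definition borel_fun {V : topologicalType} (G : pt -> V) : Prop :=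
  forall U : set V, open U -> <<s [set A : set pt | open A] >> (G @^-1` U).

Definition loc_lipschitz {V : normedModType R} (O : set pt) (g : pt -> V) : Prop :=
  forall x, O x -> exists d M : R, 0 < d /\
    forall y z, O y -> O z -> ball x d y -> ball x d z -> `|g y - g z| <= M * `|y - z|.

Definition test_fun (O : set pt) (phi : pt -> R) : Prop :=
  (forall (l : seq 'I_n), continuous (Dop l phi) /\
     forall i x, derivable (Dop l phi) x (ebase i)) /\
  exists K : set pt, compact K /\ K `<=` O /\ forall x, ~ K x -> phi x = 0.

Definition loc_ess_bounded (O : set pt) (G : pt -> pt) : Prop :=
  forall K : set pt, compact K -> K `<=` O ->
    exists M : R, ae_on K (fun x => enorm (G x) <= M).

(* G : O -> R^n is (a representative of) the distributional derivative of
   g : O -> R^n along the vector field F.f (componentwise), and G is in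
   L^infinity_loc(O):  <G_c, phi> = - \int g_c sum_i d_i (F^i phi). *)
Definition weak_deriv_Linf (O : set pt) (F : pt -> pt) (g G : pt -> pt) : Prop :=
  borel_fun G /\ loc_ess_bounded O G /\
  forall phi, test_fun O phi -> forall c : 'I_n,
    intRn (fun x => G x 0 c * phi x) =
    - intRn (fun x => g x 0 c *
               \sum_(i < n) 'D_(ebase i) (fun y => F y 0 i * phi y) x).

Variable f : 'I_m -> pt -> pt.

(* f_w, the coefficients of X_w = [X_j1, [..., [X_j(l-1), X_jl]...]] *)
Fixpoint fw (w : seq 'I_m) : pt -> pt :=
  match w with
  | [::] => fun _ => 0
  | j :: w' =>
    match w' with
    | [::] => f j
    | _ :: _ => fun x => 'D_(f j x) (fw w') x - 'D_(fw w' x) (f j) x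
    end
  end.

Definition Xder (k : 'I_m) (g : pt -> pt) : pt -> pt := fun x => 'D_(f k x) g x.

Definition classA (s : nat) (O : set pt) : Prop :=
  (forall j (l : seq 'I_n), (size l <= s - 2)%N ->
     loc_lipschitz O (Dop l (f j)) /\
     ((size l < s - 2)%N -> forall i x, O x -> derivable (Dop l (f j)) x (ebase i))) /\
  (forall (w : seq 'I_m), size w = (s - 1)%N -> forall k,
     (forall x, O x -> derivable (fw w) x (f k x)) /\
     {within O, continuous (Xder k (fw w))} /\
     forall j, exists G, weak_deriv_Linf O (f j) (Xder k (fw w)) G).

(* words of length 1..s, enumerated with repetitions: (p, t) |-> take p.+1 t *)
Definition wordT (s : nat) := ('I_s * s.-tuple 'I_m)%type.
Definition word {s : nat} (p : wordT s) : seq 'I_m := take p.1.+1 p.2.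

Definition hormander (s : nat) (O : set pt) : Prop :=
  forall x, O x -> forall v : pt, exists c : wordT s -> R,
    v = \sum_(p : wordT s) c p *: fw (word p) x.

Definition Sidx (s : nat) := {ffun 'I_n -> wordT s}.

Definition lambdaI {s : nat} (I : Sidx s) (x : pt) : R :=
  \det (\matrix_(a < n, b < n) fw (word (I b)) x 0 a).

Definition ellI {s : nat} (I : Sidx s) : nat := (\sum_(k < n) size (word (I k)))%N.

Definition LambdaF (s : nat) (x : pt) (r : R) : R :=
  \big[Num.max/0]_(J : Sidx s) (`|lambdaI J x| * r ^+ ellI J).

Definition eta_maximal {s : nat} (eta : R) (I : Sidx s) (x : pt) (r : R) : Prop :=
  `|lambdaI I x| * r ^+ ellI I > eta * LambdaF s x r.

Definition least_bound (P : R -> Prop) (a : R) : Prop :=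
  P a /\ forall b, P b -> a <= b.

Definition is_L (s : nat) (O : set pt) (Lv : R) : Prop :=
  exists a1 a2 a3,
    least_bound (fun b => forall j (l : seq 'I_n), (size l <= s - 2)%N ->
                   forall x, O x -> enorm (Dop l (f j) x) <= b) a1 /\
    least_bound (fun b => forall j (i : 'I_n) (l : seq 'I_n), size l = (s - 2)%N ->
                   ae_on O (fun x => derivable (Dop l (f j)) x (ebase i) /\
                                     enorm (Dop (i :: l) (f j) x) <= b)) a2 /\
    least_bound (fun b => forall j k (w : seq 'I_m), size w = (s - 1)%N ->
                   forall G, weak_deriv_Linf O (f k) (Xder j (fw w)) G ->
                   ae_on O (fun x => enorm (G x) <= b)) a3 /\
    Lv = a1 + a2 + a3.

Definition is_nu (s : nat) (O : set pt) (nuv : R) : Prop :=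
  (forall x, O x -> nuv <= LambdaF s x 1) /\
  (forall b, (forall x, O x -> b <= LambdaF s x 1) -> b <= nuv).

Definition unitI : set R := [set t | 0 <= t <= 1].

Definition admissible (x y : pt) (r : R) : Prop :=
  exists (gamma : R -> pt) (b : 'I_m -> R -> R),
    gamma 0 = x /\ gamma 1 = y /\
    (exists M : R, forall t u, unitI t -> unitI u ->
        `|gamma t - gamma u| <= M * `|t - u|) /\
    (forall j, measurable_fun unitI (b j) /\
               forall t, unitI t -> `|b j t| <= r) /\
    {ae lebesgue_measure, forall t, unitI t ->
        derivable gamma t 1 /\ 'D_1 gamma t = \sum_(j < m) b j t *: f j (gamma t)}.

(* y in B(x, rho) iff d(x, y) < rho *)
Definition cc_ball (x : pt) (rho : R) (y : pt) : Prop :=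
  exists r : R, 0 < r /\ r < rho /\ admissible x y r.

End Defs.

(* Main.v *)
Require Import Defs.
From HB Require Import structures.
From mathcomp Require Import all_boot all_order all_algebra.
From mathcomp Require Import perm ring lra.
From mathcomp Require Import all_classical all_reals all_analysis measurable_realfun.
Set Implicit Arguments. Unset Strict Implicit. Unset Printing Implicit Defensive.
Import Order.TTheory GRing.Theory Num.Theory.
Import numFieldNormedType.Exports.
Local Open Scope classical_set_scope.
Local Open Scope ring_scope.

(* Let gamma be an admissible path from x to y, with controls b_k bounded by rho.
   By multilinearity, the derivative of lambda_J along gamma is a sum of
   determinants in which a single column Y_w has been replaced by its derivative.
   If |w| <= s - 2, that derivative is sum_k b_k X_(kw) + A Y_w, where the matrix
   A = sum_k b_k Df_k is the same for all columns and only contributes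
   tr(A) lambda_J; the brackets X_(kw) lengthen J by one, which costs one factor
   1/r.  If |w| >= s - 1, the column is merely Lipschitz along gamma, with rate
   O(rho); Cramer's rule in a frame where |lambda| >= nu writes its variation with
   columns of length at most s, and again a single factor 1/r is lost.  Hence
   lambda_J(gamma(t)) r^l(J) varies at rate O((rho / r) Lambda(gamma(t), r)), so
   for rho < eta eps0 r the supremum of Lambda along gamma is at most
   4/3 Lambda(x, r), and each lambda_J r^l(J) moves by at most
   eta/3 Lambda(x, r).

   The delicate columns are those with |w| = s: X_k f_w, with |w| = s - 1, has
   only distributional derivatives along the X_j.  Its mollifications at scale h
   are differentiated along gamma, and Friedrichs' commutator estimate compares
   X_j of the mollification with the mollification of the L^infinity derivative,
   uniformly as h tends to 0.  As gamma is differentiable only almost everywhere,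
   each differential inequality is integrated through Dini derivatives: an
   optimal bound off a null set together with some bound everywhere. *)

(** * Dini derivatives *)

(** A bound that holds off a null set of ['rV[R]_n] says nothing about a single path, which may lie
    inside the null set. It has to be averaged: the hypotheses on weak derivatives become
    inequalities between integrals against a bump, valid for every centre near a given point, and
    these do restrict to [gamma]. Such an averaged bound also yields the Lipschitz constants of the
    top-order derivatives of the fields.

    The speed of [lambdaI] is proportional to [LambdaF] at the moving point. Replacing that factor
    by its supremum over [gamma], finite by a crude Lipschitz bound, makes the inequality linear: a
    quarter of the supremum is absorbed, and no Gronwall argument is needed. The same crude bound
    serves at the exceptional times.

    Since not every column of a frame is differentiable along [gamma], determinants are expanded in
    difference quotients, with a remainder uniform over matrices of bounded entries.

    As [intRn] is an iterated integral and [nullRn] speaks of box covers, the integration theory is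
    developed for bounded Borel functions of bounded support; dominated convergence and translation
    invariance replace integration by parts. *)

Section OneDim.
Context {R : realType}.
Implicit Types (a b t u : R).

(** Let T be the supremum of the times up to which [P] holds throughout. The closure hypothesis
    gives [P] at T, and the step hypothesis would push past T if T were below [b]. *)
Lemma real_induction a b (P : R -> Prop) : a <= b -> P a ->
  (forall t, a <= t < b -> (forall u, a <= u <= t -> P u) ->
     exists2 d : R, 0 < d & forall u, t < u < t + d -> u <= b -> P u) ->
  (forall t, a < t <= b -> (forall u, a <= u < t -> P u) -> P t) ->
  forall t, a <= t <= b -> P t.
Proof.
move=> ab Pa step lim.
pose S := [set t | a <= t <= b /\ forall u, a <= u <= t -> P u].
have Sa : S a.
  split; first by rewrite lexx ab.
  by move=> u; rewrite -eq_le => /eqP <-.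
have ubS : ubound S b by move=> t [/andP[]].
have supS : has_sup S by split; [exists a | exists b].
have aT : a <= sup S by exact: ub_le_sup supS.2 _ Sa.
have Tb : sup S <= b by apply: ge_sup => //; exists a.
have Pl u : a <= u < sup S -> P u.
  move=> /andP[au uT]; have uT' : 0 < sup S - u by rewrite subr_gt0.
  have [s Ss us] := sup_adherent uT' supS.
  rewrite opprB addrCA subrr addr0 in us.
  by apply: Ss.2; rewrite au (ltW us).
have PT : P (sup S).
  have [aeT|aT'] := eqVneq a (sup S); first by rewrite -aeT.
  by apply: lim => //; rewrite lt_neqAle aT' aT Tb.
have PlT u : a <= u <= sup S -> P u.
  by move=> /andP[au]; rewrite le_eqVlt => /orP[/eqP->//|uT]; apply: Pl; rewrite au.
have TE : sup S = b.
  apply/eqP; rewrite eq_le Tb /= leNgt; apply/negP => Tb'.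
  have [|d d0 dP] := step (sup S) _ PlT; first by rewrite aT.
  pose v := Num.min (sup S + d / 2) b.
  have Sv : S v.
    split; first by rewrite /v le_min ge_min lexx orbT ab andbT; lra.
    move=> u /andP[au]; rewrite /v le_min => /andP[ud ub].
    have [uT|Tu] := leP u (sup S); first by apply: PlT; rewrite au.
    by apply: dP => //; rewrite Tu /=; lra.
  have := ub_le_sup supS.2 Sv; apply/negP; rewrite -ltNge /v lt_min Tb' andbT.
  lra.
by move=> t; rewrite -{1}TE => /PlT.
Qed.

Local Notation mu := (@lebesgue_measure R).

Let mu_le (A B : set R) :
  measurable A -> measurable B -> A `<=` B -> (mu A <= mu B)%E.
Proof. move=> mA mB AB; exact: (le_measure mu (mem_set mA) (mem_set mB) AB). Qed.

Lemma negligible_open_cover (N : set R) (e : R) :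
  mu.-negligible N -> 0 < e ->
  exists U : set R, [/\ open U, N `<=` U & (mu U < e%:E)%E].
Proof.
move=> [A [mA A0 NA]] e0.
have Afin : (mu A < +oo)%E by rewrite A0 ltry.
have [U [oU AU mUA]] := lebesgue_regularity_outer mA Afin e0.
exists U; split => //; first exact: subset_trans AU.
have mU : measurable U by exact: open_measurable.
have -> : U = (U `\` A) `|` A by rewrite setUC setDUK.
apply: le_lt_trans mUA.
by rewrite -[leRHS]adde0 -A0; apply: measureU2 => //; exact: measurableD.
Qed.

(* The exceptional set is covered by an open set U of small measure; the
   measure of U below t absorbs the growth of h on N. *)
Lemma dini_le_ae (h : R -> R) (N : set R) (a b M c : R) :
  a <= b -> 0 <= M -> mu.-negligible N ->
  (forall t, a < t <= b -> forall e : R, 0 < e ->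
     exists2 d : R, 0 < d & forall u, a <= u -> t - d < u < t -> h t - h u <= e) ->
  (forall t, a <= t < b -> exists2 d : R, 0 < d &
     forall u, t < u < t + d -> u <= b -> h u - h t <= M * (u - t)) ->
  (forall t, a <= t < b -> ~ N t -> forall e : R, 0 < e -> exists2 d : R, 0 < d &
     forall u, t < u < t + d -> u <= b -> h u - h t <= (c + e) * (u - t)) ->
  h b - h a <= c * (b - a).
Proof.
move=> ab M0 N0 lc hM hc.
suff main (e : R) : 0 < e -> h b - h a <= (c + e) * (b - a) + (M + `|c| + e) * e.
  apply/ler_addgt0Pr => e e0.
  pose K := (b - a) + (M + `|c| + 1).
  have K0 : 0 < K by rewrite /K; have := normr_ge0 c; lra.
  pose e' := Num.min (e / K) 1.
  have e'0 : 0 < e' by rewrite lt_min ltr01 andbT divr_gt0.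
  have e'1 : e' <= 1 by rewrite ge_min lexx orbT.
  have e'K : e' * K <= e by rewrite -ler_pdivlMr// ge_min lexx.
  apply: le_trans (main _ e'0) _.
  have : e' * e' <= e' by rewrite ler_piMr// ltW.
  have := e'K; rewrite /K.
  nra.
move=> e0.
have [U [oU NU mUe]] := negligible_open_cover N0 e0.
have mU : measurable U by exact: open_measurable.
pose A t := U `&` `]a, t].
have mA t : measurable (A t) by apply: measurableI.
have AUe t : (mu (A t) < e%:E)%E.
  by apply: le_lt_trans mUe; apply: mu_le => // z [].
have Afin t : mu (A t) \is a fin_num.
  by rewrite ge0_fin_numE// (lt_trans (AUe t))// ltry.
pose psi t := fine (mu (A t)).
have psi_ge0 t : 0 <= psi t by rewrite fine_ge0.
have psi_e t : psi t <= e by rewrite -lee_fin fineK// ltW.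
have psi_mono t u : t <= u -> psi t <= psi u.
  move=> tu; apply: fine_le => //; apply: mu_le => //.
  apply: setIS => z /=; rewrite !in_itv/= => /andP[-> /=]; move=> zt.
  exact: le_trans tu.
have psi_U t u : a <= t -> t <= u -> (forall z, t < z <= u -> U z) ->
    psi t + (u - t) <= psi u.
  move=> at_ tu tuU.
  have Itu : mu `]t, u] = (u - t)%:E.
    rewrite lebesgue_measure_itv/= lte_fin.
    have [->|] := eqVneq t u; first by rewrite ltxx subrr.
    by rewrite lt_neqAle tu andbT => ->; rewrite -EFinB.
  rewrite -lee_fin EFinD -Itu !fineK//.
  rewrite -measureU//; last first.
    apply/seteqP; split => z // -[[_ zt] tz]; move: zt tz.
    rewrite /= !in_itv/= => /andP[_ zt] /andP[tz _].
    by move: (le_lt_trans zt tz); rewrite ltxx.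
  - exact: mA.
  apply: mu_le => //; first by apply: measurableU => //; exact: mA.
  move=> z [[Uz]|] /=; rewrite !in_itv/= => /andP[az zt]; split => //=.
  - by rewrite in_itv/= az (le_trans zt).
  - by apply: tuU; rewrite az.
  - by rewrite in_itv/= zt (le_lt_trans at_).
(* On the stretch following a point of [N] that stays in [U], [psi] grows at unit rate; [K] is large
   enough for [K * psi] to pay for the excess of [M] over [c + e], also when [c] is negative. *)
pose K := M + `|c| + e.
have K0 : 0 <= K by rewrite /K; have := normr_ge0 c; lra.
have Kc : M <= (c + e) + K.
  by rewrite /K; have := ler_norm (- c); rewrite normrN; lra.
pose P t := h t - h a <= (c + e) * (t - a) + K * psi t.
have : P b.
  apply: (real_induction (P := P) ab); last by rewrite ab lexx.
  - by rewrite /P !subrr mulr0 add0r mulr_ge0.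
  - move=> t tab Pt.
    have Pt' : P t by apply: Pt; rewrite lexx andbT; case/andP: tab.
    have at_ : a <= t by case/andP: tab.
    have [Nt|Nt] := pselect (N t).
      have [d1 d10 d1h] := hM _ tab.
      have /nbhs_ballP[d2 /= d20 d2U] : nbhs t U by apply: open_nbhs_nbhs; split => //; exact: NU.
      exists (Num.min d1 d2); first by rewrite lt_min d10.
      move=> u /andP[tu]; rewrite -ltrBlDl lt_min => /andP[ud1 ud2] ub.
      have pu : psi t + (u - t) <= psi u.
        apply: psi_U at_ (ltW tu) _ => z /andP[tz zu]; apply: d2U.
        by rewrite /ball/= distrC gtr0_norm; lra.
      have hu : h u - h t <= M * (u - t) by apply: d1h => //; lra.
      have : K * (psi t + (u - t)) <= K * psi u by rewrite ler_wpM2l.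
      have : M * (u - t) <= (c + e + K) * (u - t) by rewrite ler_wpM2r// subr_ge0 ltW.
      move: Pt'; rewrite /P; nra.
    have [d d0 dh] := hc _ tab Nt _ e0; exists d => // u tud ub.
    have := dh _ tud ub; move: Pt'; rewrite /P.
    have : K * psi t <= K * psi u.
      by rewrite ler_wpM2l// psi_mono// ltW//; case/andP: tud.
    nra.
  - move=> t tab Pt; rewrite /P; apply/ler_addgt0Pr => e1 e10.
    have [d d0 dh] := lc _ tab _ (divr_gt0 e10 (ltr0Sn _ 1)).
    pose k := `|c + e| + 1.
    have k0 : 0 < k by rewrite /k; have := normr_ge0 (c + e); lra.
    pose u := Num.max a (t - Num.min (d / 2) (e1 / 2 / k)).
    have m0 : 0 < Num.min (d / 2) (e1 / 2 / k) by rewrite lt_min !divr_gt0.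
    have md : Num.min (d / 2) (e1 / 2 / k) <= d / 2 by rewrite ge_min lexx.
    have mk : Num.min (d / 2) (e1 / 2 / k) * k <= e1 / 2.
      by rewrite -ler_pdivlMr// ge_min lexx orbT.
    case/andP: tab => at_ tb.
    have ut : u < t by rewrite /u gt_max at_; lra.
    have au : a <= u by rewrite /u le_max lexx.
    have tu : t - u <= Num.min (d / 2) (e1 / 2 / k).
      by rewrite lerBlDl -lerBlDr /u le_max lexx orbT.
    have hu : h t - h u <= e1 / 2 by apply: dh => //; rewrite ut andbT; lra.
    have := Pt u; rewrite au ut /P => /(_ isT) Pu.
    have : K * psi u <= K * psi t by rewrite ler_wpM2l// psi_mono// ltW.
    have : (c + e) * (u - t) <= k * (t - u).
      have : - (c + e) <= k by have := ler_norm (- (c + e)); rewrite normrN /k; lra.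
      have : 0 < t - u by rewrite subr_gt0.
      nra.
    have : k * (t - u) <= e1 / 2.
      by apply: le_trans mk; rewrite mulrC ler_wpM2r// ltW.
    nra.
rewrite /P => /le_trans; apply; rewrite lerD2l.
by rewrite /K ler_wpM2l.
Qed.

End OneDim.

(** * Iterated integrals *)

Section OneDimIntegral.
Context {R : realType}.
Local Notation mu := (@lebesgue_measure R).

Definition bsupp1 (A B : R) (u : R -> R) : Prop :=
  [/\ measurable_fun setT u, forall t, `|u t| <= B & forall t, A < `|t| -> u t = 0].

Lemma lebesgue_measure_sym (A : R) : 0 <= A -> mu `[-A, A] = (2 * A)%:E.
Proof.
move=> A0; rewrite lebesgue_measure_itv/= lte_fin.
case: ltP => [_|]; first by rewrite -EFinB; congr EFin; lra.
by move=> ?; congr EFin; lra.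
Qed.

Lemma bsupp1_indic A B u : bsupp1 A B u ->
  forall t, `|u t| <= B * (\1_(`[-A, A]) t : R).
Proof.
move=> [_ uB u0] t; rewrite indicE; case: (boolP (t \in _)) => [_|tA]; first by rewrite mulr1.
rewrite mulr0 u0 ?normr0//; rewrite ltNge; apply: contra tA => tA.
by rewrite inE/= in_itv/= -ler_norml.
Qed.

Lemma integrable_indic_sym (A B : R) :
  mu.-integrable setT (EFin \o (fun t => B * (\1_(`[-A, A]) t : R))).
Proof.
have -> : EFin \o (fun t => B * (\1_(`[-A, A]) t : R)) =
    (fun t => B%:E * (\1_(`[-A, A]) t)%:E)%E by [].
apply: integrableZl => //.
exact: integrable_indic_itv.
Qed.

Lemma bsupp1_integrable A B u : bsupp1 A B u -> mu.-integrable setT (EFin \o u).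
Proof.
move=> uAB; have [mu_ _ _] := uAB.
apply: (le_integrable _ _ _ (integrable_indic_sym A B)) => //.
  exact/measurable_EFinP.
move=> t _ /=; rewrite lee_fin (le_trans (bsupp1_indic uAB t))//.
exact: ler_norm.
Qed.

Lemma bsupp1_bound A B u : 0 <= A -> bsupp1 A B u ->
  `|Rintegral mu setT u| <= B * (2 * A).
Proof.
move=> A0 uAB; apply: le_trans (le_normr_Rintegral _ (bsupp1_integrable uAB)) _ => //.
have <- : Rintegral mu setT (fun t => B * (\1_(`[-A, A]) t : R)) = B * (2 * A).
  rewrite RintegralZl//; last first.
    have := integrable_indic_sym A 1; congr (integrable _ _ _).
    by apply/funext => t /=; rewrite mul1r.
  congr (_ * _); rewrite /Rintegral integral_indic// setIT.
  by change (fine (mu `[-A, A]) = 2 * A); rewrite lebesgue_measure_sym.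
apply: le_Rintegral => //; last by move=> t _; exact: bsupp1_indic.
  have /= := integrable_abse (bsupp1_integrable uAB).
  exact.
exact: integrable_indic_sym.
Qed.

Lemma Rintegral_dct A B (u_ : nat -> R -> R) u :
  (forall p, bsupp1 A B (u_ p)) -> bsupp1 A B u ->
  (forall t, u_ p t @[p --> \oo] --> u t) ->
  Rintegral mu setT (u_ p) @[p --> \oo] --> Rintegral mu setT u.
Proof.
move=> uAB lAB uu; apply: fine_cvg.
have iu := bsupp1_integrable lAB.
rewrite /Rintegral fineK; last first.
  by apply: (integrable_fin_num (measurableT) iu).
have [|||||_ _ ] := @dominated_convergence _ _ _ mu _ measurableT
  (fun p => EFin \o u_ p) (EFin \o u) (EFin \o (fun t => B * (\1_(`[-A, A]) t : R))).
- by move=> p; apply/measurable_EFinP; case: (uAB p).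
- by apply/measurable_EFinP; case: lAB.
- by apply: aeW => t _; apply: cvg_EFin; [exact: nearW|exact: uu].
- exact: integrable_indic_sym.
- by apply: aeW => t p _ /=; rewrite lee_fin; exact: bsupp1_indic.
- exact.
Qed.

Lemma lebesgue_shift (h : R) (A : set R) : measurable A ->
  mu ((fun t => t + h) @^-1` A) = mu A.
Proof.
move=> mA.
have mh : measurable_fun setT ((fun t : R => t + h) : R -> measurableTypeR R).
  exact: measurable_funD.
pose mix := isMeasurableFun.Build _ _ _ _ _ mh.
pose phi : {mfun _ >-> _} := HB.pack ((fun t : R => t + h) : R -> measurableTypeR R) mix.
change (pushforward mu phi A = mu A).
apply/esym/lebesgue_measure_unique => //= _ [[a b]] _ <-.
rewrite /pushforward.
have -> : phi @^-1` `]a, b] = `]a - h, b - h]%classic.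
  by apply/seteqP; split => t /=; rewrite !in_itv/= ltrBlDr lerBrDr.
rewrite !lebesgue_measure_itv/= !lte_fin ltrD2r; case: ifP => // _.
by rewrite -!EFinB; congr EFin; lra.
Qed.

Lemma Rintegral_shift A B u (h : R) : bsupp1 A B u ->
  Rintegral mu setT (fun t => u (t + h)) = Rintegral mu setT u.
Proof.
move=> uAB; have [mu_ _ _] := uAB.
have mh : measurable_fun setT ((fun t : R => t + h) : R -> measurableTypeR R).
  exact: measurable_funD.
pose mix := isMeasurableFun.Build _ _ _ _ _ mh.
pose phi : {mfun _ >-> _} := HB.pack ((fun t : R => t + h) : R -> measurableTypeR R) mix.
rewrite /Rintegral; congr fine.
have E (f : R -> \bar R) : measurable_fun setT f -> (forall t, (0 <= f t)%E) ->
    (\int[mu]_t f (t + h)%R = \int[mu]_t f t)%E.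
  move=> mf f0.
  transitivity (\int[pushforward mu phi]_t f t)%E.
    by rewrite ge0_integral_pushforward.
  by apply: eq_measure_integral => //= C mC _; exact: lebesgue_shift.
have mE : measurable_fun setT (EFin \o u) by exact/measurable_EFinP.
rewrite integralE [in RHS]integralE; congr (_ - _)%E.
- rewrite -(E (funepos (EFin \o u)))//; last exact: measurable_funepos.
  by apply: eq_integral => t _; rewrite !funeposE.
- rewrite -(E (funeneg (EFin \o u)))//; last exact: measurable_funeneg.
  by apply: eq_integral => t _; rewrite !funenegE.
Qed.

End OneDimIntegral.

(** * Borel functions on row vectors and measurability of partial integrals *)

Section Borel.
Context {R : realType} {n : nat}.
Local Notation pt := 'rV[R]_n.

(** The sigma-algebra of [borel_fun], packaged as a measurable type so that product measurability
    and Tonelli's theorem apply to it. *)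
Definition borelT := g_sigma_algebraType [set A : set pt | open A].
Definition borelF (F : pt -> R) : Prop := measurable_fun (@setT borelT) (F : borelT -> R).

Lemma open_borel (U : set pt) : open U -> measurable (U : set borelT).
Proof. by move=> oU; apply: sub_sigma_algebra. Qed.

Lemma closed_borel (U : set pt) : closed U -> measurable (U : set borelT).
Proof.
by move=> /closed_openC/open_borel/measurableC; rewrite setCK.
Qed.

Lemma continuous_borelF (F : pt -> R) : continuous F -> borelF F.
Proof.
move=> /continuousP cF; apply: (measurability _ (RGenOpens.measurableE R)).
move=> _ [_ [a [b ->] <-]]; rewrite setTI; apply: open_borel.
exact/cF/interval_open.
Qed.

Lemma rV_ballP (x y : pt) (e : R) :
  ball x e y <-> 0 < e /\ forall i, `|x 0 i - y 0 i| < e.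
Proof.
split => [[e0 h]|[e0 h]]; split => //; first by move=> i; exact: (h 0 i).
by move=> i j; rewrite (ord1 i); exact: h.
Qed.

Lemma rat_box_nbhs (U : set pt) (x : pt) : open U -> U x ->
  exists p q : 'rV[rat]_n,
    (forall i, ratr (p 0 i) < x 0 i < ratr (q 0 i)) /\
    (forall y : pt, (forall i, ratr (p 0 i) < y 0 i < ratr (q 0 i)) -> U y).
Proof.
move=> oU Ux.
have /nbhs_ballP[e /= e0 eU] : nbhs x U by exact: open_nbhs_nbhs.
have lp (i : 'I_n) : exists q : rat, x 0 i - e / 2 < ratr q < x 0 i.
  have h : x 0 i - e / 2 < x 0 i by rewrite ltrBlDr ltrDl divr_gt0.
  have [q] := rat_in_itvoo h.
  by rewrite in_itv/= => ?; exists q.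
have lq (i : 'I_n) : exists q : rat, x 0 i < ratr q < x 0 i + e / 2.
  have h : x 0 i < x 0 i + e / 2 by rewrite ltrDl divr_gt0.
  have [q] := rat_in_itvoo h.
  by rewrite in_itv/= => ?; exists q.
have [p hp] := choice lp; have [q hq] := choice lq.
exists (\row_i p i), (\row_i q i); split.
  by move=> i; rewrite !mxE; have /andP[_ ->] := hp i; have /andP[-> _] := hq i.
move=> y hy; apply: eU; apply/rV_ballP; split => // j.
have := hy j; have := hp j; have := hq j; rewrite !mxE => /andP[? ?] /andP[? ?] /andP[? ?].
by rewrite ltr_norml; apply/andP; split; lra.
Qed.

(** An open set is the countable union of the rational boxes inside it, and the preimage of a box
    only involves the coordinates. *)
Lemma measurable_coord_borel d (S : measurableType d) (Phi : S -> pt) :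
  (forall i, measurable_fun setT (fun z => Phi z 0 i)) ->
  measurable_fun setT (Phi : S -> borelT).
Proof.
move=> mP; apply: (@measurability _ _ S borelT setT Phi [set A : set pt | open A] erefl).
move=> _ [U oU <-]; rewrite setTI.
pose box (pq : 'rV[rat]_n * 'rV[rat]_n) : set pt :=
  [set y | forall i, ratr (pq.1 0 i) < y 0 i < ratr (pq.2 0 i)].
have -> : Phi @^-1` U = \bigcup_pq
    (if pselect (box pq `<=` U) then Phi @^-1` box pq else set0).
  apply/seteqP; split => z /=.
    move=> /(rat_box_nbhs oU)[p [q [zpq pqU]]]; exists (p, q) => //.
    by case: pselect.
  by move=> [pq _]; case: pselect => // pqU; exact: pqU.
apply: countable_bigcupT_measurable => // pq; case: pselect => /= _; last exact: measurable0.
have -> : Phi @^-1` box pq =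
    \bigcap_(i in [set: 'I_n]) ((fun z => Phi z 0 i) @^-1` `]ratr (pq.1 0 i), ratr (pq.2 0 i)[).
  apply/seteqP; split => z /=.
    by move=> h i _ /=; rewrite in_itv/=; exact: h.
  by move=> h i; have := h i I; rewrite /= in_itv.
apply: fin_bigcap_measurable => // i _.
by rewrite -[X in measurable X]setTI; apply: mP.
Qed.

Lemma borelF_coord (i : 'I_n) : borelF (fun x => x 0 i).
Proof. by apply: continuous_borelF; exact: coord_continuous. Qed.

Lemma measurable_set_coord (k : nat) :
  measurable_fun setT (fun z : borelT * measurableTypeR R => set_coord z.1 k z.2 : borelT).
Proof.
apply: measurable_coord_borel => i.
have -> : (fun z : borelT * measurableTypeR R => (set_coord z.1 k z.2 : pt) 0 i) =
    fun z => if nat_of_ord i == k then z.2 else (z.1 : pt) 0 i.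
  by apply/funext => z; rewrite mxE.
case: (nat_of_ord i == k); first exact: measurable_snd.
by apply: (measurableT_comp (borelF_coord i)); exact: measurable_fst.
Qed.

Lemma measurable_section (F : pt -> R) (k : nat) (x : pt) : borelF F ->
  measurable_fun setT (fun t => F (set_coord x k t)).
Proof.
move=> mF; apply: (measurableT_comp mF).
have h : measurable_fun setT (fun t : R => ((x : borelT), t)) by exact: measurable_pair1.
exact: (measurableT_comp (measurable_set_coord k) h).
Qed.

(** Tonelli's theorem gives measurability of the partial integrals of the positive and negative
    parts separately, so no integrability is required. *)
Lemma borelF_iter_int (F : pt -> R) (k : nat) : borelF F -> borelF (iter_int k F).
Proof.
move=> mF; elim: k => [//|k IH].
pose f (z : borelT * measurableTypeR R) := (iter_int k F (set_coord z.1 k z.2))%:E.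
have mf : measurable_fun setT f.
  by apply/measurable_EFinP; apply: (measurableT_comp IH); exact: measurable_set_coord.
rewrite /borelF.
have -> : iter_int k.+1 F = fun x : borelT => fine
   ((\int[lebesgue_measure]_t (f^\+ (x, t)) - \int[lebesgue_measure]_t (f^\- (x, t)))%E).
  apply/funext => x /=; rewrite /Rintegral integralE; congr fine; congr (_ - _)%E.
    by apply: eq_integral => t _; rewrite !funeposE.
  by apply: eq_integral => t _; rewrite !funenegE.
apply: measurableT_comp => //; apply: emeasurable_funB.
- have := @measurable_fun_fubini_tonelli_F _ _ borelT (measurableTypeR R) R (@lebesgue_measure R) (f^\+)%E.
  apply.
  + exact: measurable_funepos.
  + by move=> z; exact: funepos_ge0.
- have := @measurable_fun_fubini_tonelli_F _ _ borelT (measurableTypeR R) R (@lebesgue_measure R) (f^\-)%E.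
  apply.
  + exact: measurable_funeneg.
  + by move=> z; exact: funeneg_ge0.
Qed.

End Borel.

Section IterInt.
Context {R : realType} {n : nat}.
Local Notation pt := 'rV[R]_n.
Local Notation mu := (@lebesgue_measure R).
Implicit Types (F G : pt -> R) (A B : R) (k : nat).

(* Bounded Borel functions vanishing where a coordinate of index at least k
   leaves [-A, A]; for k = 0 the support lies in a cube. *)
Definition bsupp k A B F : Prop :=
  [/\ borelF F, forall x, `|F x| <= B &
   forall x : pt, (exists2 i : 'I_n, (k <= i)%N & A < `|x 0 i|) -> F x = 0].

Lemma set_coordE (x : pt) k t (i : 'I_n) :
  set_coord x k t 0 i = if (i : nat) == k then t else x 0 i.
Proof. by rewrite mxE. Qed.

Lemma bsupp_section k A B F x : (k < n)%N -> bsupp k A B F ->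
  bsupp1 A B (fun t => F (set_coord x k t)).
Proof.
move=> kn [mF FB F0]; split; first exact: measurable_section.
- by move=> t; exact: FB.
- by move=> t At; apply: F0; exists (Ordinal kn) => //=; rewrite set_coordE eqxx.
Qed.

Lemma bsupp_ge0 k A B F : bsupp k A B F -> 0 <= B.
Proof. by move=> [_ FB _]; exact: le_trans (FB 0). Qed.

Lemma bsupp_iter k A B F : 0 <= A -> (k <= n)%N -> bsupp 0 A B F ->
  bsupp k A (B * (2 * A) ^+ k) (iter_int k F).
Proof.
move=> A0 + FAB; elim: k => [_|k IH kn]; first by rewrite expr0 mulr1.
have IHk := IH (ltnW kn).
split; first by apply: borelF_iter_int; case: FAB.
- move=> x /=; rewrite exprSr mulrA.
  by apply: bsupp1_bound => //; exact: bsupp_section.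
- move=> x [i ki Ai] /=.
  rewrite (_ : (fun t => _) = cst 0); first by rewrite /Rintegral integral0.
  apply/funext => t /=; have [_ _] := IHk; apply.
  by exists i; [exact: ltnW|rewrite set_coordE gtn_eqF].
Qed.

Lemma bsupp_iter_section k A B F x : 0 <= A -> (k < n)%N -> bsupp 0 A B F ->
  bsupp1 A (B * (2 * A) ^+ k) (fun t => iter_int k F (set_coord x k t)).
Proof.
by move=> A0 kn FAB; apply: bsupp_section => //; apply: bsupp_iter => //; exact: ltnW.
Qed.

Lemma bsuppW k A B A' B' F : bsupp k A B F -> A <= A' -> B <= B' -> bsupp k A' B' F.
Proof.
move=> [mF FB F0] AA BB; split => //; first by move=> x; exact: le_trans BB.
by move=> x [i ki Ai]; apply: F0; exists i => //; exact: le_lt_trans Ai.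
Qed.

Lemma bsuppD A B B' F G : bsupp 0 A B F -> bsupp 0 A B' G ->
  bsupp 0 A (B + B') (fun x => F x + G x).
Proof.
move=> [mF FB F0] [mG GB G0]; split; first exact: measurable_funD.
- by move=> x; rewrite (le_trans (ler_normD _ _))// lerD.
- by move=> x h; rewrite F0// G0// addr0.
Qed.

Lemma bsuppM A B B' F G : bsupp 0 A B F -> borelF G -> (forall x, `|G x| <= B') ->
  bsupp 0 A (B * B') (fun x => F x * G x).
Proof.
move=> [mF FB F0] mG GB; split; first exact: measurable_funM.
- by move=> x; rewrite normrM ler_pM.
- by move=> x h; rewrite F0// mul0r.
Qed.

Lemma borelF_cst (c : R) : borelF (fun _ : pt => c).
Proof. exact: measurable_cst. Qed.

Lemma bsuppZ A B F (c : R) : bsupp 0 A B F -> bsupp 0 A (B * `|c|) (fun x => c * F x).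
Proof.
move=> FAB; have := bsuppM FAB (borelF_cst c) (fun=> lexx _).
by under eq_fun do rewrite mulrC.
Qed.

Lemma bsupp_sum (I : Type) (r : seq I) A (B : I -> R) (F : I -> pt -> R) :
  0 <= A ->
  (forall i, bsupp 0 A (B i) (F i)) ->
  bsupp 0 A (\sum_(i <- r) B i) (fun x => \sum_(i <- r) F i x).
Proof.
move=> A0 h; elim: r => [|i r IH].
  rewrite big_nil; under eq_fun do rewrite big_nil; split => //; first exact: borelF_cst.
  by move=> x; rewrite normr0.
rewrite big_cons (_ : (fun x => _) = fun x => F i x + \sum_(j <- r) F j x).
  exact: bsuppD.
by apply/funext => x; rewrite big_cons.
Qed.

Lemma iter_intD k A B B' F G x : 0 <= A -> (k <= n)%N ->
  bsupp 0 A B F -> bsupp 0 A B' G ->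
  iter_int k (fun x => F x + G x) x = iter_int k F x + iter_int k G x.
Proof.
move=> A0 + FAB GAB; elim: k x => [//|k IH] x kn /=.
under eq_fun do rewrite (IH _ (ltnW kn)).
by rewrite RintegralD//; apply: bsupp1_integrable; apply: bsupp_iter_section;
  eassumption.
Qed.

Lemma iter_intZ k A B F c x : 0 <= A -> (k <= n)%N -> bsupp 0 A B F ->
  iter_int k (fun x => c * F x) x = c * iter_int k F x.
Proof.
move=> A0 + FAB; elim: k x => [//|k IH] x kn /=.
under eq_fun do rewrite (IH _ (ltnW kn)).
by rewrite RintegralZl//; apply: bsupp1_integrable; apply: bsupp_iter_section;
  eassumption.
Qed.

Lemma iter_int0 k x : iter_int k (fun _ : pt => 0) x = 0.
Proof.
elim: k x => [//|k IH] x /=; under eq_fun do rewrite IH.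
by rewrite /Rintegral integral0.
Qed.

Lemma iter_int_sum (I : Type) (r : seq I) k A (B : I -> R) (F : I -> pt -> R) x :
  0 <= A -> (k <= n)%N -> (forall i, bsupp 0 A (B i) (F i)) ->
  iter_int k (fun x => \sum_(i <- r) F i x) x = \sum_(i <- r) iter_int k (F i) x.
Proof.
move=> A0 kn h; elim: r => [|i r IH].
  by rewrite big_nil; under eq_fun do rewrite big_nil; rewrite iter_int0.
rewrite (_ : (fun x => _) = fun x => F i x + \sum_(j <- r) F j x).
  rewrite big_cons -IH; apply: (iter_intD x A0 kn (h i)).
  exact: (bsupp_sum r A0 h).
by apply/funext => y; rewrite big_cons.
Qed.

Lemma le_iter_int k A B A' B' F G x : 0 <= A -> 0 <= A' -> (k <= n)%N ->
  bsupp 0 A B F -> bsupp 0 A' B' G ->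
  (forall x, F x <= G x) -> iter_int k F x <= iter_int k G x.
Proof.
move=> A0 A0' + FAB GAB FG; elim: k x => [//|k IH] x kn /=.
apply: le_Rintegral => //.
- exact: bsupp1_integrable (bsupp_iter_section x A0 kn FAB).
- exact: bsupp1_integrable (bsupp_iter_section x A0' kn GAB).
- by move=> t _; apply: IH; exact: ltnW.
Qed.

Lemma iter_int_ge0 k F x : (forall x, 0 <= F x) -> 0 <= iter_int k F x.
Proof.
by move=> F0; elim: k x => [//|k IH] x /=; apply: Rintegral_ge0 => t _; exact: IH.
Qed.

Lemma iter_int_dct k A B (F_ : nat -> pt -> R) F x : 0 <= A -> (k <= n)%N ->
  (forall p, bsupp 0 A B (F_ p)) -> bsupp 0 A B F ->
  (forall x, F_ p x @[p --> \oo] --> F x) ->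
  iter_int k (F_ p) x @[p --> \oo] --> iter_int k F x.
Proof.
move=> A0 + F_AB FAB cF; elim: k x => [x _|k IH x kn /=]; first exact: cF.
apply: (@Rintegral_dct _ A (B * (2 * A) ^+ k)).
- by move=> p; apply: bsupp_iter_section.
- exact: bsupp_iter_section.
- by move=> t; apply: IH; exact: ltnW.
Qed.

(** A null set is represented by a nonnegative [D] of zero iterated integral. At each level the
    inner integrals of [D] vanish for almost every value of the next coordinate, and there the inner
    integrals of [F] and [G] agree by induction. *)
Lemma iter_int_null k A B D F G x : 0 <= A -> (k <= n)%N ->
  bsupp 0 A B D -> (forall x, 0 <= D x) -> borelF F -> borelF G ->
  (forall x, D x = 0 -> F x = G x) ->
  iter_int k D x = 0 -> iter_int k F x = iter_int k G x.
Proof.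
move=> A0 + DAB D0 mF mG FG; elim: k x => [x _|k IH x kn /=]; first exact: FG.
set u := fun t => iter_int k D (set_coord x k t) => Iu.
have uAB : bsupp1 A (B * (2 * A) ^+ k) u by exact: bsupp_iter_section.
have iu := bsupp1_integrable uAB.
have u0 t : 0 <= u t by exact: iter_int_ge0.
have ae : ae_eq mu setT (EFin \o u) (cst 0%E).
  apply/ae_eq_integral_abs => //; first by apply/measurable_EFinP; case: uAB.
  have E : (\int[mu]_t `|(EFin \o u) t| = \int[mu]_t (u t)%:E)%E.
    by apply: eq_integral => t _ /=; rewrite ger0_norm.
  rewrite E -(fineK (integrable_fin_num measurableT iu)).
  by move: Iu; rewrite /Rintegral => ->.
rewrite /Rintegral; congr fine; apply: ae_eq_integral => //.
- by apply/measurable_EFinP; apply: measurable_section; exact: borelF_iter_int.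
- by apply/measurable_EFinP; apply: measurable_section; exact: borelF_iter_int.
- apply: filterS ae => t /= h _; congr EFin; apply: IH; first exact: ltnW.
  by have [] := h I.
Qed.

(** A translation along coordinate [i] is absorbed when that coordinate is integrated; before that
    it is still visible in the base point. *)
Lemma iter_int_shift k A B F x (i : 'I_n) h : 0 <= A -> (k <= n)%N -> bsupp 0 A B F ->
  iter_int k (fun y => F (y + h *: ebase i)) x =
  if (i < k)%N then iter_int k F x else iter_int k F (x + h *: ebase i).
Proof.
move=> A0 + FAB; elim: k x => [//|k IH] x kn.
have hE (y : pt) (j : 'I_n) : (y + h *: ebase i) 0 j = y 0 j + (if j == i then h else 0).
  by rewrite !mxE eqxx /= [j == i]eq_sym; case: eqP => _; rewrite ?mulr1 ?mulr0.
rewrite /=; under eq_fun do rewrite (IH _ (ltnW kn)).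
have [ik|ki] := ltnP i k; first by rewrite ltnS (ltnW ik).
rewrite ltnS; have [ik|ik] := leqP i k.
  have Eik : (i : nat) = k by apply/eqP; rewrite eqn_leq ik.
  rewrite -[RHS](Rintegral_shift h (bsupp_iter_section x A0 kn FAB)).
  congr (Rintegral _ _ _); apply/funext => t; congr iter_int.
  apply/rowP => j; rewrite hE !set_coordE -Eik.
  by rewrite (inj_eq val_inj); case: eqP => _; rewrite ?addr0.
congr (Rintegral _ _ _); apply/funext => t; congr iter_int.
apply/rowP => j; rewrite hE !set_coordE hE.
have [->|ji] := eqVneq j i; last by rewrite !addr0.
by rewrite gtn_eqF.
Qed.

End IterInt.

(** * Null sets seen by iterated integrals *)

Section NullSets.
Context {R : realType} {n : nat}.
Local Notation pt := 'rV[R]_n.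
Local Notation mu := (@lebesgue_measure R).
Implicit Types (F G : pt -> R) (A B : R) (k : nat).

Definition boxk k (a b : pt) : set pt :=
  [set x | forall i : 'I_n, (k <= i)%N -> a 0 i <= x 0 i <= b 0 i].

Lemma closed_boxk k a b : closed (boxk k a b).
Proof.
have -> : boxk k a b = \bigcap_(i in [set i : 'I_n | (k <= i)%N])
    (fun x : pt => x 0 i) @^-1` `[a 0 i, b 0 i].
  apply/seteqP; split => x h i /=; first by move=> ki; rewrite in_itv/=; exact: h.
  by move=> ki; have := h i ki; rewrite /= in_itv.
apply: closed_bigI => i _; apply: closed_comp; last exact: interval_closed.
by move=> x _; exact: coord_continuous.
Qed.

Lemma borelF_indic (S : set pt) : measurable (S : set borelT) -> borelF (\1_S : pt -> R).
Proof. by move=> mS; exact: measurable_indic. Qed.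

Lemma indic_le1 (S : set pt) x : `|\1_S x : R| <= 1.
Proof. by rewrite indicE; case: (_ \in _); rewrite /= ?normr0 ?normr1. Qed.

Lemma bsupp_boxk (a b : pt) : exists2 A, 0 <= A & bsupp 0 A 1 (\1_(boxk 0 a b) : pt -> R).
Proof.
exists (\sum_i (`|a 0 i| + `|b 0 i|)); first by apply: sumr_ge0 => i _; rewrite addr_ge0.
split.
- by apply: borelF_indic; apply: closed_borel; exact: closed_boxk.
- exact: indic_le1.
- move=> x [i _ Ai]; rewrite indicE; case: (boolP (x \in _)) => //; rewrite inE => /(_ i isT) h.
  move: Ai; rewrite ltNge => /negP; case.
  rewrite (bigD1 i)//= (le_trans (y := `|a 0 i| + `|b 0 i|))//; last first.
    by rewrite lerDl sumr_ge0// => j _; rewrite addr_ge0.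
  case/andP: h => h1 h2; rewrite ler_norml; apply/andP; split.
  + rewrite lerNl (le_trans (y := - a 0 i))//; first by rewrite lerN2.
    by rewrite (le_trans (ler_norm _))// normrN lerDl.
  + by rewrite (le_trans h2)// (le_trans (ler_norm _))// lerDr.
Qed.

Lemma iter_int_boxk k (a b x : pt) : (k <= n)%N -> (forall i, a 0 i <= b 0 i) ->
  iter_int k (\1_(boxk 0 a b)) x =
  (\prod_(i < n | (i < k)%N) (b 0 i - a 0 i)) * (\1_(boxk k a b) x : R).
Proof.
move=> + ab; elim: k x => [x _|k IH x kn /=]; first by rewrite big_pred0// mul1r.
under eq_fun do rewrite (IH _ (ltnW kn)).
pose ko := Ordinal kn.
have E t : (\1_(boxk k a b) (set_coord x k t) : R) =
    (\1_(boxk k.+1 a b) x : R) * (\1_(`[a 0 ko, b 0 ko]) t : R).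
  rewrite !indicE -natrM mulnb; congr (_%:R); congr nat_of_bool.
  apply/idP/andP; rewrite !inE.
  - move=> h; split.
      by move=> i ki; have := h i (ltnW ki); rewrite set_coordE gtn_eqF.
    by have := h ko (leqnn _); rewrite set_coordE eqxx /= in_itv.
  - move=> [h1]; rewrite /= in_itv/= => h2 i; rewrite set_coordE leq_eqVlt.
    have [ik _|ik /=] := eqVneq (i : nat) k; last exact: h1.
    by rewrite (_ : i = ko) //; exact: val_inj.
under eq_fun do rewrite E mulrA.
rewrite RintegralZl//; last exact: integrable_indic_itv.
rewrite {1}/Rintegral integral_indic//= setIT.
rewrite [X in fine X](_ : _ = (b 0 ko - a 0 ko)%:E); last first.
  change (mu `[a 0 ko, b 0 ko] = (b 0 ko - a 0 ko)%:E).
  rewrite lebesgue_measure_itv/= lte_fin; have := ab ko.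
  by rewrite le_eqVlt => /orP[/eqP->|->]; rewrite ?ltxx ?subrr// EFinB.
rewrite [in RHS](bigD1 ko)//= mulrAC; congr (_ * _); rewrite mulrC; congr (_ * _).
by apply: eq_bigl => i; rewrite ltnS -(inj_eq val_inj) /= ltn_neqAle andbC.
Qed.

Lemma intRn_box (a b : pt) : (forall i, a 0 i <= b 0 i) ->
  intRn (\1_(boxk 0 a b)) = \prod_(i < n) (b 0 i - a 0 i).
Proof.
move=> ab; rewrite /intRn iter_int_boxk// indicE mem_set ?mulr1.
  by apply: eq_bigl => i; rewrite ltn_ord.
by move=> i; rewrite leqNgt ltn_ord.
Qed.

Definition cube A : set pt := boxk 0 (const_mx (- A)) (const_mx A).

Lemma cubeP A (x : pt) : cube A x <-> forall i, `|x 0 i| <= A.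
Proof.
split=> [h i|h i _]; last by rewrite !mxE -ler_norml.
by have := h i isT; rewrite !mxE -ler_norml.
Qed.

Lemma bsupp_indic_cube A (S : set pt) : measurable (S : set borelT) ->
  bsupp 0 A 1 (\1_(cube A `&` S) : pt -> R).
Proof.
move=> mS; split; [|exact: indic_le1|].
- apply: borelF_indic; apply: measurableI => //.
  by apply: closed_borel; exact: closed_boxk.
- move=> x [i _ Ai]; rewrite indicE; case: (boolP (x \in _)) => //.
  by rewrite inE => -[/cubeP/(_ i)]; rewrite leNgt Ai.
Qed.

(** [N] need not be Borel, so it is replaced by the intersection of its box covers at tolerances
    1/(q+1). Only finite sums of volumes are controlled; dominated convergence along finite unions
    carries the bound to each full cover. *)
Lemma nullRn_indic (N : set pt) A : nullRn N -> 0 <= A ->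
  exists D, [/\ bsupp 0 A 1 D, forall x, 0 <= D x, intRn D = 0 &
    forall x, N x -> cube A x -> D x = 1].
Proof.
move=> N0 A0.
have e0 (q : nat) : 0 < (q.+1%:R : R)^-1 by rewrite invr_gt0.
have [a ha] := choice (fun q => N0 _ (e0 q)).
have [b hb] := choice ha.
pose S q : set pt := \bigcup_p boxk 0 (a q p) (b q p).
have mbox (q p : nat) : measurable (boxk 0 (a q p) (b q p) : set borelT).
  by apply: closed_borel; exact: closed_boxk.
have mS q : measurable (S q : set borelT) by exact: bigcupT_measurable.
pose T : set pt := \bigcap_q S q.
have mT : measurable (T : set borelT) by exact: bigcapT_measurable.
exists (\1_(cube A `&` T)); split.
- exact: bsupp_indic_cube.
- by move=> x; rewrite indicE ler0n.
- apply/eqP; rewrite eq_le; apply/andP; split; last first.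
    by apply: iter_int_ge0 => x; rewrite indicE ler0n.
  have le q : intRn (\1_(cube A `&` T)) <= q.+1%:R^-1.
    apply: (@le_trans _ _ (intRn (\1_(cube A `&` S q)))).
      apply: (le_iter_int _ A0 A0 (leqnn n)); try exact: bsupp_indic_cube.
      move=> x; rewrite !indicE ler_nat.
      case: (boolP (x \in cube A `&` T)) => //; rewrite inE => -[h1 h2].
      by rewrite mem_set//; split => //; exact: h2.
    pose SP P : set pt := \bigcup_(p in `I_P) boxk 0 (a q p) (b q p).
    have mSP P : measurable (SP P : set borelT) by exact: bigcup_measurable.
    have cv : iter_int n (\1_(cube A `&` SP P)) 0 @[P --> \oo] -->
        iter_int n (\1_(cube A `&` S q)) 0.
      apply: (@iter_int_dct _ _ n A 1 (fun P => \1_(cube A `&` SP P) : pt -> R)) => // [P||x];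
        try exact: bsupp_indic_cube.
      have [[h1 [p _ h2]]|h] := pselect ((cube A `&` S q) x).
        apply: cvg_near_cst.
        exists p.+1 => // P /= pP; rewrite !indicE !mem_set//; split => //.
          by exists p.
        by exists p.
      rewrite indicE memNset//.
      apply: cvg_near_cst.
      apply: nearW => P; rewrite indicE memNset// => -[h1 [p _ h2]]; apply: h.
      by split => //; exists p.
    rewrite /intRn -(cvg_lim _ cv)//; apply: limr_le; first by apply/cvg_ex; eexists; exact: cv.
    apply: nearW => P.
    have [ab [_ /(_ P) vol]] := hb q.
    apply: le_trans vol.
    have h1 p : intRn (\1_(cube A `&` boxk 0 (a q p) (b q p))) <=
        \prod_(i < n) (b q p 0 i - a q p 0 i).
      rewrite -intRn_box; last exact: ab.
      have [A' A'0 bA'] := bsupp_boxk (a q p) (b q p).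
      apply: (le_iter_int _ A0 A'0 (leqnn n) _ bA'); first exact: bsupp_indic_cube.
      move=> x; rewrite !indicE ler_nat.
      case: (boolP (x \in cube A `&` _)) => //; rewrite inE => -[h1 h2].
      by rewrite mem_set.
    apply: (@le_trans _ _ (\sum_(p < P) intRn (\1_(cube A `&` boxk 0 (a q p) (b q p)))));
      last by apply: ler_sum => p _; exact: h1.
    rewrite /intRn -(@iter_int_sum _ _ _ _ n A (fun=> 1))//; last first.
      by move=> p; exact: bsupp_indic_cube.
    apply: (le_iter_int _ A0 A0 (leqnn n)); first exact: bsupp_indic_cube.
      by apply: bsupp_sum => // p; exact: bsupp_indic_cube.
    move=> x; rewrite indicE; case: (boolP (x \in _)) => [|_].
      rewrite inE => -[h2 [p /= pP h3]].
      have e1 : \1_(cube A `&` boxk 0 (a q p) (b q p)) x = 1 :> R by rewrite indicE mem_set.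
      by rewrite (bigD1 (Ordinal pP))//= -/(Ordinal pP) e1 lerDl sumr_ge0.
    by rewrite sumr_ge0// => j _; rewrite indicE ler0n.
  apply/ler_addgt0Pr => e e_gt0; rewrite add0r.
  have [k ke] := ltr_add_invr e_gt0.
  by apply: le_trans (le k) _; move: ke; rewrite add0r => /ltW.
- move=> x Nx cx; rewrite indicE mem_set//; split => // q _.
  have [_ [/(_ x Nx)[p hp] _]] := hb q.
  by exists p => // i _.
Qed.

End NullSets.

(** * Difference quotients and measurability of derivatives *)

Section Derivatives.
Context {R : realType} {n : nat}.
Local Notation pt := 'rV[R]_n.
Implicit Types (F G u : pt -> R) (A B : R) (k : nat).

Lemma coord_le_norm (v : pt) i : `|v 0 i| <= `|v|.
Proof.
rewrite [leRHS]/Num.Def.normr/= mx_normrE.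
exact: (le_bigmax _ (fun i => `|v i.1 i.2|) (0, i)).
Qed.

Lemma rV_norm_le (v : pt) (c : R) : 0 <= c -> (forall i, `|v 0 i| <= c) -> `|v| <= c.
Proof.
move=> c0 h; rewrite [leLHS]/Num.Def.normr/= mx_normrE (bigmax_le _ c0)// => -[i j] _ /=.
by rewrite (ord1 i).
Qed.

Lemma norm_ebase_le (i : 'I_n) : `|ebase i : pt| <= 1.
Proof.
apply: rV_norm_le => // j; rewrite mxE.
by case: (_ && _); rewrite /= ?normr0 ?normr1.
Qed.

Lemma rV_sum_ebase (v : pt) : v = \sum_i v 0 i *: ebase i.
Proof. exact: row_sum_delta. Qed.

Lemma borelF_shift F (v : pt) : borelF F -> borelF (fun x => F (x + v)).
Proof.
move=> mF; apply: (measurableT_comp mF); apply: measurable_coord_borel => i.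
have -> : (fun z : borelT => ((z : pt) + v) 0 i) = (fun z : borelT => (z : pt) 0 i + v 0 i).
  by apply/funext => z; rewrite mxE.
by apply: measurable_funD; [exact: borelF_coord|exact: measurable_cst].
Qed.

Lemma bsupp_shift A B F (v : pt) : bsupp 0 A B F ->
  bsupp 0 (A + `|v|) B (fun x => F (x + v)).
Proof.
move=> [mF FB F0]; split; [exact: borelF_shift|by move=> x; exact: FB|].
move=> x [i _ Ai]; apply: F0; exists i => //; rewrite mxE.
have := coord_le_norm v i; have := ler_distD (- v 0 i) (x 0 i) 0.
rewrite !subr0 opprK normrN; lra.
Qed.

Lemma intRn_shift A B F (v : pt) : 0 <= A -> bsupp 0 A B F ->
  intRn (fun x => F (x + v)) = intRn F.
Proof.
move=> A0 FAB; rewrite [v]rV_sum_ebase.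
elim: (index_enum _) A A0 F FAB => [|i r IH] A A0 F FAB.
  by rewrite big_nil; under eq_fun do rewrite addr0.
rewrite big_cons.
under eq_fun do rewrite addrA.
rewrite /intRn (iter_int_shift (F := fun x => F (x + \sum_(j <- r) v 0 j *: ebase j))
   0 i (v 0 i) _ (leqnn n) (bsupp_shift _ FAB)); last by rewrite addr_ge0.
by rewrite ltn_ord; apply: IH FAB.
Qed.

(** The offset [k] keeps all steps of the sequence below a prescribed size, so that local Lipschitz
    bounds apply to every term. *)
Lemma derivable_seq (u : pt -> R) (x v : pt) (k : nat) : derivable u x v ->
  (p + k).+1%:R * (u (x + (p + k).+1%:R^-1 *: v) - u x) @[p --> \oo] --> 'D_v u x.
Proof.
move=> du.
have h : (p + k).+1%:R^-1 @[p --> \oo] --> (0 : R).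
  by rewrite (cvg_shiftn k (fun p => p.+1%:R^-1 : R)); exact: (@cvg_harmonic R).
apply/cvgrPdist_lt => e e0.
move/cvgrPdist_lt : (du) => /(_ _ e0) [d /= d0 hd].
move/cvgrPdist_lt : h => /(_ _ d0); apply: filterS => p hp.
have := hd (p + k).+1%:R^-1 => /=.
rewrite invrK /shift /= [_ *: v + x]addrC; apply.
  by rewrite /ball_ /=.
by rewrite invr_neq0// pnatr_eq0.
Qed.

(** By Cauchy's criterion the set [C] where the quotients converge is a countable intersection of
    countable unions of the sets [S j d]; these are closed, as intersections, over possibly
    uncountably many pairs of steps, of closed sets. *)
Lemma borelF_derive u (v : pt) : continuous u -> borelF (fun x => 'D_v u x).
Proof.
move=> cu.
pose q (h : R) (x : pt) := h^-1 * (u (h *: v + x) - u x).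
have cq h : continuous (q h).
  move=> x; apply: (@continuousM _ _ (cst h^-1) (fun x => u (h *: v + x) - u x)).
    exact: cst_continuous.
  apply: (@continuousB _ _ _ (fun x => u (h *: v + x)) u); last exact: cu.
  apply: (continuous_comp (f := fun x => h *: v + x)); last exact: cu.
  apply: (@continuousD _ _ _ (cst (h *: v)) id); last exact: cvg_id.
  exact: cst_continuous.
pose C : set pt := [set x | cvg (q h x @[h --> 0^'])].
pose S (j d : nat) : set pt := \bigcap_(hh in [set hh : R * R |
     [/\ `|hh.1| < d.+1%:R^-1, `|hh.2| < d.+1%:R^-1, hh.1 != 0 & hh.2 != 0]])
     [set x | `|q hh.1 x - q hh.2 x| <= j.+1%:R^-1].
have mS j d : measurable (S j d : set borelT).
  apply: closed_borel; apply: closed_bigI => hh _.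
  apply: (closed_comp (f := fun x => `|q hh.1 x - q hh.2 x|) (D := [set t | t <= j.+1%:R^-1])).
    move=> x _; apply: (continuous_comp (f := fun x => q hh.1 x - q hh.2 x)); last exact: norm_continuous.
    by apply: (@continuousB _ _ _ (q hh.1) (q hh.2)); exact: cq.
  exact: closed_le.
have CE : C = \bigcap_j \bigcup_d S j d.
  apply/seteqP; split => x.
    move=> /cvg_ex[l] /cvgrPdist_lt hl j _.
    have e0 : 0 < (j.+1%:R : R)^-1 / 2 by rewrite divr_gt0// invr_gt0.
    have [d /= d0 hd] := hl _ e0.
    have [m md] := ltr_add_invr d0; rewrite add0r in md.
    exists m => // -[h1 h2] [/= l1 l2 n1 n2].
    have a1 := hd h1; have a2 := hd h2.
    have {}a1 : `|l - q h1 x| < j.+1%:R^-1 / 2.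
      by apply: a1 => //; rewrite /ball_/= sub0r normrN; exact: lt_trans md.
    have {}a2 : `|l - q h2 x| < j.+1%:R^-1 / 2.
      by apply: a2 => //; rewrite /ball_/= sub0r normrN; exact: lt_trans md.
    have := ler_distD l (q h1 x) (q h2 x); rewrite [`|q h1 x - l|]distrC /=.
    move: a1 a2; set c := (j.+1%:R^-1 : R).
    move: `|_| `|_| `|_| => r1 r2 r3; lra.
  move=> h; apply/cauchy_cvgP; apply: cauchy_exP => e e0.
  have [j je] := ltr_add_invr e0; rewrite add0r in je.
  have [d _ hd] := h j I.
  exists (q (d.+2%:R^-1) x); exists d.+1%:R^-1; first by rewrite /= invr_gt0.
  move=> h2 /=; rewrite sub0r normrN => h2d h20; rewrite /ball/=.
  apply: le_lt_trans je; apply: (hd (d.+2%:R^-1, h2)); split => //=.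
  by rewrite ger0_norm ?invr_ge0// ltf_pV2 ?posrE// ltr_nat.
have mC : measurable (C : set borelT).
  by rewrite CE; apply: bigcapT_measurable => j; exact: bigcupT_measurable.
(* Off [C] the derivative has the default value [point]; the second term reproduces it, so that [w]
   converges everywhere. *)
pose w (p : nat) (x : pt) : R :=
  \1_C x * (p + 0).+1%:R * (u (x + (p + 0).+1%:R^-1 *: v) - u x) + \1_(~` C) x * (point : R).
apply: (@measurable_fun_cvg _ borelT R setT w) => [p|x _].
  apply: measurable_funD; apply: measurable_funM => //.
  - by apply: measurable_funM => //; exact: borelF_indic.
  - apply: measurable_funB; last exact: continuous_borelF.
    by apply: borelF_shift; exact: continuous_borelF.
  - by apply: borelF_indic; exact: measurableC.
have [Cx|Cx] := pselect (C x).
  have e1 : \1_C x = 1 :> R by rewrite indicE mem_set.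
  have e2 : \1_(~` C) x = 0 :> R by rewrite indicE memNset//; exact.
  rewrite /w e1 e2; under eq_cvg do rewrite mul0r addr0 mul1r.
  exact: derivable_seq.
have e1 : \1_C x = 0 :> R by rewrite indicE memNset.
have e2 : \1_(~` C) x = 1 :> R by rewrite indicE mem_set.
rewrite /w e1 e2; under eq_cvg do rewrite !mul0r mul1r add0r.
have -> : 'D_v u x = point by rewrite /derive dvgP.
exact: cvg_cst.
Qed.

Lemma derive_off_cube A u (i : 'I_n) x :
  (forall x, ~ cube A x -> u x = 0) -> ~ cube A x ->
  derivable u x (ebase i) /\ 'D_(ebase i) u x = 0.
Proof.
move=> u0 nx.
have near0 : \near x, cst 0 x = u x.
  have o : open (~` (cube A : set pt)) by apply: closed_openC; exact: closed_boxk.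
  by apply: filterS (open_nbhs_nbhs (conj o nx)) => y /u0.
by have [] := near_eq_is_derive near0 (is_derive_cst 0 x (ebase i)).
Qed.

End Derivatives.

Section IntegralDerivative.
Context {R : realType} {n : nat}.
Local Notation pt := 'rV[R]_n.
Implicit Types (F G u : pt -> R) (A B : R) (k : nat).

(* Dominated convergence for difference quotients, whose integrals vanish by
   translation invariance. *)
Lemma intRn_derive0 u (N : set pt) (i : 'I_n) A B M (s0 : R) :
  0 <= A -> bsupp 0 A B u -> continuous u -> 0 < s0 ->
  (forall x s, 0 < s < s0 -> `|u (x + s *: ebase i) - u x| <= M * s) ->
  nullRn N -> (forall x, ~ N x -> derivable u x (ebase i)) ->
  intRn (fun x => 'D_(ebase i) u x) = 0.
Proof.
move=> A0 uAB cu s00 lip N0 dN.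
have A10 : 0 <= A + 1 by rewrite addr_ge0.
have [D [DA D0 ID DN]] := nullRn_indic N0 A10.
have D1 x : `|D x| <= 1 by case: DA.
have mD : borelF D by case: DA.
have uA1 : bsupp 0 (A + 1) B u by apply: bsuppW uAB _ _; rewrite ?lerDl.
have M0 : 0 <= M.
  have /(_ 0 (s0 / 2)) := lip; rewrite divr_gt0//= gtr_pMr// invf_lt1// ltr1n => /(_ isT) h.
  by rewrite -(pmulr_lge0 _ (divr_gt0 s00 (ltr0Sn _ 1))) (le_trans (normr_ge0 _) h).
have u0 x : ~ cube A x -> u x = 0.
  move=> nx; have [_ _] := uAB; apply.
  have /existsNP[i0 /negP] : ~ forall i, `|x 0 i| <= A by move=> h; apply: nx; apply/cubeP.
  by rewrite -ltNge; exists i0.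
have [k ks] := ltr_add_invr s00; rewrite add0r in ks.
pose h p : R := (p + k).+1%:R^-1.
have h0 p : 0 < h p by rewrite invr_gt0.
have hs p : h p < s0.
  by apply: le_lt_trans ks; rewrite lef_pV2 ?posrE// ler_nat ltnS leq_addl.
have h1 p : h p <= 1 by rewrite invf_le1// ler1n.
pose q p (x : pt) := (p + k).+1%:R * (u (x + h p *: ebase i) - u x).
have ush p : bsupp 0 (A + 1) B (fun x => u (x + h p *: ebase i)).
  apply: (bsuppW (bsupp_shift (h p *: ebase i) uAB)) => //.
  rewrite lerD2l normrZ gtr0_norm// -[leRHS]mulr1.
  by apply: ler_pM => //; [exact: ltW|exact: norm_ebase_le].
have dsh p : bsupp 0 (A + 1) (B + B * `|-1|) (fun x => u (x + h p *: ebase i) - u x).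
  under eq_fun do rewrite -mulN1r.
  by apply: bsuppD (ush p) _; apply: bsuppZ.
have qb p x : `|q p x| <= M.
  rewrite /q normrM ger0_norm// mulrC -ler_pdivlMr//.
  by apply: lip; rewrite h0 hs.
have mq p : borelF (q p) by have [] := bsuppZ (p + k).+1%:R (dsh p).
have qAB p : bsupp 0 (A + 1) M (q p).
  by have [_ _ h2] := bsuppZ (p + k).+1%:R (dsh p); split.
have Iq p : intRn (q p) = 0.
  rewrite /intRn /q (iter_intZ _ _ A10 (leqnn n) (dsh p)).
  rewrite (_ : (fun x => _) = (fun x => u (x + h p *: ebase i) + (-1) * u x)); last first.
    by apply/funext => x; rewrite mulN1r.
  rewrite (iter_intD _ A10 (leqnn n) (ush p) (bsuppZ (-1) uA1)).
  rewrite (iter_intZ _ _ A10 (leqnn n) uA1).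
  by have := intRn_shift (h p *: ebase i) A0 uAB; rewrite /intRn => ->; rewrite mulN1r subrr mulr0.
(* The quotients may diverge on [N]. The factor [1 - D] vanishes on [N] within the cube, which makes
   convergence hold everywhere, and it changes no integral because [D] has integral zero. *)
pose F_ p (x : pt) := q p x * (1 - D x).
pose F (x : pt) : R := 'D_(ebase i) u x * (1 - D x).
have mF : borelF (fun x => 'D_(ebase i) u x) by exact: borelF_derive.
have m1D : borelF (fun x => 1 - D x) by apply: measurable_funB => //; exact: borelF_cst.
have D1' x : `|1 - D x| <= 1.
  have := D1 x; rewrite ger0_norm ?D0// => Dx.
  by rewrite ger0_norm ?subr_ge0//; have := D0 x; lra.
have cvF x : F_ p x @[p --> \oo] --> F x.
  have dq : derivable u x (ebase i) -> F_ p x @[p --> \oo] --> F x.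
    by move=> dx; apply: cvgM; [exact: derivable_seq|exact: cvg_cst].
  have [Nx|] := pselect (N x); last by move=> /dN.
  have [cx|nx] := pselect (cube (A + 1) x).
    rewrite /F_ /F DN// subrr; under eq_cvg do rewrite mulr0; rewrite mulr0.
    exact: cvg_cst.
  apply: dq; apply: (derive_off_cube i u0 _).1 => cx; apply: nx.
  by apply/cubeP => j; move/cubeP: cx => /(_ j) /le_trans; apply; rewrite lerDl.
have F_AB p : bsupp 0 (A + 1) (M * 1) (F_ p) by exact: bsuppM.
have FAB : bsupp 0 (A + 1) (M * 1) F.
  split; first exact: measurable_funM.
  - move=> x; have /(cvg_norm) cx := cvF x.
    rewrite -(cvg_lim _ cx)//; apply: limr_le; first by apply/cvg_ex; eexists; exact: cx.
    by apply: nearW => p; have [_ + _] := F_AB p; apply.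
  - move=> x [j _ Aj]; rewrite /F (derive_off_cube i u0 _).2 ?mul0r// => /cubeP/(_ j).
    by rewrite leNgt (lt_trans _ Aj)// ltrDl.
have <- : intRn F = intRn (fun x => 'D_(ebase i) u x).
  apply: (iter_int_null A10 (leqnn n) DA D0) => //; first exact: measurable_funM.
  by move=> x Dx; rewrite /F Dx subr0 mulr1.
have cv := iter_int_dct (x := 0) A10 (leqnn n) F_AB FAB cvF.
have : intRn (F_ p) @[p --> \oo] --> (0 : R).
  apply: cvg_near_cst; apply: nearW => p; rewrite -(Iq p).
  apply: (iter_int_null A10 (leqnn n) DA D0) => //; first by case: (F_AB p).
  by move=> x Dx; rewrite /F_ Dx subr0 mulr1.
by move=> /cvg_lim <-//; apply/esym/cvg_lim.
Qed.

End IntegralDerivative.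

(** * Mollifiers *)

Section FlatExp.
Context {R : realType}.
Implicit Types (p q : {poly R}) (x y : R).

(** The classical flat function, with an arbitrary polynomial in 1/x as a factor so that the family
    is closed under differentiation. *)
Definition flatexp p x : R := if 0 < x then p.[x^-1] * expR (- x^-1) else 0.

Lemma poly_expRN_bounded p : exists2 C : R, 0 <= C &
  forall y, 0 < y -> `|p.[y] * expR (- y)| <= C.
Proof.
exists (\sum_(i < size p) `|p`_i| * i`!%:R).
  by apply: sumr_ge0 => i _; rewrite mulr_ge0.
move=> y y0; rewrite horner_coef mulr_suml (le_trans (ler_norm_sum _ _ _))//.
apply: ler_sum => i _; rewrite -mulrA normrM; apply: ler_wpM2l => //.
rewrite normrM !ger0_norm ?expR_ge0 ?exprn_ge0 ?(ltW y0)//.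
rewrite expRN ler_pdivrMr ?expR_gt0//.
case: (i : nat) => [|k].
  by rewrite expr0 fact0 mul1r -expR0 ler_expR ltW.
have := expR_ge1Dxn k (ltW y0) => h.
rewrite mulrC -ler_pdivrMr ?ltr0n ?fact_gt0//.
by apply: le_trans h; rewrite lerDr.
Qed.

Lemma flatexp_bounded p : exists2 C : R, 0 <= C & forall x, `|flatexp p x| <= C.
Proof.
have [C C0 h] := poly_expRN_bounded p; exists C => // x; rewrite /flatexp.
by case: ifP => x0; [apply: h; rewrite invr_gt0|rewrite normr0].
Qed.

Lemma is_derive_flatexp p x :
  is_derive x 1 (flatexp p) (flatexp ('X^2 * (p - p^`())) x).
Proof.
have [x0|x0|<-] := ltrgtP 0 x.
- have n0 : \near x, p.[x^-1] * expR (- x^-1) = flatexp p x.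
    near=> z; rewrite /flatexp; case: ifPn => //; rewrite -leNgt => z0.
    have : 0 < z by near: z; exact: lt_nbhsr.
    by rewrite ltNge z0.
  apply: (near_eq_is_derive n0).
  rewrite /flatexp x0.
  have xn0 : x != 0 by rewrite gt_eqF.
  have dinv : is_derive x 1 (fun z : R => z^-1) (- x ^- 2 *: (1 : R)).
    exact: (is_deriveV (f := id)).
  have d1 : is_derive x 1 (fun z : R => p.[z^-1]) (p^`().[x^-1] * (- x ^- 2 *: (1 : R))).
    exact: (is_derive1_comp (f := horner p) (g := fun z : R => z^-1)).
  have d2 : is_derive x 1 (fun z : R => expR (- z^-1)) (expR (- x^-1) * (- (- x ^- 2 *: (1 : R)))).
    exact: (is_derive1_comp (f := expR) (g := fun z : R => - z^-1)).
  apply: (is_derive_eq (is_deriveM d1 d2)).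
  rewrite !hornerE /= -!exprVn /GRing.scale /=; ring.
- have n0 : \near x, cst 0 x = flatexp p x.
    near=> z; rewrite /flatexp; case: ifPn => // z0.
    have : z < 0 by near: z; exact: lt_nbhsl.
    by rewrite ltNge (ltW z0).
  apply: (near_eq_is_derive n0); rewrite /flatexp ltNge (ltW x0) /=.
  exact: is_derive_cst.
(* At 0, for h > 0, the quotient p(1/h) exp(-1/h) / h is h times the corresponding bounded
   expression for X^2 p, hence tends to 0. *)
- have [C C0 hC] := poly_expRN_bounded ('X^2 * p).
  have cv : (fun h : R => h^-1 *: ((flatexp p \o shift 0) (h *: 1) - flatexp p 0)) @ 0^' --> (0 : R).
    apply/cvgrPdist_le => e e0.
    exists (e / (C + 1)); first by rewrite /= divr_gt0// ltr_wpDl.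
    move=> h /=; rewrite sub0r normrN => he h0.
    rewrite sub0r normrN addr0 [h *: 1]mulr1 /flatexp ltxx subr0.
    case: ifP => hp; last by rewrite scaler0 normr0 ltW.
    have hV : 0 < h^-1 by rewrite invr_gt0.
    have := hC _ hV; rewrite !hornerE /= => hb.
    rewrite /GRing.scale /=.
    have -> : h^-1 * (p.[h^-1] * expR (- h^-1)) = h * (h^-1 ^+ 2 * p.[h^-1] * expR (- h^-1)).
      by field.
    rewrite normrM (le_trans (ler_wpM2l (normr_ge0 _) hb))//.
    rewrite (le_trans (ler_wpM2r C0 (ltW he)))//.
    rewrite -mulrA -[leRHS]mulr1; apply: ler_wpM2l; first exact: ltW.
    by rewrite mulrC ler_pdivrMr ?mul1r ?lerDl// ltr_wpDl.
  have E : flatexp ('X^2 * (p - p^`())) 0 = 0 by rewrite /flatexp ltxx.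
  rewrite E; apply: DeriveDef; first by apply/cvg_ex; exists 0.
  exact: cvg_lim cv.
Unshelve. all: by end_near. Qed.

Lemma flatexp1_ge0 x : 0 <= flatexp 1 x.
Proof. by rewrite /flatexp; case: ifP => // _; rewrite hornerC mul1r expR_ge0. Qed.

Lemma flatexp1_ge_half x : 2^-1 <= x -> expR (- 2) <= flatexp 1 x.
Proof.
move=> hx; have x0 : 0 < x by apply: lt_le_trans hx.
rewrite /flatexp x0 hornerC mul1r ler_expR lerN2.
by rewrite -[leRHS]invrK lef_pV2 ?posrE// invr_gt0.
Qed.

End FlatExp.

Section Smooth.
Context {R : realType}.

Lemma is_derive_line (V : normedModType R) (f : V -> R) (x v : V) (s l : R) :
  is_derive (s *: v + x) v f l -> is_derive s 1 (fun t : R => f (t *: v + x)) l.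
Proof.
move=> [df fl].
have E : (fun h : R => h^-1 *: (((fun t : R => f (t *: v + x)) \o shift s) (h *: 1) - f (s *: v + x)))
    = (fun h => h^-1 *: ((f \o shift (s *: v + x)) (h *: v) - f (s *: v + x))).
  by apply/funext => h /=; rewrite [h *: 1]mulr1 scalerDl addrA.
by apply: DeriveDef; rewrite /derivable /derive E.
Qed.

Lemma mvt_line (V : normedModType R) (f : V -> R) (x v : V) (l : R -> R) :
  (forall s : R, 0 <= s <= 1 -> is_derive (s *: v + x) v f (l s)) ->
  exists2 s : R, 0 <= s <= 1 & f (x + v) - f x = l s.
Proof.
move=> h; pose u (t : R) := f (t *: v + x).
have du (s : R) : 0 <= s <= 1 -> is_derive s 1 u (l s) by move=> /h; exact: is_derive_line.
have cu : {within `[0, 1], continuous u}.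
  apply: derivable_within_continuous => s; rewrite in_itv/= => /du sd.
  exact: ex_derive.
have [|s s01] := @MVT_segment R u l 0 1 ler01 _ cu.
  by move=> s; rewrite in_itv/= => /andP[s0 s1]; apply: du; rewrite !ltW.
rewrite /u scale1r scale0r add0r subr0 mulr1 => E.
by exists s; [move: s01; rewrite in_itv|rewrite [x + v]addrC].
Qed.

Context {n : nat}.
Local Notation pt := 'rV[R]_n.

(* A class of functions closed under partial derivatives, hence consisting of
   smooth functions. *)
Inductive smooth : (pt -> R) -> Prop :=
| smooth_cst c : smooth (fun _ => c)
| smooth_flat p (a b : R) i : smooth (fun x => flatexp p (a * x 0 i + b))
| smoothD f g : smooth f -> smooth g -> smooth (fun x => f x + g x)
| smoothM f g : smooth f -> smooth g -> smooth (fun x => f x * g x).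

Lemma smooth_differentiable f : smooth f -> forall x, differentiable f x.
Proof.
elim=> [c x|p a b i x|g h _ dg _ dh x|g h _ dg _ dh x].
- exact: differentiable_cst.
- apply: (differentiable_comp (f := fun x : pt => a * x 0 i + b)).
    apply: differentiableD; last exact: differentiable_cst.
    apply: (differentiableZ (f := fun x : pt => x 0 i)).
    exact: differentiable_coord.
  by apply/derivable1_diffP; have [] := is_derive_flatexp p (a * x 0 i + b).
- by apply: differentiableD; [exact: dg|exact: dh].
- by apply: differentiableM; [exact: dg|exact: dh].
Qed.

Lemma ebase_coord (i j : 'I_n) : (ebase j : pt) 0 i = (i == j)%:R.
Proof. by rewrite mxE eqxx. Qed.

Lemma smooth_derive f j : smooth f ->
  exists2 g, smooth g & forall x, is_derive x (ebase j) f (g x).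
Proof.
elim=> [c|p a b i|f1 f2 s1 [g1 sg1 d1] s2 [g2 sg2 d2]|f1 f2 s1 [g1 sg1 d1] s2 [g2 sg2 d2]].
- exists (fun=> 0); first exact: smooth_cst.
  by move=> x; exact: is_derive_cst.
- pose k := a * (i == j)%:R.
  exists (fun x => k * flatexp ('X^2 * (p - p^`())) (a * x 0 i + b)).
    by apply: smoothM; [exact: smooth_cst|exact: smooth_flat].
  move=> x.
  have dl : is_derive (0 : R) 1 (fun t : R => k * t + (a * x 0 i + b)) k.
    have h1 := is_deriveZ k (is_derive_id (0 : R) (1 : R)).
    apply: (is_derive_eq (is_deriveD h1 (is_derive_cst (a * x 0 i + b) (0 : R) (1 : R)))).
    by rewrite addr0 [_ *: _]mulr1.
  have E : (fun t : R => flatexp p (a * (t *: ebase j + x) 0 i + b)) =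
     (fun t => flatexp p (k * t + (a * x 0 i + b))).
    by apply/funext => t; rewrite !mxE eqxx /= /k; congr flatexp; ring.
  have := @is_derive1_comp _ (flatexp p) (fun t : R => k * t + (a * x 0 i + b)) 0 _ _
    (is_derive_flatexp p _) dl.
  rewrite mulr0 add0r [_ * k]mulrC => -[d3 e3].
  have F (h : R) : h^-1 *: (((fun t : R => flatexp p (k * t + (a * x 0 i + b))) \o shift 0) (h *: 1) -
       flatexp p (k * 0 + (a * x 0 i + b))) =
     h^-1 *: (((fun x : pt => flatexp p (a * x 0 i + b)) \o shift x) (h *: ebase j) -
       flatexp p (a * x 0 i + b)).
    rewrite /= addr0 [h *: 1]mulr1 mulr0 add0r; congr (_ *: (flatexp _ _ - _)).
    by rewrite !mxE eqxx /= /k; ring.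
  have FE := funext F.
  by apply: DeriveDef; rewrite /derivable /derive -FE; [exact: d3|exact: e3].
- exists (fun x => g1 x + g2 x); first exact: smoothD.
  by move=> x; exact: is_deriveD.
- exists (fun x => f1 x * g2 x + f2 x * g1 x).
    by apply: smoothD; exact: smoothM.
  by move=> x; exact: is_deriveM.
Qed.

Lemma smooth_bounded f : smooth f -> exists2 C : R, 0 <= C & forall x, `|f x| <= C.
Proof.
elim=> [c|p a b i|g h _ [C C0 gC] _ [D D0 hD]|g h _ [C C0 gC] _ [D D0 hD]].
- by exists `|c|.
- by have [C C0 h] := flatexp_bounded p; exists C.
- exists (C + D); first exact: addr_ge0.
  by move=> x; rewrite (le_trans (ler_normD _ _))// lerD.
- by exists (C * D); [exact: mulr_ge0|move=> x; rewrite normrM ler_pM].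
Qed.

Lemma smooth_affine f (c : R) (x0 : pt) : smooth f -> smooth (fun y => f (c *: (y - x0))).
Proof.
elim=> [k|p a b i|g h _ sg _ sh|g h _ sg _ sh].
- exact: smooth_cst.
- rewrite (_ : (fun y => _) = fun y : pt => flatexp p (a * c * y 0 i + (b - a * c * x0 0 i))).
    exact: smooth_flat.
  by apply/funext => y; rewrite !mxE; congr flatexp; ring.
- exact: smoothD.
- exact: smoothM.
Qed.

Lemma smooth_prod (I : Type) (r : seq I) (F : I -> pt -> R) :
  (forall i, smooth (F i)) -> smooth (fun x => \prod_(i <- r) F i x).
Proof.
move=> sF; elim: r => [|i r IH].
  by under eq_fun do rewrite big_nil; exact: smooth_cst.
rewrite (_ : (fun x => _) = fun x => F i x * \prod_(j <- r) F j x).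
  exact: smoothM.
by apply/funext => x; rewrite big_cons.
Qed.

Lemma smooth_continuous f : smooth f -> continuous f.
Proof. by move=> sf x; apply/differentiable_continuous/smooth_differentiable. Qed.

Lemma smooth_Dop f (l : seq 'I_n) : smooth f -> smooth (Dop l f).
Proof.
move=> sf; elim: l => [//|i l IH] /=.
have [g sg dg] := smooth_derive i IH.
by rewrite (_ : (fun x => _) = g)//; apply/funext => x; exact: derive_val.
Qed.

Lemma smooth_is_derive f (g : 'I_n -> pt -> R) (x v : pt) :
  smooth f -> (forall j, is_derive x (ebase j) f (g j x)) ->
  is_derive x v f (\sum_j v 0 j * g j x).
Proof.
move=> sf hg; have df := smooth_differentiable sf x.
apply: DeriveDef; first exact: diff_derivable.
rewrite deriveE// {1}(rV_sum_ebase v) linear_sum; apply: eq_bigr => j _.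
by rewrite linearZ /=; congr (_ * _); rewrite -deriveE// derive_val.
Qed.

Lemma smooth_lipschitz f : smooth f ->
  exists2 C : R, 0 <= C & forall x v, `|f (x + v) - f x| <= C * `|v|.
Proof.
move=> sf.
have [g hg] := choice (fun j => let: ex_intro2 g a b := smooth_derive j sf in ex_intro _ g (conj a b)).
have [C hC] := choice (fun j => let: ex_intro2 g a b := smooth_bounded (hg j).1 in ex_intro _ g (conj a b)).
exists (\sum_j C j); first by apply: sumr_ge0 => j _; exact: (hC j).1.
move=> x v; have [s _ ->] := @mvt_line _ f x v (fun s => \sum_j v 0 j * g j (s *: v + x))
   (fun s _ => smooth_is_derive v sf (fun j => (hg j).2 _)).
rewrite (le_trans (ler_norm_sum _ _ _))// mulr_suml; apply: ler_sum => j _.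
rewrite normrM mulrC; apply: ler_pM => //; first exact: (hC j).2.
exact: coord_le_norm.
Qed.

Lemma smooth_taylor f (g : 'I_n -> pt -> R) : smooth f ->
  (forall j, smooth (g j)) -> (forall j x, is_derive x (ebase j) f (g j x)) ->
  exists2 C : R, 0 <= C &
    forall x v, `|f (x + v) - f x - \sum_j v 0 j * g j x| <= C * `|v| ^+ 2.
Proof.
move=> sf sg dg.
have [C hC] := choice (fun j => let: ex_intro2 g a b := smooth_lipschitz (sg j) in ex_intro _ g (conj a b)).
exists (\sum_j C j); first by apply: sumr_ge0 => j _; exact: (hC j).1.
move=> x v; have [s /andP[s0 s1] ->] := @mvt_line _ f x v (fun s => \sum_j v 0 j * g j (s *: v + x))
   (fun s _ => smooth_is_derive v sf (fun j => dg j _)).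
rewrite -sumrB (le_trans (ler_norm_sum _ _ _))// mulr_suml; apply: ler_sum => j _.
rewrite -mulrBr normrM.
have h := (hC j).2 x (s *: v).
have h2 : `|g j (s *: v + x) - g j x| <= C j * `|v|.
  rewrite [s *: v + x]addrC (le_trans h)//; apply: ler_wpM2l; first exact: (hC j).1.
  by rewrite normrZ ger0_norm// ler_piMl.
rewrite expr2 mulrCA; apply: ler_pM => //; exact: coord_le_norm.
Qed.

End Smooth.

(** * A compactly supported bump and its rescalings *)

Section Bump.
Context {R : realType} {n : nat}.
Local Notation pt := 'rV[R]_n.

Definition bumpf (z : pt) : R :=
  \prod_(i < n) (flatexp 1 (1 * z 0 i + 1) * flatexp 1 (- 1 * z 0 i + 1)).

Lemma bump_smooth : smooth bumpf.
Proof. by apply: smooth_prod => i; apply: smoothM; exact: smooth_flat. Qed.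

Lemma bump_ge0 (z : pt) : 0 <= bumpf z.
Proof. by apply: prodr_ge0 => i _; rewrite mulr_ge0// flatexp1_ge0. Qed.

Lemma bump_out (z : pt) : ~ cube 1 z -> bumpf z = 0.
Proof.
move=> nz; have /existsNP[i /negP] : ~ forall i, `|z 0 i| <= 1 by move=> h; apply: nz; apply/cubeP.
rewrite -ltNge lter_normr => zi; rewrite /bumpf (bigD1 i)//= /flatexp.
case: ifP => h1; last by rewrite !mul0r.
case: ifP => h2; last by rewrite mulr0 mul0r.
by exfalso; case/orP: zi => zi; lra.
Qed.

Lemma bump_in (z : pt) : (forall i, `|z 0 i| <= 2^-1) -> (expR (- 2) ^+ 2) ^+ n <= bumpf z.
Proof.
move=> hz; rewrite -[X in _ ^+ X]card_ord -prodr_const; apply: ler_prod => i _.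
rewrite exprn_ge0 ?expR_ge0//= expr2.
by have := hz i; rewrite ler_norml => /andP[h1 h2]; apply: ler_pM;
  rewrite ?expR_ge0//; apply: flatexp1_ge_half; lra.
Qed.

Definition dbump (i : 'I_n) (z : pt) : R := 'D_(ebase i) bumpf z.

Lemma dbump_smooth i : smooth (dbump i).
Proof. exact: (smooth_Dop [:: i] bump_smooth). Qed.

Lemma is_derive_dbump i (z : pt) : is_derive z (ebase i) bumpf (dbump i z).
Proof. by apply/derivableP/diff_derivable/smooth_differentiable/bump_smooth. Qed.

Lemma dbump_out i (z : pt) : ~ cube 1 z -> dbump i z = 0.
Proof. by move=> nz; have [] := derive_off_cube i (@bump_out) nz. Qed.

Lemma bump_estimates : exists C : R, [/\ 0 <= C,
  forall z, `|bumpf z| <= C, forall i z, `|dbump i z| <= C,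
  forall z v, `|bumpf (z + v) - bumpf z| <= C * `|v| &
  forall z v, `|bumpf (z + v) - bumpf z - \sum_j v 0 j * dbump j z| <= C * `|v| ^+ 2].
Proof.
have [C1 C10 h1] := smooth_bounded bump_smooth.
have [C2 h2] := choice (fun j => let: ex_intro2 g a b := smooth_bounded (dbump_smooth j) in ex_intro _ g (conj a b)).
have [C3 C30 h3] := smooth_lipschitz bump_smooth.
have [C4 C40 h4] := smooth_taylor bump_smooth dbump_smooth is_derive_dbump.
have S0 : 0 <= \sum_j C2 j by apply: sumr_ge0 => j _; exact: (h2 j).1.
have S2 j : C2 j <= \sum_j C2 j.
  by rewrite (bigD1 j)//= lerDl sumr_ge0// => i _; exact: (h2 i).1.
exists (C1 + \sum_j C2 j + C3 + C4); split.
- by rewrite !addr_ge0.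
- by move=> z; apply: le_trans (h1 z) _; lra.
- by move=> i z; apply: le_trans ((h2 i).2 z) _; have := S2 i; lra.
- by move=> z v; apply: le_trans (h3 z v) _; apply: ler_wpM2r => //; lra.
- by move=> z v; apply: le_trans (h4 z v) _; apply: ler_wpM2r; [exact: exprn_ge0|lra].
Qed.

Definition bumpat (x : pt) (e : R) (y : pt) : R := bumpf (e^-1 *: (y - x)).

Lemma bumpat_smooth x e : smooth (bumpat x e).
Proof. exact: smooth_affine bump_smooth. Qed.

Lemma bumpat_ge0 x e y : 0 <= bumpat x e y.
Proof. exact: bump_ge0. Qed.

Lemma cube_rescale (x : pt) (e : R) (y : pt) : 0 < e ->
  cube 1 (e^-1 *: (y - x)) <-> `|y - x| <= e.
Proof.
move=> e0; have E i : (e^-1 *: (y - x)) 0 i = e^-1 * (y - x) 0 i by rewrite mxE.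
split=> [/cubeP h|h].
  apply: rV_norm_le => [|i]; first exact: ltW.
  have := h i; rewrite E normrM gtr0_norm ?invr_gt0//.
  by rewrite ler_pdivrMl// mulr1.
apply/cubeP => i; rewrite E normrM gtr0_norm ?invr_gt0// ler_pdivrMl// mulr1.
exact: le_trans (coord_le_norm _ i) h.
Qed.

Lemma bumpat_out x e y : 0 < e -> e < `|y - x| -> bumpat x e y = 0.
Proof.
by move=> e0 ey; apply: bump_out => /(cube_rescale x y e0); rewrite leNgt ey.
Qed.

Lemma bumpat_derive x e y i : 'D_(ebase i) (bumpat x e) y = e^-1 * dbump i (e^-1 *: (y - x)).
Proof.
have := smooth_is_derive (e^-1 *: ebase i) bump_smooth (fun j => is_derive_dbump j (e^-1 *: (y - x))).
rewrite (bigD1 i)//= big1 ?addr0 => [|j ji]; last by rewrite !mxE (negbTE ji) /= mulr0 mul0r.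
rewrite mxE ebase_coord eqxx mulr1 => -[_ <-].
have E : (fun h : R => h^-1 *: ((bumpat x e \o shift y) (h *: ebase i) - bumpat x e y)) =
    (fun h => h^-1 *: ((bumpf \o shift (e^-1 *: (y - x))) (h *: (e^-1 *: ebase i)) -
       bumpf (e^-1 *: (y - x)))).
  apply/funext => h /=; congr (_ *: (_ - _)); rewrite /bumpat; congr bumpf.
  by rewrite -addrA scalerDr !scalerA mulrC.
by rewrite /derive E.
Qed.

End Bump.

(** * Unnormalized mollification *)

Section Mollification.
Context {R : realType} {n : nat}.
Local Notation pt := 'rV[R]_n.
Implicit Types (F G g : pt -> R) (A B : R).

Lemma bsuppMr A B B' G F : bsupp 0 A B G -> continuous F ->
  (forall x, `|F x| <= B') -> bsupp 0 A (B * B') (fun y => G y * F y).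
Proof. by move=> hG cF; apply: bsuppM => //; exact: continuous_borelF. Qed.

Lemma le_normr_intRn A A' B B' F G : 0 <= A -> 0 <= A' -> bsupp 0 A B F -> bsupp 0 A' B' G ->
  (forall x, `|F x| <= G x) -> `|intRn F| <= intRn G.
Proof.
move=> A0 A0' hF hG FG; rewrite ler_norml; apply/andP; split; last first.
  apply: (le_iter_int _ A0 A0' (leqnn n) hF hG) => x.
  exact: le_trans (ler_norm _) (FG x).
rewrite lerNl /intRn -mulN1r -(iter_intZ (-1) _ A0 (leqnn n) hF).
apply: (le_iter_int _ A0 A0' (leqnn n) (bsuppZ (-1) hF) hG) => x.
by rewrite mulN1r (le_trans _ (FG x))// -normrN ler_norm.
Qed.

Lemma intRn_cube_bound A B F : 0 <= A -> bsupp 0 A B F -> `|intRn F| <= B * (2 * A) ^+ n.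
Proof. by move=> A0 hF; have [_ + _] := bsupp_iter A0 (leqnn n) hF; apply. Qed.

Definition mollif G (e : R) (x : pt) : R := intRn (fun y => G y * bumpat x e y).
Definition dmollif G (e : R) (i : 'I_n) (x : pt) : R :=
  intRn (fun y => G y * 'D_(ebase i) (bumpat x e) y).

Lemma bumpat_shift e (x w y : pt) :
  bumpat (x + w) e y = bumpf (e^-1 *: (y - x) + - (e^-1 *: w)).
Proof. by rewrite /bumpat opprD addrA scalerBr. Qed.

Lemma bumpat_continuous x e : continuous (bumpat x e : pt -> R).
Proof. exact: smooth_continuous (bumpat_smooth x e). Qed.

Lemma dbumpat_continuous x e i : continuous (fun y : pt => 'D_(ebase i) (bumpat x e) y).
Proof.
have := smooth_continuous (smooth_Dop [:: i] (bumpat_smooth x e)).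
exact.
Qed.

Lemma dbumpat_bounded x e : exists B : R, forall i (y : pt), `|'D_(ebase i) (bumpat x e) y| <= B.
Proof.
have [C [C0 _ h2 _ _]] := @bump_estimates R n.
exists (`|e^-1| * C) => i y; rewrite bumpat_derive normrM.
exact: ler_wpM2l (h2 i _).
Qed.

(** The expansion falls on the bump, so [G] needs no regularity. Moving the centre by [w] moves the
    argument of the bump by [- w / e], whence the plus sign in front of the sum. The constant blows
    up as [e] tends to 0, which is harmless since it never enters a final bound. *)
Lemma mollif_taylor A B G e : 0 <= A -> bsupp 0 A B G -> 0 < e ->
  exists2 K, 0 <= K & forall x w,
    `|mollif G e (x + w) - mollif G e x| <= K * `|w| /\
    `|mollif G e (x + w) - mollif G e x + \sum_j w 0 j * dmollif G e j x| <= K * `|w| ^+ 2.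
Proof.
move=> A0 hG e0.
have B0 := bsupp_ge0 hG.
have [C [C0 C1 C2 C3 C4]] := @bump_estimates R n.
have V0 : 0 <= (2 * A) ^+ n by rewrite exprn_ge0// mulr_ge0.
have eV0 : 0 <= e^-1 by rewrite invr_ge0 ltW.
have hb x : bsupp 0 A (B * C) (fun y => G y * bumpat x e y).
  by apply: bsuppMr => //; [exact: bumpat_continuous|move=> y; exact: C1].
have hd x i : bsupp 0 A (B * (e^-1 * C)) (fun y => G y * 'D_(ebase i) (bumpat x e) y).
  apply: bsuppMr => //; first exact: dbumpat_continuous.
  by move=> y; rewrite bumpat_derive normrM ger0_norm//; apply: ler_wpM2l.
pose K := B * (C * e^-1) * (2 * A) ^+ n + B * (C * e^-1 ^+ 2) * (2 * A) ^+ n.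
have K10 : 0 <= B * (C * e^-1) * (2 * A) ^+ n by rewrite !mulr_ge0.
have K20 : 0 <= B * (C * e^-1 ^+ 2) * (2 * A) ^+ n by rewrite !mulr_ge0// exprn_ge0.
exists K; first by rewrite /K addr_ge0.
move=> x w.
have mollifB : mollif G e (x + w) - mollif G e x =
    intRn (fun y => G y * (bumpat (x + w) e y - bumpat x e y)).
  rewrite /mollif /intRn -mulN1r -(iter_intZ (-1) _ A0 (leqnn n) (hb x)).
  rewrite -(iter_intD _ A0 (leqnn n) (hb (x + w)) (bsuppZ (-1) (hb x))).
  by congr iter_int; apply/funext => y; ring.
have nw : `|- (e^-1 *: w)| = e^-1 * `|w| by rewrite normrN normrZ ger0_norm.
have cD : continuous (fun y => bumpat (x + w) e y - bumpat x e y).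
  by move=> y; apply: (@continuousB _ _ _ (bumpat (x + w) e) (bumpat x e)); exact: bumpat_continuous.
split.
  rewrite mollifB.
  have h : bsupp 0 A (B * (C * (e^-1 * `|w|))) (fun y => G y * (bumpat (x + w) e y - bumpat x e y)).
    apply: bsuppMr => // y.
    by rewrite bumpat_shift (le_trans (C3 _ _))// nw.
  apply: le_trans (intRn_cube_bound A0 h) _.
  have -> : B * (C * (e^-1 * `|w|)) * (2 * A) ^+ n = B * (C * e^-1) * (2 * A) ^+ n * `|w| by ring.
  by apply: ler_wpM2r => //; rewrite /K lerDl.
have sumE : \sum_j w 0 j * dmollif G e j x =
    intRn (fun y => \sum_j w 0 j * (G y * 'D_(ebase j) (bumpat x e) y)).
  rewrite /intRn (iter_int_sum _ _ A0 (leqnn n) (fun j => bsuppZ (w 0 j) (hd x j))).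
  apply: eq_bigr => j _.
  by rewrite (iter_intZ _ _ A0 (leqnn n) (hd x j)).
have hS := bsupp_sum (index_enum 'I_n) A0 (fun j => bsuppZ (w 0 j) (hd x j)).
have hB : bsupp 0 A (B * (C * (e^-1 * `|w|))) (fun y => G y * (bumpat (x + w) e y - bumpat x e y)).
  by apply: bsuppMr => // y; rewrite bumpat_shift (le_trans (C3 _ _))// nw.
rewrite mollifB sumE /intRn -(iter_intD _ A0 (leqnn n) hB hS).
pose T (y : pt) := G y * (bumpf (e^-1 *: (y - x) + - (e^-1 *: w)) - bumpf (e^-1 *: (y - x)) -
     \sum_j (- (e^-1 *: w)) 0 j * dbump j (e^-1 *: (y - x))).
have E : (fun y => G y * (bumpat (x + w) e y - bumpat x e y) +
    \sum_j w 0 j * (G y * 'D_(ebase j) (bumpat x e) y)) = T.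
  apply/funext => y; rewrite /T bumpat_shift [RHS]mulrBr [in RHS]mulr_sumr; congr (_ + _).
  rewrite -sumrN; apply: eq_bigr => j _.
  by rewrite bumpat_derive !mxE; ring.
rewrite E.
have hT : bsupp 0 A (B * (C * (e^-1 * `|w|) ^+ 2)) T.
  split.
  - have [h _ _] := bsuppD hB hS.
    by move: h; rewrite E.
  - move=> y; rewrite /T normrM; apply: ler_pM => //; first by case: hG.
    by rewrite -nw; exact: C4.
  - by move=> y hy; have [_ _ h] := hG; rewrite /T h// mul0r.
apply: le_trans (intRn_cube_bound A0 hT) _.
have -> : B * (C * (e^-1 * `|w|) ^+ 2) * (2 * A) ^+ n = B * (C * e^-1 ^+ 2) * (2 * A) ^+ n * `|w| ^+ 2 by ring.
by apply: ler_wpM2r; [exact: exprn_ge0|rewrite /K lerDr].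
Qed.

Lemma supp_ball A (x0 : pt) (d : R) F : `|x0| + d <= A ->
  (forall y, d < `|y - x0| -> F y = 0) ->
  forall y : pt, (exists2 i : 'I_n, (0 <= i)%N & A < `|y 0 i|) -> F y = 0.
Proof.
move=> hA F0 y [i _ Ai]; apply: F0.
have := coord_le_norm y i; have := ler_normD (y - x0) x0; rewrite subrK; lra.
Qed.

Lemma bumpat_bsupp A (x : pt) (e : R) : 0 < e -> `|x| + e <= A ->
  exists2 C, 0 <= C & bsupp 0 A C (bumpat x e).
Proof.
move=> e0 hA; have [C [C0 C1 _ _ _]] := @bump_estimates R n.
exists C => //; split.
- by apply: continuous_borelF; exact: bumpat_continuous.
- by move=> y; exact: C1.
- by apply: supp_ball hA _ => y; exact: bumpat_out.
Qed.

(** The bumps are not normalized: estimates carry this factor on both sides, and it is cancelled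
    once the scale has been chosen. The lower bound of order [e ^+ n] below is what lets it dominate
    error terms. *)
Definition bump_mass (e : R) : R := intRn (bumpat (0 : pt) e).

Lemma intRn_bumpat (x : pt) e : 0 < e -> intRn (bumpat x e) = bump_mass e.
Proof.
move=> e0; have A0 : 0 <= `|x| + e by rewrite addr_ge0// ltW.
have [C _ h] := bumpat_bsupp e0 (lexx (`|x| + e)).
rewrite /bump_mass -(intRn_shift x A0 h); congr intRn.
by apply/funext => y; rewrite /bumpat addrK subr0.
Qed.

Lemma bump_mass_ge : exists2 c : R, 0 < c & forall e, 0 < e -> c * e ^+ n <= bump_mass e.
Proof.
exists ((expR (- 2) ^+ 2) ^+ n); first by rewrite !exprn_gt0// expR_gt0.
move=> e e0; set c := _ ^+ n.
pose a : pt := const_mx (- (e / 2)); pose b : pt := const_mx (e / 2).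
have -> : c * e ^+ n = intRn (fun x => c * \1_(boxk 0 a b) x).
  have [A A0 hA] := bsupp_boxk a b.
  rewrite /intRn (iter_intZ _ _ A0 (leqnn n) hA); congr (_ * _).
  have := @intRn_box R n a b; rewrite /intRn => -> => [|i].
    rewrite -[X in _ ^+ X]card_ord -prodr_const; apply: eq_bigr => i _.
    by rewrite !mxE; lra.
  by rewrite !mxE; lra.
have [A A0 hA] := bsupp_boxk a b.
have A0' : 0 <= `|0 : pt| + e by rewrite addr_ge0// ltW.
have [C _ h] := bumpat_bsupp e0 (lexx (`|0 : pt| + e)).
apply: (le_iter_int _ A0 A0' (leqnn n) (bsuppZ c hA) h) => x.
rewrite indicE; case: (boolP (x \in _)) => [|_]; last by rewrite mulr0 bumpat_ge0.
rewrite inE mulr1 => hx; apply: bump_in => i; rewrite subr0 mxE normrM.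
have := hx i isT; rewrite !mxE -ler_norml => hi.
by rewrite ger0_norm ?invr_ge0 ?(ltW e0)// mulrC ler_pdivrMr// mulrC.
Qed.

Lemma bump_mass_gt0 e : 0 < e -> 0 < bump_mass e.
Proof.
by move=> e0; have [c c0 /(_ e e0)] := bump_mass_ge; apply: lt_le_trans; rewrite mulr_gt0// exprn_gt0.
Qed.

Lemma intRn_ball_bound A B F (x : pt) (e : R) : 0 < e -> 0 <= A -> bsupp 0 A B F ->
  (forall y, e < `|y - x| -> F y = 0) -> `|intRn F| <= B * (2 * e) ^+ n.
Proof.
move=> e0 A0 hF F0.
rewrite -(intRn_shift x A0 hF).
apply: intRn_cube_bound; first exact: ltW.
split; [by apply: borelF_shift; case: hF|by move=> y; case: hF => _ + _; apply|].
move=> y [i _ yi]; apply: F0; rewrite addrK.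
exact: lt_le_trans (coord_le_norm y i).
Qed.

End Mollification.

(** * Weak derivatives and paths *)

Section WeakBound.
Context {R : realType} {n : nat}.
Local Notation pt := 'rV[R]_n.
Implicit Types (F : pt -> pt) (G g : pt -> R) (A B : R).

Definition cball (x0 : pt) (d : R) : set pt := [set y | `|y - x0| <= d].

Lemma closed_cball x0 d : closed (cball x0 d).
Proof.
apply: (closed_comp (f := fun y : pt => `|y - x0|) (D := [set t | t <= d])); last exact: closed_le.
move=> x _; apply: (continuous_comp (f := fun y : pt => y - x0)); last exact: norm_continuous.
by apply: (@continuousB _ _ _ id (cst x0)); [exact: cvg_id|exact: cst_continuous].
Qed.

(** [g] is controlled on [O] only. Cut off to a closed ball it becomes a bounded Borel function on
    the whole space, to which the iterated integrals apply. *)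
Lemma local_cut (O : set pt) g x0 (eta : R) :
  open O -> (forall x, O x -> {for x, continuous g}) -> O x0 -> 0 < eta ->
  exists2 d : R, 0 < d & (forall y, cball x0 d y -> O y /\ `|g y - g x0| <= eta) /\
    forall d' : R, 0 < d' <= d -> borelF (fun y => \1_(cball x0 d') y * g y).
Proof.
move=> oO cg Ox0 eta0.
have mO : measurable (O : set borelT) by exact: open_borel.
have mg : measurable_fun (O : set borelT) g.
  apply: (measurability _ (RGenOpens.measurableE R)) => _ [_ [a [b ->] <-]].
  apply: open_borel; rewrite openE => x [Ox gx].
  apply: filterI; first exact: open_nbhs_nbhs.
  by apply: (cg x Ox); apply: open_nbhs_nbhs; split => //; exact: interval_open.
have /nbhs_ballP[d1 /= d10 d1O] : nbhs x0 O by exact: open_nbhs_nbhs.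
have /cvgrPdist_le /(_ _ eta0) /nbhs_ballP[d2 /= d20 d2g] := cg x0 Ox0.
pose d := Num.min d1 d2 / 2.
have m0 : 0 < Num.min d1 d2 by rewrite lt_min d10.
have dd1 : d < d1 by rewrite /d ltr_pdivrMr// (le_lt_trans (y := d1)) ?ge_min ?lexx// ltr_pMr// ltr1n.
have dd2 : d < d2 by rewrite /d ltr_pdivrMr// (le_lt_trans (y := d2)) ?ge_min ?lexx ?orbT// ltr_pMr// ltr1n.
have h y : cball x0 d y -> O y /\ `|g y - g x0| <= eta.
  rewrite /cball /= => hy; split.
    by apply: d1O; rewrite -ball_normE /= distrC; exact: le_lt_trans dd1.
  rewrite distrC; apply: d2g; rewrite -ball_normE /= distrC; exact: le_lt_trans dd2.
exists d; first by rewrite /d divr_gt0.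
split => // d' /andP[d'0 d'd].
have mK : measurable (cball x0 d' : set borelT) by apply: closed_borel; exact: closed_cball.
have KO : cball x0 d' `<=` O by move=> y hy; apply: (h y _).1; exact: le_trans d'd.
have -> : (fun y => \1_(cball x0 d') y * g y) = g \_ (cball x0 d').
  apply/funext => y; rewrite indicE patchE; case: ifPn => _; by rewrite ?mul1r ?mul0r.
apply/(measurable_restrictT _ mK); exact: measurable_funS mg.
Qed.

(* The directional derivative along F of the mollification of g is locally
   bounded by b, up to errors vanishing at small scales. *)
Definition wbound (O : set pt) F g (b : R) : Prop :=
  forall x0, O x0 -> forall e : R, 0 < e -> exists2 d : R, 0 < d &
    forall x (h : R), ball x0 d x -> 0 < h < d ->
      `|intRn (fun y => g y * \sum_i F x 0 i * 'D_(ebase i) (bumpat x h) y)|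
        <= (b + e) * bump_mass (n := n) h.

Lemma derivable_expand (V W : normedModType R) (f : V -> W) (x v : V) (e : R) :
  derivable f x v -> 0 < e -> exists2 d : R, 0 < d &
    forall h : R, `|h| < d -> `|f (x + h *: v) - f x - h *: 'D_v f x| <= e * `|h|.
Proof.
move=> df e0; move/cvgrPdist_le : (df) => /(_ _ e0)[d /= d0 hd].
exists d => // h hd'; have [->|h0] := eqVneq h 0.
  by rewrite !scale0r addr0 subrr subr0 !normr0 mulr0.
have := hd h; rewrite /= sub0r normrN => /(_ hd' h0).
rewrite /shift /= [h *: v + x]addrC => hh.
have E : f (x + h *: v) - f x = h *: (h^-1 *: (f (x + h *: v) - f x)).
  by rewrite scalerA divff// scale1r.
rewrite E -scalerBr normrZ mulrC distrC.
exact: ler_wpM2r.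
Qed.

(** The Taylor estimate gives the chain rule at the times where [gamma] is differentiable, and a
    Lipschitz bound at all others; [dini_le_ae] combines them. The sign [sg] serves to obtain both
    one-sided inequalities. *)
Lemma mollif_path A B G (gamma : R -> pt) (N : set R) (h M k t0 u0 sg : R) :
  0 <= A -> bsupp 0 A B G -> 0 < h -> t0 <= u0 -> 0 <= M -> `|sg| = 1 ->
  (forall t u, t0 <= t <= u0 -> t0 <= u <= u0 -> `|gamma t - gamma u| <= M * `|t - u|) ->
  (@lebesgue_measure R).-negligible N ->
  (forall t, t0 <= t <= u0 -> ~ N t -> derivable gamma t 1 /\
     `|\sum_j ('D_1 gamma t) 0 j * dmollif G h j (gamma t)| <= k) ->
  sg * mollif G h (gamma u0) - sg * mollif G h (gamma t0) <= k * (u0 - t0).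
Proof.
move=> A0 hG h0 tu M0 sg1 lip N0 dN.
have [K K0 hK] := mollif_taylor A0 hG h0.
have lip' t u : t0 <= t <= u0 -> t0 <= u <= u0 ->
    `|mollif G h (gamma u) - mollif G h (gamma t)| <= K * M * `|u - t|.
  move=> ht hu; have [h1 _] := hK (gamma t) (gamma u - gamma t).
  rewrite [gamma t + _]addrC subrK in h1; rewrite (le_trans h1)// -mulrA; apply: ler_wpM2l => //.
  by rewrite distrC [`|u - t|]distrC; exact: lip.
have sgle a : sg * a <= `|a| by rewrite (le_trans (ler_norm _))// normrM sg1 mul1r.
have KM0 : 0 <= K * M by rewrite mulr_ge0.
apply: (dini_le_ae (h := fun t => sg * mollif G h (gamma t)) tu KM0 N0).
- move=> t /andP[t0t tu0] e e0; exists (e / (K * M + 1)); first by rewrite divr_gt0// ltr_wpDl.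
  move=> u t0u /andP[ut tu']; rewrite -mulrBr (le_trans (sgle _))//.
  rewrite (le_trans (lip' u t _ _))//.
  + by rewrite t0u (le_trans (ltW tu')).
  + by rewrite (ltW t0t).
  rewrite gtr0_norm ?subr_gt0//.
  have : t - u <= e / (K * M + 1) by lra.
  rewrite ler_pdivlMr ?ltr_wpDl// => h1; nra.
- move=> t /andP[t0t tu0]; exists 1 => // u /andP[tu' _] uu0.
  rewrite -mulrBr (le_trans (sgle _))// (le_trans (lip' t u _ _))//.
  + by rewrite t0t ltW.
  + by rewrite uu0 (le_trans t0t (ltW tu')).
  + by rewrite gtr0_norm// subr_gt0.
- move=> t /andP[t0t tu0] nNt e e0.
  have tI : t0 <= t <= u0 by rewrite t0t ltW.
  have [dg kg] := dN t tI nNt.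
  pose S := \sum_j `|dmollif G h j (gamma t)|.
  have S0 : 0 <= S by apply: sumr_ge0.
  have e1 : 0 < e / 2 / (S + 1) by rewrite !divr_gt0// ltr_wpDl.
  have [d d0 hd] := derivable_expand dg e1.
  pose d' := Num.min d (e / 2 / (K * M ^+ 2 + 1)).
  have KM2 : 0 <= K * M ^+ 2 by rewrite mulr_ge0// exprn_ge0.
  exists d'; first by rewrite lt_min d0 !divr_gt0// ltr_wpDl.
  move=> u /andP[tu'] + uu0; rewrite -ltrBlDl lt_min => /andP[ud1 ud2].
  have uI : t0 <= u <= u0 by rewrite uu0 (le_trans t0t (ltW tu')).
  pose w := gamma u - gamma t.
  have [_ h2] := hK (gamma t) w.
  have hw : gamma t + w = gamma u by rewrite /w addrC subrK.
  rewrite hw in h2.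
  have ut0 : 0 < u - t by rewrite subr_gt0.
  have nw : `|w| <= M * (u - t).
    by rewrite (le_trans (lip _ _ uI tI))// gtr0_norm.
  have := hd (u - t); rewrite gtr0_norm// => /(_ ud1).
  rewrite [(u - t) *: (1 : R)]mulr1 [t + _]addrC subrK.
  rewrite -/w; set v := 'D_1 gamma t => hv.
  have sumw : `|\sum_j w 0 j * dmollif G h j (gamma t) -
      (u - t) * \sum_j v 0 j * dmollif G h j (gamma t)| <= e / 2 * (u - t).
    rewrite mulr_sumr -sumrB (le_trans (ler_norm_sum _ _ _))//.
    rewrite (@le_trans _ _ (e / 2 / (S + 1) * (u - t) * S))//.
      rewrite mulr_sumr; apply: ler_sum => j _.
      rewrite mulrA -mulrBl normrM; apply: ler_wpM2r => //.
      have := coord_le_norm (w - (u - t) *: v) j; rewrite !mxE.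
      by move=> /le_trans; apply; rewrite /w in hv *.
    rewrite mulrAC; apply: ler_wpM2r; first exact: ltW.
    by rewrite mulrAC -mulrA ler_piMr ?divr_ge0 ?(ltW e0)// ler_pdivrMr ?ltr_wpDl// mul1r lerDl.
  have KW : K * `|w| ^+ 2 <= e / 2 * (u - t).
    have h3 : `|w| ^+ 2 <= (M * (u - t)) ^+ 2 by rewrite lerXn2r ?nnegrE// mulr_ge0// ltW.
    have h4 : K * `|w| ^+ 2 <= K * (M * (u - t)) ^+ 2 by rewrite ler_wpM2l.
    have h5 : (u - t) * (K * M ^+ 2 + 1) <= e / 2.
      by rewrite -ler_pdivlMr ?ltr_wpDl// ltW.
    apply: le_trans h4 _.
    have -> : K * (M * (u - t)) ^+ 2 = (u - t) * (K * M ^+ 2) * (u - t) by ring.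
    apply: ler_wpM2r; first exact: ltW.
    apply: le_trans h5; rewrite ler_wpM2l//; [exact: ltW|lra].
  rewrite -mulrBr.
  set a := mollif G h (gamma u) - mollif G h (gamma t) in h2 *.
  set b := \sum_j w 0 j * _ in h2 sumw.
  set c := \sum_j v 0 j * _ in sumw kg.
  have E : a = (a + b) - (b - (u - t) * c) - (u - t) * c by ring.
  rewrite (le_trans (sgle _))// E (le_trans (ler_normB _ _))//.
  rewrite (le_trans (lerD (ler_normB _ _) (lexx _)))//.
  have : `|(u - t) * c| <= (u - t) * k.
    by rewrite normrM gtr0_norm// ler_wpM2l// ltW.
  nra.
Qed.

End WeakBound.

Section PathBound.
Context {R : realType} {n : nat}.
Local Notation pt := 'rV[R]_n.
Implicit Types (F : pt -> pt) (G g : pt -> R) (A B : R).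

Lemma mollif_approx A B G (h : R) (x : pt) (a e : R) : 0 <= A -> bsupp 0 A B G -> 0 < h ->
  `|x| + h <= A ->
  (forall y, `|y - x| <= h -> `|G y - a| <= e) ->
  `|mollif G h x - a * bump_mass (n := n) h| <= e * bump_mass (n := n) h.
Proof.
move=> A0 hG h0 hA hGa; rewrite -(intRn_bumpat x h0).
have [C C0 hC] := bumpat_bsupp h0 hA.
have hGb : bsupp 0 A (B * C) (fun y => G y * bumpat x h y).
  by apply: bsuppMr => //; [exact: bumpat_continuous|case: hC].
have haC := bsuppZ (- a) hC.
have E : mollif G h x - a * intRn (bumpat x h) =
    intRn (fun y => G y * bumpat x h y + - a * bumpat x h y).
  by rewrite /intRn (iter_intD _ A0 (leqnn n) hGb haC) (iter_intZ _ _ A0 (leqnn n) hC) mulNr.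
rewrite E /intRn -(iter_intZ _ _ A0 (leqnn n) hC).
apply: (le_normr_intRn A0 A0 (bsuppD hGb haC) (bsuppZ e hC)) => y.
rewrite -mulrDl normrM (ger0_norm (bumpat_ge0 _ _ _)).
have [yx|yx] := leP `|y - x| h; last by rewrite bumpat_out// !mulr0.
by apply: ler_wpM2r; [exact: bumpat_ge0|exact: hGa].
Qed.

Lemma dbumpat_out (x : pt) (h : R) y i : 0 < h -> h < `|y - x| -> 'D_(ebase i) (bumpat x h) y = 0.
Proof.
move=> h0 hy; rewrite bumpat_derive dbump_out ?mulr0// => /(cube_rescale x y h0).
by rewrite leNgt hy.
Qed.

Lemma fin_min_pos (m : nat) (d : 'I_m -> R) : (forall j, 0 < d j) ->
  exists2 e : R, 0 < e & forall j, e <= d j.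
Proof.
move=> d0; have S0 : 0 <= \sum_j (d j)^-1 by apply: sumr_ge0 => j _; rewrite invr_ge0 ltW.
exists (1 + \sum_j (d j)^-1)^-1; first by rewrite invr_gt0 ltr_pwDl.
move=> j; rewrite -[leRHS]invrK lef_pV2 ?posrE ?invr_gt0 ?ltr_pwDl//.
rewrite (bigD1 j)//= addrCA lerDl addr_ge0// sumr_ge0// => i _.
by rewrite invr_ge0 ltW.
Qed.

Section Path.
Context {m : nat}.
Variables (O : set pt) (F : 'I_m -> pt -> pt) (g : pt -> R) (b rho M : R).
Variables (gamma : R -> pt) (c : 'I_m -> R -> R) (N : set R).
Hypotheses (oO : open O) (cg : forall x, O x -> {for x, continuous g}).
Hypotheses (wb : forall j, wbound O (F j) g b) (b0 : 0 <= b) (rho0 : 0 <= rho).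
Hypotheses (gO : forall t, 0 <= t <= 1 -> O (gamma t)) (M0 : 0 <= M).
Hypothesis lip : forall t u, 0 <= t <= 1 -> 0 <= u <= 1 ->
  `|gamma t - gamma u| <= M * `|t - u|.
Hypothesis N0 : (@lebesgue_measure R).-negligible N.
Hypothesis dgamma : forall t, 0 <= t <= 1 -> ~ N t ->
  derivable gamma t 1 /\ 'D_1 gamma t = \sum_j c j t *: F j (gamma t).
Hypothesis cb : forall j t, 0 <= t <= 1 -> `|c j t| <= rho.

(** For a short time [gamma] stays in a ball where the averaged bound holds at all small scales. It
    is integrated for the mollification, which is then compared with [g] at the two endpoints
    only. *)
Lemma wbound_step (sg t0 e : R) : `|sg| = 1 -> 0 <= t0 < 1 -> 0 < e ->
  exists2 d : R, 0 < d & forall u, t0 < u < t0 + d -> u <= 1 ->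
    sg * g (gamma u) - sg * g (gamma t0) <= (m%:R * rho * b + e) * (u - t0).
Proof.
move=> sg1 /andP[t00 t01] e0.
have t0I : 0 <= t0 <= 1 by rewrite t00 ltW.
set x0 := gamma t0; have Ox0 : O x0 by exact: gO.
have mr0 : 0 <= m%:R * rho by rewrite mulr_ge0.
pose e1 := e / (m%:R * rho + 1).
have e10 : 0 < e1 by rewrite divr_gt0// ltr_wpDl.
have mre1 : m%:R * rho * e1 <= e.
  have : e1 * (m%:R * rho + 1) = e by rewrite divfK// gt_eqF// ltr_wpDl.
  lra.
have [dw hw] := choice (fun j => let: ex_intro2 d p q := wb j Ox0 e10 in ex_intro _ d (conj p q)).
have [d1 d10 d1w] := fin_min_pos (fun j => (hw j).1).
have [d2 d20 [d2O d2b]] := local_cut oO cg Ox0 ltr01.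
pose d := Num.min d1 d2.
have d0 : 0 < d by rewrite lt_min d10.
have dd1 : d <= d1 by rewrite ge_min lexx.
have dd2 : d <= d2 by rewrite ge_min lexx orbT.
pose G y := \1_(cball x0 d) y * g y.
pose A := `|x0| + d; have A0 : 0 <= A by rewrite addr_ge0// ltW.
have G_out y : d < `|y - x0| -> G y = 0.
  by move=> hy; rewrite /G indicE memNset ?mul0r// /cball /= => /(lt_le_trans hy); rewrite ltxx.
have G_in y : `|y - x0| <= d -> G y = g y.
  by move=> hy; rewrite /G indicE mem_set ?mul1r.
have hG : bsupp 0 A (`|g x0| + 1) G.
  split; first by apply: d2b; rewrite d0.
  - move=> y; have [yd|yd] := leP `|y - x0| d; last first.
      by rewrite G_out// normr0 addr_ge0.
    rewrite G_in// -[g y](subrK (g x0)) addrC (le_trans (ler_normD _ _))// lerD2l.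
    exact: (d2O y (le_trans yd dd2)).2.
  - exact: supp_ball (lexx _) G_out.
exists (d / 2 / (M + 1)); first by rewrite !divr_gt0// ltr_wpDl.
move=> u /andP[t0u ud] u1.
have uI : 0 <= u <= 1 by rewrite u1 (le_trans t00 (ltW t0u)).
have near t : t0 <= t <= u -> `|gamma t - x0| < d / 2.
  move=> /andP[t0t tu]; have tI : 0 <= t <= 1 by rewrite (le_trans t00 t0t) (le_trans tu u1).
  rewrite (le_lt_trans (lip tI t0I))// ger0_norm ?subr_ge0//.
  have : (t - t0) * (M + 1) < d / 2 by rewrite -ltr_pdivlMr ?ltr_wpDl//; lra.
  have : 0 <= t - t0 by rewrite subr_ge0.
  nra.
(* From here on [u] is fixed, and the scale [h] may depend on [u] and [e2]: the bound on the
   derivative of the mollification is uniform in [h], while the endpoint errors vanish with it. *)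
apply/ler_addgt0Pr => e2 e20.
have near_g t : t0 <= t <= u -> exists2 d3 : R, 0 < d3 & forall y, `|y - gamma t| < d3 -> `|g y - g (gamma t)| <= e2 / 2.
  move=> /andP[t0t tu]; have tI : 0 <= t <= 1 by rewrite (le_trans t00 t0t) (le_trans tu u1).
  have /cvgrPdist_le /(_ _ (divr_gt0 e20 (ltr0Sn _ 1))) /nbhs_ballP[d3 /= d30 hd3] := cg (gO tI).
  exists d3 => // y hy; rewrite distrC; apply: hd3.
  by rewrite -ball_normE /= distrC.
have t0u' : t0 <= u by exact: ltW.
have tt0 : t0 <= t0 <= u by rewrite lexx.
have tuu : t0 <= u <= u by rewrite lexx t0u'.
have [d3 d30 hd3] := near_g _ tt0; have [d4 d40 hd4] := near_g _ tuu.
pose h := Num.min (d / 2) (Num.min d3 d4) / 2.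
have m10 : 0 < Num.min (d / 2) (Num.min d3 d4) by rewrite !lt_min d30 d40 divr_gt0.
have h0 : 0 < h by rewrite /h divr_gt0.
have hlt : h < Num.min (d / 2) (Num.min d3 d4) by rewrite /h; lra.
have [hd hd3' hd4'] : [/\ h < d / 2, h < d3 & h < d4].
  by move: hlt; rewrite !lt_min => /andP[-> /andP[-> ->]].
have hm := bump_mass_gt0 (n := n) h0.
have inG t y : t0 <= t <= u -> `|y - gamma t| <= h -> `|y - x0| <= d.
  move=> ht hy; rewrite (le_trans (ler_distD (gamma t) _ _))//.
  by have := near t ht; lra.
have appr t : t0 <= t <= u -> (forall y, `|y - gamma t| <= h -> `|g y - g (gamma t)| <= e2 / 2) ->
    `|mollif G h (gamma t) - g (gamma t) * bump_mass (n := n) h| <= e2 / 2 * bump_mass (n := n) h.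
  move=> ht hgy; apply: mollif_approx hG h0 _ _ => //.
    have := ler_normD (gamma t - x0) x0; rewrite subrK.
    by have := near t ht; rewrite /A; lra.
  by move=> y hy; rewrite G_in ?hgy// (inG t).
have a1 := appr _ tt0 (fun y hy => hd3 y (le_lt_trans hy hd3')).
have a2 := appr _ tuu (fun y hy => hd4 y (le_lt_trans hy hd4')).
have lip' t u' : t0 <= t <= u -> t0 <= u' <= u -> `|gamma t - gamma u'| <= M * `|t - u'|.
  move=> /andP[p1 p2] /andP[p3 p4]; apply: lip.
    by rewrite (le_trans t00 p1) (le_trans p2 u1).
  by rewrite (le_trans t00 p3) (le_trans p4 u1).
pose k := m%:R * rho * (b + e1) * bump_mass (n := n) h.
have dG t : t0 <= t <= u -> ~ N t -> derivable gamma t 1 /\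
    `|\sum_j ('D_1 gamma t) 0 j * dmollif G h j (gamma t)| <= k.
  move=> ht nt; have /andP[p1 p2] := ht.
  have tI : 0 <= t <= 1 by rewrite (le_trans t00 p1) (le_trans p2 u1).
  have [dg ->] := dgamma tI nt; split => //.
  have [BD hBD] := dbumpat_bounded (gamma t) h.
  have hGd i : bsupp 0 A ((`|g x0| + 1) * BD) (fun y => G y * 'D_(ebase i) (bumpat (gamma t) h) y).
    by apply: bsuppMr => //; exact: dbumpat_continuous.
  (* The velocity is a combination of the fields frozen at [gamma t], the centre of the bump; this
     is exactly the integral that [wbound] controls. *)
  have E : \sum_i (\sum_j c j t *: F j (gamma t)) 0 i * dmollif G h i (gamma t) =
      \sum_j c j t * intRn (fun y => g y * \sum_i F j (gamma t) 0 i * 'D_(ebase i) (bumpat (gamma t) h) y).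
    under eq_bigr do rewrite summxE mulr_suml.
    rewrite exchange_big /=; apply: eq_bigr => j _.
    rewrite (_ : (fun y => _) = (fun y => \sum_i F j (gamma t) 0 i * (G y * 'D_(ebase i) (bumpat (gamma t) h) y))); last first.
      apply/funext => y; rewrite mulr_sumr; apply: eq_bigr => i _.
      have [yh|yh] := leP `|y - gamma t| h; last by rewrite dbumpat_out// !mulr0.
      have yd := inG t y ht yh.
      by rewrite (G_in _ yd) mulrCA.
    rewrite /intRn (iter_int_sum _ _ A0 (leqnn n) (fun i => bsuppZ (F j (gamma t) 0 i) (hGd i))).
    rewrite mulr_sumr; apply: eq_bigr => i _.
    by rewrite (iter_intZ _ _ A0 (leqnn n) (hGd i)) mxE mulrA.
  rewrite E (le_trans (ler_norm_sum _ _ _))//.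
  apply: (@le_trans _ _ (\sum_(j < m) rho * ((b + e1) * bump_mass (n := n) h))).
    apply: ler_sum => j _; rewrite normrM; apply: ler_pM => //; first exact: cb.
    apply: (hw j).2.
      rewrite -ball_normE /= distrC (lt_le_trans (near t ht))//.
      by have := d1w j; lra.
    by rewrite h0 /=; have := d1w j; lra.
  by rewrite sumr_const card_ord -mulr_natl /k !mulrA.
have := mollif_path A0 hG h0 t0u' M0 sg1 lip' N0 dG.
have sgle a : sg * a <= `|a| by rewrite (le_trans (ler_norm _))// normrM sg1 mul1r.
have b1 := sgle (mollif G h (gamma t0) - g (gamma t0) * bump_mass (n := n) h).
have b2 := sgle (- (mollif G h (gamma u) - g (gamma u) * bump_mass (n := n) h)).
rewrite normrN in b2.
rewrite -/x0 in a1 b1 *.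
rewrite /k => hk.
set ms := bump_mass h in hk hm a1 a2 b1 b2.
have fin : (sg * g (gamma u) - sg * g x0) * ms <= ((m%:R * rho * b + e) * (u - t0) + e2) * ms.
  have : m%:R * rho * e1 * ((u - t0) * ms) <= e * ((u - t0) * ms).
    by apply: ler_wpM2r => //; rewrite mulr_ge0 ?subr_ge0// ltW.
  nra.
by rewrite -(ler_pM2r hm).
Qed.

(** The exceptional times of [gamma] were absorbed at positive scale: the one-sided estimate of
    [wbound_step] holds at every time, so the Dini argument runs with an empty exceptional set. *)
Lemma wbound_path t u : 0 <= t -> t <= u -> u <= 1 ->
  `|g (gamma u) - g (gamma t)| <= m%:R * rho * b * (u - t).
Proof.
move=> t0 tu u1.
have main sg : `|sg| = 1 -> sg * g (gamma u) - sg * g (gamma t) <= m%:R * rho * b * (u - t).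
  move=> sg1.
  have K0 : 0 <= m%:R * rho * b + 1 by rewrite addr_ge0// !mulr_ge0.
  have nul : (@lebesgue_measure R).-negligible set0 by exact: negligible_set0.
  apply: (dini_le_ae (h := fun t => sg * g (gamma t)) tu K0 nul).
  - move=> v /andP[tv vu] e e0.
    have vI : 0 <= v <= 1 by rewrite (le_trans vu u1) andbT ltW// (le_lt_trans t0).
    have /cvgrPdist_le /(_ _ e0) /nbhs_ballP[d3 /= d30 hd3] := cg (gO vI).
    exists (d3 / (M + 1)); first by rewrite divr_gt0// ltr_wpDl.
    move=> w tw /andP[wv1 wv2]; rewrite -mulrBr (le_trans (ler_norm _))// normrM sg1 mul1r.
    apply: hd3; rewrite -ball_normE /=.
    have wI : 0 <= w <= 1 by rewrite (le_trans t0 tw) (le_trans (ltW wv2)) ?(le_trans vu).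
    rewrite (le_lt_trans (lip vI wI))// gtr0_norm ?subr_gt0//.
    have : (v - w) * (M + 1) < d3 by rewrite -ltr_pdivlMr ?ltr_wpDl//; lra.
    nra.
  - move=> v /andP[tv vu].
    have vI : 0 <= v < 1 by rewrite (le_trans t0 tv) (lt_le_trans vu u1).
    have [d d0 hd] := wbound_step sg1 vI ltr01.
    by exists d => // w hw wu; apply: hd => //; exact: le_trans wu u1.
  - move=> v /andP[tv vu] _ e e0.
    have vI : 0 <= v < 1 by rewrite (le_trans t0 tv) (lt_le_trans vu u1).
    have [d d0 hd] := wbound_step sg1 vI e0.
    by exists d => // w hw wu; apply: hd => //; exact: le_trans wu u1.
rewrite ler_norml; apply/andP; split.
  have := main (-1); rewrite normrN normr1 => /(_ erefl); lra.
by have := main 1; rewrite normr1 => /(_ erefl); rewrite !mul1r.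
Qed.

End Path.

End PathBound.

(** * Comparison of integrals up to null sets *)

Section AlmostEverywhere.
Context {R : realType} {n : nat}.
Local Notation pt := 'rV[R]_n.
Implicit Types (F G g u : pt -> R) (A B : R).

Lemma intRn_aefin (I : finType) (N : I -> set pt) A F G : 0 <= A ->
  (forall i, nullRn (N i)) -> borelF F -> borelF G ->
  (forall x, ~ cube A x -> F x = G x) -> (forall x, (forall i, ~ N i x) -> F x = G x) ->
  intRn F = intRn G.
Proof.
move=> A0 N0 mF mG FG1 FG2.
have [D hD] := choice (fun i => nullRn_indic (N0 i) A0).
have DA i : bsupp 0 A 1 (D i) by case: (hD i).
have D0 i x : 0 <= D i x by case: (hD i).
have SA := bsupp_sum (index_enum I) A0 DA.
have I0 : iter_int n (fun x => \sum_i D i x) 0 = 0.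
  rewrite (iter_int_sum _ _ A0 (leqnn n) DA) big1// => i _.
  by case: (hD i).
apply: (iter_int_null A0 (leqnn n) SA _ mF mG _ I0); first by move=> x; apply: sumr_ge0.
move=> x Dx; have [cx|] := pselect (cube A x); last exact: FG1.
apply: FG2 => i Nix; have [_ _ _ /(_ x Nix cx) h] := hD i.
have : D i x <= \sum_i D i x by rewrite (bigD1 i)//= lerDl sumr_ge0.
by rewrite Dx h ler10.
Qed.

Lemma intRn_ae_bound (I : finType) (N : I -> set pt) A B F H : 0 <= A ->
  (forall i, nullRn (N i)) -> borelF F -> bsupp 0 A B H -> (forall x, 0 <= H x) ->
  (forall x, ~ cube A x -> F x = 0) ->
  (forall x, (forall i, ~ N i x) -> `|F x| <= H x) -> `|intRn F| <= intRn H.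
Proof.
move=> A0 N0 mF hH H0 F0 FH.
(* [F] may be unbounded on the exceptional sets; truncating it between [- H] and [H] changes it only
   there. *)
pose F' x := Num.max (- H x) (Num.min (H x) (F x)).
have mH : borelF H by case: hH.
have mF' : borelF F'.
  apply: measurable_maxr; last exact: measurable_minr.
  by apply: (measurableT_comp _ mH); exact: oppr_measurable.
have F'H x : `|F' x| <= H x.
  rewrite /F' ler_norml le_max lexx /= ge_max ge_min lexx /= andbT.
  by have := H0 x; lra.
have HA x : ~ cube A x -> H x = 0.
  move=> nx; have [_ _] := hH; apply.
  have /existsNP[i0 /negP] : ~ forall i, `|x 0 i| <= A by move=> h; apply: nx; apply/cubeP.
  by rewrite -ltNge; exists i0.
have hF' : bsupp 0 A B F'.
  split => //.
  - by move=> x; rewrite (le_trans (F'H x))// (le_trans (ler_norm _))//; case: hH.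
  - move=> x hx; apply/eqP; rewrite -normr_eq0 -normr_le0 normr_id (le_trans (F'H x))//.
    by have [_ _ ->] := hH.
have -> : intRn F = intRn F'.
  apply: (intRn_aefin A0 N0) => // x.
    by move=> nx; rewrite F0// /F' F0// HA// minxx oppr0 maxxx.
  move=> /FH; rewrite ler_norml => /andP[h1 h2]; rewrite /F'.
  by rewrite min_r// max_r.
exact: (le_normr_intRn A0 A0 hF' hH F'H).
Qed.

Lemma derive_near0 (u : pt -> R) (x v : pt) (d : R) y :
  (forall y, d < `|y - x| -> u y = 0) -> d < `|y - x| ->
  derivable u y v /\ 'D_v u y = 0.
Proof.
move=> u0 hy.
have near0 : \near y, cst 0 y = u y.
  have o : open (~` cball x d) by apply: closed_openC; exact: closed_cball.
  have hy' : (~` cball x d) y by rewrite /cball /= => h; move: hy; rewrite ltNge h.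
  apply: filterS (open_nbhs_nbhs (conj o hy')) => z; rewrite /cball /= => /negP; rewrite -ltNge.
  by move=> /u0.
by have [] := near_eq_is_derive near0 (is_derive_cst 0 y v).
Qed.

Lemma derive_lip_bound (u : pt -> R) (x v : pt) (M s0 : R) : 0 < s0 -> 0 <= M ->
  (forall s, 0 < s < s0 -> `|u (x + s *: v) - u x| <= M * s) -> `|'D_v u x| <= M.
Proof.
move=> s00 M0 h; have [du|ndu] := pselect (derivable u x v); last first.
  by rewrite /derive dvgP// normr0.
have [k ks] := ltr_add_invr s00; rewrite add0r in ks.
have /(cvg_norm) cx := derivable_seq k du.
rewrite -(cvg_lim _ cx)//; apply: limr_le; first by apply/cvg_ex; eexists; exact: cx.
apply: nearW => p; rewrite normrM ger0_norm// mulrC -ler_pdivlMr//; apply: h.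
rewrite invr_gt0 ltr0n /=; apply: le_lt_trans ks; rewrite lef_pV2 ?posrE// ler_nat ltnS.
exact: leq_addl.
Qed.

End AlmostEverywhere.

(** * Cutoffs of Lipschitz functions and integration by parts *)

Section Cutoff.
Context {R : realType} {n : nat}.
Local Notation pt := 'rV[R]_n.
Implicit Types (G g u : pt -> R) (A B : R).

Definition bump_const : R := sval (cid (@bump_estimates R n)).

Lemma bump_const_ge0 : 0 <= bump_const.
Proof. by rewrite /bump_const; case: cid => C []. Qed.

Lemma bumpat_le (x : pt) e y : `|bumpat x e y| <= bump_const.
Proof. by have [_ h _ _ _] := svalP (cid (@bump_estimates R n)); exact: h. Qed.

Lemma bumpat_lip (x : pt) (e : R) y w : 0 < e ->
  `|bumpat x e (y + w) - bumpat x e y| <= bump_const / e * `|w|.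
Proof.
move=> e0; have [_ _ _ h _] := svalP (cid (@bump_estimates R n)).
have := h (e^-1 *: (y - x)) (e^-1 *: w).
by rewrite -scalerDr addrAC normrZ gtr0_norm ?invr_gt0// mulrA.
Qed.

Section Lip.
Variables (x : pt) (e M H : R) (h : pt -> R).
Hypotheses (e0 : 0 < e) (M0 : 0 <= M).
Hypothesis hlip : forall y z, `|y - x| <= 2 * e -> `|z - x| <= 2 * e -> `|h y - h z| <= M * `|y - z|.
Hypothesis hH : forall y, `|y - x| <= 2 * e -> `|h y| <= H.
Let u (y : pt) := h y * bumpat x e y.

Let H0 : 0 <= H.
Proof. by apply: le_trans (hH (y := x) _); rewrite ?subrr ?normr0 ?mulr_ge0 ?(ltW e0). Qed.

Let L0 : 0 <= (M + H / e) * bump_const.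
Proof. by rewrite mulr_ge0 ?bump_const_ge0// addr_ge0// divr_ge0// ltW. Qed.

(** [h] is controlled at distance [2 * e] while the bump lives at distance [e]: if an increment of
    size at most [e] starts or ends outside the larger ball, the bump vanishes at both ends. *)
Lemma cutoff_lip y w : `|w| <= e -> `|u (y + w) - u y| <= (M + H / e) * bump_const * `|w|.
Proof.
move=> we; have C0 := bump_const_ge0.
have K0 : 0 <= (M + H / e) * bump_const * `|w|.
  by rewrite !mulr_ge0// addr_ge0// divr_ge0// ltW.
have E2 : 2 * e = e + e by ring.
have [y2|y2] := leP `|y - x| (2 * e); last first.
  have y1 : e < `|y + w - x|.
    have := ler_normD (y + w - x) (- w); rewrite normrN addrAC addrK E2 in y2 *; lra.
  by rewrite /u !bumpat_out// ?mulr0 ?subrr ?normr0//; have := e0; lra.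
have [z2|z2] := leP `|y + w - x| (2 * e); last first.
  have y1 : e < `|y - x|.
    have := ler_normD (y - x) w; rewrite [y - x + w]addrAC; lra.
  by rewrite /u !bumpat_out// ?mulr0 ?subrr ?normr0//; have := e0; lra.
have -> : u (y + w) - u y = (h (y + w) - h y) * bumpat x e (y + w) +
    h y * (bumpat x e (y + w) - bumpat x e y) by rewrite /u; ring.
rewrite (le_trans (ler_normD _ _))// !normrM.
have -> : (M + H / e) * bump_const * `|w| = (M * `|w|) * bump_const + H * (bump_const / e * `|w|).
  by field; rewrite gt_eqF.
apply: lerD; apply: ler_pM => //; [|exact: bumpat_le|exact: hH|exact: bumpat_lip].
by rewrite (le_trans (hlip z2 y2))// addrAC subrr add0r.
Qed.

Lemma cutoff_continuous : continuous u.
Proof.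
move=> y; apply/(@cvgrPdist_le _ _ _ (nbhs y) (nbhs_filter y)) => d d0.
have C0 := bump_const_ge0.
pose K := (M + H / e) * bump_const + 1.
have K0 : 0 < K by rewrite ltr_wpDl// mulr_ge0// addr_ge0// divr_ge0// ltW.
have m0 : 0 < Num.min e (d / K) by rewrite lt_min e0 divr_gt0.
apply: (@filterS _ (nbhs y) (nbhs_filter y) _ _ _ (nbhsx_ballx y _ m0)) => z; rewrite -ball_normE /= lt_min => /andP[h1 h2].
rewrite distrC; have h3 : `|z - y| <= e by rewrite distrC ltW.
have := cutoff_lip y h3; rewrite [y + _]addrC subrK distrC.
have h4 : `|z - y| <= d / K by rewrite distrC ltW.
rewrite [`|u y - u z|]distrC => /le_trans; apply.
rewrite -[leRHS](divfK (lt0r_neq0 K0)) mulrC.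
by apply: ler_pM => //; rewrite /K lerDl.
Qed.

Lemma cutoff_out y : e < `|y - x| -> u y = 0.
Proof. by move=> hy; rewrite /u bumpat_out// mulr0. Qed.

Lemma cutoff_bsupp A : `|x| + e <= A -> bsupp 0 A (H * bump_const) u.
Proof.
move=> hA; split.
- by apply: continuous_borelF; exact: cutoff_continuous.
- move=> y; have [y2|y2] := leP `|y - x| (2 * e).
    by rewrite normrM ler_pM// ?hH// bumpat_le.
  by rewrite cutoff_out ?normr0 ?mulr_ge0 ?bump_const_ge0//; have := e0; lra.
- by apply: supp_ball hA _; exact: cutoff_out.
Qed.

Lemma cutoff_derive_bound i y : `|'D_(ebase i) u y| <= (M + H / e) * bump_const.
Proof.
apply: (derive_lip_bound (s0 := e) e0 L0).
move=> s /andP[s0 se].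
have ns : `|s *: (ebase i : pt)| <= s.
  by rewrite normrZ gtr0_norm// -[leRHS]mulr1 ler_pM2l//; exact: norm_ebase_le.
rewrite (le_trans (cutoff_lip _ _))//; first exact: le_trans (ltW se).
exact: ler_wpM2l.
Qed.

Lemma cutoff_derive_out i y : e < `|y - x| -> 'D_(ebase i) u y = 0.
Proof. by move=> hy; have [] := derive_near0 (ebase i) cutoff_out hy. Qed.

Lemma cutoff_derive_bsupp i A : `|x| + e <= A ->
  bsupp 0 A ((M + H / e) * bump_const) (fun y => 'D_(ebase i) u y).
Proof.
move=> hA; split.
- by apply: borelF_derive; exact: cutoff_continuous.
- exact: cutoff_derive_bound.
- by apply: supp_ball hA _; exact: cutoff_derive_out.
Qed.

Lemma cutoff_intRn_derive i (N : set pt) : nullRn N ->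
  (forall y, `|y - x| <= e -> ~ N y -> derivable h y (ebase i)) ->
  intRn (fun y => 'D_(ebase i) u y) = 0.
Proof.
move=> N0 dN; have A0 : 0 <= `|x| + e by rewrite addr_ge0// ltW.
apply: (intRn_derive0 A0 (cutoff_bsupp (lexx _)) cutoff_continuous e0 (M := (M + H / e) * bump_const) _ N0).
  move=> y s /andP[s0 se].
  have ns : `|s *: (ebase i : pt)| <= s.
    by rewrite normrZ gtr0_norm// -[leRHS]mulr1 ler_pM2l//; exact: norm_ebase_le.
  rewrite (le_trans (cutoff_lip _ _))//; first exact: le_trans (ltW se).
  exact: ler_wpM2l.
move=> y nNy; have [ye|ye] := leP `|y - x| e.
  apply: derivableM; first exact: dN.
  by apply: diff_derivable; exact: smooth_differentiable (bumpat_smooth x e) y.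
by have [] := derive_near0 (ebase i) cutoff_out ye.
Qed.

End Lip.

Lemma bumpat_derivable (x : pt) (e : R) y v : derivable (bumpat x e) y v.
Proof. by apply: diff_derivable; exact: smooth_differentiable (bumpat_smooth x e) y. Qed.

Lemma sum_ebase_mul (i : 'I_n) (a : 'I_n -> R) : \sum_j (ebase i : pt) 0 j * a j = a i.
Proof.
rewrite (bigD1 i)//= big1 ?addr0 => [|j ji]; rewrite ebase_coord ?eqxx ?mul1r//.
by rewrite (negbTE ji) mul0r.
Qed.

(** Unlike in [loc_lipschitz], the constant is the same on all of [O]; only the radius depends on
    the point. This uniformity is what makes later constants functions of [Lv] alone. *)
Definition llip (O : set pt) (B : R) (h : pt -> R) : Prop :=
  forall x, O x -> exists2 d : R, 0 < d &
    forall y z, ball x d y -> ball x d z -> `|h y - h z| <= B * `|y - z|.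

Lemma loc_lipschitz_ball (V : normedModType R) (O : set pt) (h : pt -> V) x : open O -> loc_lipschitz O h -> O x ->
  exists d M : R, [/\ 0 < d, 0 <= M & forall y z, ball x d y -> ball x d z ->
    `|h y - h z| <= M * `|y - z|].
Proof.
move=> oO hl Ox; have [d [M [d0 hd]]] := hl x Ox.
have /nbhs_ballP[d1 /= d10 hd1] : nbhs x O by exact: open_nbhs_nbhs.
exists (Num.min d d1), `|M|; split => //; first by rewrite lt_min d0.
have sub y : ball x (Num.min d d1) y -> ball x d y /\ O y.
  move=> hy; split; first by apply: le_ball hy; rewrite ge_min lexx.
  by apply: hd1; apply: le_ball hy; rewrite ge_min lexx orbT.
move=> y z /sub[y1 y2] /sub[z1 z2]; rewrite (le_trans (hd y z y2 z2 y1 z1))//.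
by apply: ler_wpM2r => //; exact: ler_norm.
Qed.

Lemma loc_lipschitz_continuous (V : normedModType R) (O : set pt) (h : pt -> V) : open O -> loc_lipschitz O h ->
  forall x, O x -> {for x, continuous h}.
Proof.
move=> oO hl x Ox; have [d [M [d0 M0 hd]]] := loc_lipschitz_ball oO hl Ox.
apply/(@cvgrPdist_le _ _ _ (nbhs x) (nbhs_filter x)) => e e0.
have K0 : 0 < M + 1 by rewrite ltr_wpDl.
have m0 : 0 < Num.min d (e / (M + 1)) by rewrite lt_min d0 divr_gt0.
apply: (@filterS _ (nbhs x) (nbhs_filter x) _ _ _ (nbhsx_ballx x _ m0)) => z.
rewrite -ball_normE /= lt_min => /andP[h1 h2].
rewrite (le_trans (hd x z _ _))//; first exact: ballxx.
  by rewrite -ball_normE.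
rewrite (le_trans (y := (M + 1) * `|x - z|))//; first by apply: ler_wpM2r => //; rewrite lerDl.
by rewrite mulrC -ler_pdivlMr// ltW.
Qed.

(** Integration by parts: the derivative of [h] times the bump has integral zero, so the derivative
    moves from the bump to [h], where an almost everywhere bound suffices. *)
Lemma lip_wbound (O : set pt) (h : pt -> R) (i : 'I_n) (b : R) (N : set pt) :
  open O -> loc_lipschitz O h -> nullRn N -> 0 <= b ->
  (forall x, O x -> ~ N x -> derivable h x (ebase i) /\ `|'D_(ebase i) h x| <= b) ->
  wbound O (fun _ => ebase i) h b.
Proof.
move=> oO hl N0 b0 dN x0 Ox0 eta eta0.
have ch := loc_lipschitz_continuous oO hl.
have [d1 [M [d10 B0 hd1]]] := loc_lipschitz_ball oO hl Ox0.
have [d2 d20 [d2O d2b]] := local_cut oO ch Ox0 ltr01.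
pose d := Num.min d1 d2 / 4.
have m0 : 0 < Num.min d1 d2 by rewrite lt_min d10.
have dd1 : d * 4 <= d1 by rewrite /d divfK// ge_min lexx.
have dd2 : d * 4 <= d2 by rewrite /d divfK// ge_min lexx orbT.
exists d; first by rewrite /d divr_gt0.
move=> x e xd /andP[e0 ed].
have xx0 : `|x - x0| < d by move: xd; rewrite -ball_normE /= distrC.
have inb y : `|y - x| <= 2 * e -> `|y - x0| < d * 4.
  by move=> hy; have := ler_distD x y x0; lra.
have hlip y z : `|y - x| <= 2 * e -> `|z - x| <= 2 * e -> `|h y - h z| <= M * `|y - z|.
  move=> /inb hy /inb hz; apply: hd1; rewrite -ball_normE /= distrC.
    exact: lt_le_trans hy dd1.
  exact: lt_le_trans hz dd1.
have hO y : `|y - x| <= 2 * e -> O y.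
  by move=> /inb hy; apply: (d2O y _).1; rewrite /cball /= ltW// (lt_le_trans hy).
have hH y : `|y - x| <= 2 * e -> `|h y| <= `|h x0| + 1.
  move=> /inb hy; have := (d2O y (ltW (lt_le_trans hy dd2))).2.
  have := ler_normD (h y - h x0) (h x0); rewrite subrK; lra.
have A0 : 0 <= `|x| + e by rewrite addr_ge0// ltW.
have e2 y : `|y - x| <= e -> `|y - x| <= 2 * e by move=> ?; have := e0; lra.
have I0 := cutoff_intRn_derive e0 B0 hlip hH (i := i) N0 (fun y hy nN => (dN y (hO y (e2 y hy)) nN).1).
have uD := cutoff_derive_bsupp e0 B0 hlip hH i (lexx (`|x| + e)).
set u := (fun y => h y * bumpat x e y) in I0 uD.
pose K := cball x0 d2.
have mG : borelF (fun y => \1_K y * h y) by apply: d2b; rewrite d20 lexx.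
have KE y : `|y - x| <= 2 * e -> \1_K y * h y = h y.
  move=> /inb hy; rewrite indicE mem_set ?mul1r// /K /cball /= ltW//; exact: lt_le_trans hy dd2.
(* Off the null set [W] is the bump times the derivative of [h]; writing it as a difference keeps it
   Borel without any regularity of that derivative. *)
pose W y := 'D_(ebase i) u y + (-1) * ((\1_K y * h y) * 'D_(ebase i) (bumpat x e) y).
have hbD : bsupp 0 (`|x| + e) ((`|h x0| + 1) * (e^-1 * bump_const)) (fun y => (\1_K y * h y) * 'D_(ebase i) (bumpat x e) y).
  split.
  - by apply: measurable_funM => //; apply: continuous_borelF; exact: dbumpat_continuous.
  - move=> y; have [ye|ye] := leP `|y - x| e; last first.
      by rewrite dbumpat_out// mulr0 normr0 !mulr_ge0 ?addr_ge0 ?invr_ge0 ?(ltW e0) ?bump_const_ge0.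
    rewrite KE; last exact: e2.
    rewrite normrM; apply: ler_pM => //; first by apply: hH; exact: e2.
    apply: (derive_lip_bound (s0 := 1)) => //; first by rewrite mulr_ge0 ?invr_ge0 ?(ltW e0) ?bump_const_ge0.
    move=> s /andP[s0 _]; rewrite (le_trans (bumpat_lip _ _ _ e0))// [e^-1 * _]mulrC.
    apply: ler_wpM2l; first by rewrite divr_ge0 ?(ltW e0) ?bump_const_ge0.
    by rewrite normrZ gtr0_norm// -[leRHS]mulr1 ler_pM2l//; exact: norm_ebase_le.
  - by apply: supp_ball (lexx _) _ => y hy; rewrite dbumpat_out// mulr0.
have hW := bsuppD uD (bsuppZ (-1) hbD); rewrite -/W in hW.
have IW : intRn (fun y => h y * \sum_j (ebase i : pt) 0 j * 'D_(ebase j) (bumpat x e) y) = - intRn W.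
  rewrite (_ : (fun y => _) = (fun y => (\1_K y * h y) * 'D_(ebase i) (bumpat x e) y)); last first.
    apply/funext => y; rewrite sum_ebase_mul.
    by have [ye|ye] := leP `|y - x| e; [rewrite KE// e2|rewrite dbumpat_out// !mulr0].
  rewrite /intRn (iter_intD _ A0 (leqnn n) uD (bsuppZ (-1) hbD)) (iter_intZ _ _ A0 (leqnn n) hbD).
  by move: I0; rewrite /intRn => ->; rewrite add0r mulN1r opprK.
rewrite IW normrN -(intRn_bumpat x e0).
have [C C0 hC] := bumpat_bsupp e0 (lexx (`|x| + e)).
apply: (@le_trans _ _ (b * intRn (bumpat x e))); last first.
  by apply: ler_wpM2r; [rewrite intRn_bumpat// ltW// bump_mass_gt0|rewrite lerDl ltW].
rewrite /intRn -(iter_intZ b _ A0 (leqnn n) hC).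
apply: (intRn_ae_bound A0 (fun i : unit => N0) _ (bsuppZ b hC)).
- by case: hW.
- by move=> y; rewrite mulr_ge0// bumpat_ge0.
- move=> y ny; have [_ _] := hW; apply.
  have /existsNP[i0 /negP] : ~ forall i, `|y 0 i| <= `|x| + e by move=> k; apply: ny; apply/cubeP.
  by rewrite -ltNge; exists i0.
- move=> y /(_ tt) nNy; rewrite /W; have [ye|ye] := leP `|y - x| e; last first.
    by rewrite cutoff_derive_out// dbumpat_out// !mulr0 addr0 normr0 mulr_ge0// bumpat_ge0.
  have [dh hb] := dN y (hO y (e2 y ye)) nNy.
  rewrite /u (deriveM dh (@bumpat_derivable x e y (ebase i))).
  rewrite KE; last exact: e2.
  rewrite /GRing.scale /= mulN1r addrAC subrr add0r normrM (ger0_norm (bumpat_ge0 _ _ _)) mulrC.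
  by apply: ler_wpM2r => //; exact: bumpat_ge0.
Qed.

End Cutoff.

(** * From distributional derivatives to averaged bounds *)

Section WeakDerivative.
Context {R : realType} {n : nat}.
Local Notation pt := 'rV[R]_n.
Implicit Types (G g u : pt -> R) (A B : R).

Lemma coord_le_enorm (v : pt) i : `|v 0 i| <= enorm v.
Proof.
rewrite /enorm -sqrtr_sqr; apply: ler_wsqrtr.
by rewrite (bigD1 i)//= lerDl sumr_ge0// => j _; rewrite sqr_ge0.
Qed.

Lemma enorm_ge0 (v : pt) : 0 <= enorm v.
Proof. exact: sqrtr_ge0. Qed.

Lemma norm_le_enorm (v : pt) : `|v| <= enorm v.
Proof. by apply: rV_norm_le => [|i]; [exact: enorm_ge0|exact: coord_le_enorm]. Qed.

Lemma compact_cball (x : pt) (e : R) : 0 < e -> compact (cball x e).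
Proof.
move=> e0.
have -> : cball x e = [set y : pt | forall i, `[x 0 i - e, x 0 i + e]%classic (y 0 i)].
  apply/seteqP; split => y /=.
    move=> h i; rewrite in_itv/=; have := le_trans (coord_le_norm (y - x) i) h.
    by rewrite !mxE ler_distl.
  move=> h; apply: rV_norm_le => [|i]; first exact: ltW.
  by have := h i; rewrite in_itv/= !mxE ler_distl.
apply: (@rV_compact _ _ (fun i => `[x 0 i - e, x 0 i + e]%classic)) => i.
exact: segment_compact.
Qed.

Lemma bumpat_test_fun (O : set pt) (x : pt) (e : R) : 0 < e -> cball x e `<=` O ->
  test_fun O (bumpat x e).
Proof.
move=> e0 hO; split.
  move=> l; have sl := smooth_Dop l (bumpat_smooth x e); split.
    exact: smooth_continuous.
  by move=> i y; apply: diff_derivable; exact: smooth_differentiable.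
exists (cball x e); split; [exact: compact_cball|split => // y].
by rewrite /cball /= => /negP; rewrite -ltNge => /(bumpat_out e0).
Qed.

Lemma borelF_sum (I : Type) (r : seq I) (F : I -> pt -> R) :
  (forall i, borelF (F i)) -> borelF (fun x => \sum_(i <- r) F i x).
Proof. by move=> h; apply: measurable_sum. Qed.

Lemma borel_fun_coord (G : pt -> pt) c : borel_fun G -> borelF (fun x => G x 0 c).
Proof.
move=> bG; apply: (measurability _ (RGenOpens.measurableE R)) => _ [_ [a [b ->] <-]].
rewrite setTI; apply: (bG ((fun v : pt => v 0 c) @^-1` `]a, b[)).
by apply: open_comp; [move=> v _; exact: coord_continuous|exact: interval_open].
Qed.

Lemma out_cube_ball (x : pt) (e : R) y : ~ cube (`|x| + e) y -> e < `|y - x|.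
Proof.
move=> ny; have /existsNP[i /negP] : ~ forall i, `|y 0 i| <= `|x| + e by move=> k; apply: ny; apply/cubeP.
rewrite -ltNge => h; have := coord_le_norm y i; have := ler_normD (y - x) x.
rewrite subrK; lra.
Qed.

(* Friedrichs' commutator estimate: frozen at x, the field F differentiates the
   bump directly; the error involves only F - F x, which is small with the
   support of the bump, and g - g x. *)
Lemma weak_wbound (O : set pt) (F gv : pt -> pt) (c : 'I_n) (b : R) :
  open O -> (forall i, loc_lipschitz O (fun y => F y 0 i)) ->
  (forall i, exists2 N, nullRn N & forall x, O x -> ~ N x ->
     derivable (fun y => F y 0 i) x (ebase i)) ->
  (forall x, O x -> {for x, continuous (fun y => gv y 0 c)}) ->
  (exists Gw : pt -> pt, weak_deriv_Linf O F gv Gw /\ ae_on O (fun x => enorm (Gw x) <= b)) ->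
  0 <= b -> wbound O F (fun x => gv x 0 c) b.
Proof.
move=> oO lF dF cg [Gw [[bG [_ weak]] [NG [NG0 GB]]]] b0 x0 Ox0 eta eta0.
set g := (fun x : pt => gv x 0 c) in cg *.
have [dM hdM] := choice (fun i => let: ex_intro d (ex_intro M h) := loc_lipschitz_ball oO (lF i) Ox0
  in ex_intro (fun p : R * R => [/\ 0 < p.1, 0 <= p.2 & forall y z, ball x0 p.1 y -> ball x0 p.1 z ->
    `|F y 0 i - F z 0 i| <= p.2 * `|y - z|]) (d, M) h).
have dM1 i : 0 < (dM i).1 by case: (hdM i).
have [d1 d10 hd1] := fin_min_pos dM1.
pose M := \sum_i (dM i).2.
have dM0 i : 0 <= (dM i).2 by case: (hdM i).
have M0 : 0 <= M by apply: sumr_ge0.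
have MM i : (dM i).2 <= M by rewrite /M (bigD1 i)//= lerDl sumr_ge0.
have [N hN] := choice (fun i => let: ex_intro2 N p q := dF i in ex_intro _ N (conj p q)).
have [c0 c00 hc0] := @bump_mass_ge R n.
pose C := @bump_const R n.
have C0 : 0 <= C := @bump_const_ge0 R n.
pose L := n%:R * (3 * M * C).
have L0 : 0 <= L by rewrite /L !mulr_ge0.
have Q0 : 0 <= 2 * L * 2 ^+ n by rewrite !mulr_ge0 ?exprn_ge0.
(* The commutator will be at most [2 * e1 * L * (2 * e) ^+ n], whereas [bump_mass] is at least
   [c0 * e ^+ n]; this oscillation of [g] makes the former at most [eta] times the latter at every
   small scale. *)
pose e1 := eta * c0 / (2 * L * 2 ^+ n + 1).
have e10 : 0 < e1 by rewrite divr_gt0 ?mulr_gt0// ltr_wpDl.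
have e1Q : e1 * (2 * L * 2 ^+ n) <= eta * c0.
  have : e1 * (2 * L * 2 ^+ n + 1) = eta * c0 by rewrite divfK// gt_eqF// ltr_wpDl.
  by move: (2 * L * 2 ^+ n) (eta * c0) => *; lra.
clearbody e1.
have e1L : 0 <= 2 * e1 * L by rewrite mulr_ge0// mulr_ge0// ltW.
have [d2 d20 [d2O d2b]] := local_cut oO cg Ox0 e10.
pose d := Num.min d1 d2 / 4.
have m0 : 0 < Num.min d1 d2 by rewrite lt_min d10.
have dd1 : d * 4 <= d1 by rewrite /d divfK// ge_min lexx.
have dd2 : d * 4 <= d2 by rewrite /d divfK// ge_min lexx orbT.
exists d; first by rewrite /d divr_gt0.
move=> x e xd /andP[e0 ed].
have xx0 : `|x - x0| < d by move: xd; rewrite -ball_normE /= distrC.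
have inb y : `|y - x| <= 2 * e -> `|y - x0| < d * 4.
  by move=> hy; have := ler_distD x y x0; lra.
have e2 y : `|y - x| <= e -> `|y - x| <= 2 * e by move=> ?; lra.
have hO y : `|y - x| <= 2 * e -> O y.
  by move=> /inb hy; apply: (d2O y _).1; rewrite /cball /= ltW// (lt_le_trans hy).
have A0 : 0 <= `|x| + e by rewrite addr_ge0// ltW.
pose h i y := F y 0 i - F x 0 i.
have hlip i y z : `|y - x| <= 2 * e -> `|z - x| <= 2 * e -> `|h i y - h i z| <= M * `|y - z|.
  move=> /inb hy /inb hz.
  rewrite /h opprB addrA subrK; have [_ _ hh] := hdM i.
  rewrite (le_trans (hh y z _ _))//; last by apply: ler_wpM2r.
    by rewrite -ball_normE /= distrC (lt_le_trans hy)// (le_trans dd1).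
  by rewrite -ball_normE /= distrC (lt_le_trans hz)// (le_trans dd1).
have hH i y : `|y - x| <= 2 * e -> `|h i y| <= 2 * M * e.
  move=> hy; have xx : `|x - x| <= 2 * e by rewrite subrr normr0 mulr_ge0// ltW.
  have := hlip i y x hy xx; rewrite {2}/h subrr subr0 => /le_trans; apply.
  by rewrite [2 * M]mulrC -mulrA ler_wpM2l.
pose u i y := h i y * bumpat x e y.
have cu i : continuous (u i) := cutoff_continuous e0 M0 (hlip i) (hH i).
(* The size [2 * M * e] of [F - F x] cancels the factor [1 / e] from the gradient of the bump: the
   derivative of the product is bounded independently of the scale. *)
have KE : M + 2 * M * e / e = 3 * M by rewrite mulfK ?gt_eqF//; ring.
have uD i : bsupp 0 (`|x| + e) (3 * M * C) (fun y => 'D_(ebase i) (u i) y).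
  by rewrite -KE; exact: (cutoff_derive_bsupp e0 M0 (hlip i) (hH i) i (lexx _)).
have du i y : `|y - x| <= e -> ~ N i y -> derivable (h i) y (ebase i).
  move=> hy nN; apply: derivableB; last exact: derivable_cst.
  by apply: (hN i).2 nN; apply: hO; exact: e2.
have I0 i : intRn (fun y => 'D_(ebase i) (u i) y) = 0.
  exact: (cutoff_intRn_derive e0 M0 (hlip i) (hH i) (hN i).1 (du i)).
pose K := cball x0 d2.
have mG : borelF (fun y => \1_K y * g y) by apply: d2b; rewrite d20 lexx.
have KgE y : `|y - x| <= 2 * e -> \1_K y * g y = g y.
  by move=> /inb hy; rewrite indicE mem_set ?mul1r// /K /cball /= ltW// (lt_le_trans hy).
pose G y := \1_K y * g y.
have [BD hBD] := @dbumpat_bounded R n x e.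
(* the mollified derivative, the distributional one, and the commutator *)
pose S y := G y * \sum_i F x 0 i * 'D_(ebase i) (bumpat x e) y.
pose T y := G y * \sum_i 'D_(ebase i) (fun z => F z 0 i * bumpat x e z) y.
pose V y := (G y - g x) * \sum_i 'D_(ebase i) (u i) y.
have FE i : (fun z => F z 0 i * bumpat x e z) = (fun z => u i z + F x 0 i * bumpat x e z).
  by apply/funext => z; rewrite /u /h; ring.
have cF i : continuous (fun z => F z 0 i * bumpat x e z).
  rewrite FE => z; apply: (@continuousD _ _ _ (u i) (fun z => F x 0 i * bumpat x e z)); first exact: cu.
  apply: (@continuousM _ _ (cst (F x 0 i)) (bumpat x e)); first exact: cst_continuous.
  exact: bumpat_continuous.
have mT : borelF T.
  by apply: measurable_funM => //; apply: borelF_sum => i; exact: borelF_derive.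
have sumD := bsupp_sum (index_enum 'I_n) A0 uD.
have sumC : \sum_(i < n) 3 * M * C = L.
  by rewrite sumr_const card_ord -[LHS]mulr_natl.
rewrite sumC in sumD.
have dbo i y : e < `|y - x| -> 'D_(ebase i) (fun z => F z 0 i * bumpat x e z) y = 0.
  move=> hy; have [] := derive_near0 (ebase i) (u := fun z => F z 0 i * bumpat x e z) (x := x) (d := e) _ hy => //.
  by move=> z hz; rewrite bumpat_out// mulr0.
have duo i y : e < `|y - x| -> 'D_(ebase i) (u i) y = 0.
  by move=> hy; exact: (cutoff_derive_out (h i) e0 i hy).
have gB y : `|y - x| <= e -> `|G y - g x| <= 2 * e1.
  move=> hy; rewrite /G KgE; last exact: e2.
  have h1 := (d2O y (ltW (lt_le_trans (inb _ (e2 _ hy)) dd2))).2.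
  have xx : `|x - x| <= 2 * e by rewrite subrr normr0 mulr_ge0// ltW.
  have h2 := (d2O x (ltW (lt_le_trans (inb _ xx) dd2))).2.
  have := ler_distD (g x0) (g y) (g x); rewrite [`|g x0 - g x|]distrC; lra.
have hV : bsupp 0 (`|x| + e) (2 * e1 * L) V.
  split.
  - apply: measurable_funM; last by case: sumD.
    by apply: measurable_funB => //; exact: borelF_cst.
  - move=> y; have [ye|ye] := leP `|y - x| e; last first.
      by rewrite /V big1 ?mulr0 ?normr0// => i _; exact: duo.
    by rewrite /V normrM; apply: ler_pM => //; [exact: gB|case: sumD].
  - apply: supp_ball (lexx _) _ => y ye.
    by rewrite /V big1 ?mulr0// => i _; exact: duo.
have IV : `|intRn V| <= 2 * e1 * L * (2 * e) ^+ n.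
  apply: (intRn_ball_bound (x := x) e0 A0 hV) => y ye.
  by rewrite /V big1 ?mulr0// => i _; exact: duo.
have Gb y : `|y - x| <= e -> `|G y| <= 2 * e1 + `|g x|.
  by move=> hy; have := gB y hy; have := ler_normD (G y - g x) (g x); rewrite subrK; lra.
have hSi i : bsupp 0 (`|x| + e) ((2 * e1 + `|g x|) * `|BD|) (fun y => G y * 'D_(ebase i) (bumpat x e) y).
  split.
  - by apply: measurable_funM => //; apply: continuous_borelF; exact: dbumpat_continuous.
  - move=> y; have [ye|ye] := leP `|y - x| e; last first.
      by rewrite dbumpat_out// mulr0 normr0 mulr_ge0// addr_ge0// mulr_ge0// ltW.
    rewrite normrM; apply: ler_pM => //; first exact: Gb.
    exact: le_trans (hBD i y) (ler_norm _).
  - by apply: supp_ball (lexx _) _ => y hy; rewrite dbumpat_out// mulr0.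
have SE : S = (fun y => \sum_i F x 0 i * (G y * 'D_(ebase i) (bumpat x e) y)).
  by apply/funext => y; rewrite /S mulr_sumr; apply: eq_bigr => i _; rewrite mulrCA.
have hS := bsupp_sum (index_enum 'I_n) A0 (fun i => bsuppZ (F x 0 i) (hSi i)).
rewrite -SE in hS.
have hX := bsuppD hV (bsuppZ (g x) sumD).
have hW := bsuppD hS hX.
(* Subtracting the constant [g x] in [V] is free, because each derivative of [u i] has integral
   zero. *)
have IT : intRn T = intRn S + intRn V.
  rewrite (intRn_aefin A0 (fun i => (hN i).1) mT (G := fun y => S y + (V y + g x * \sum_i 'D_(ebase i) (u i) y))).
  - rewrite /intRn (iter_intD _ A0 (leqnn n) hS hX) (iter_intD _ A0 (leqnn n) hV (bsuppZ (g x) sumD)).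
    rewrite (iter_intZ _ _ A0 (leqnn n) sumD) (iter_int_sum _ _ A0 (leqnn n) uD) [\sum_i _]big1; last first.
      by move=> i _; have := I0 i; rewrite /intRn.
    by rewrite mulr0 addr0.
  - by case: hW.
  - move=> y /out_cube_ball ye; rewrite /T /S /V !big1 ?mulr0 ?addr0// => i _.
    + exact: duo.
    + by rewrite dbumpat_out// mulr0.
    + exact: dbo.
  - move=> y nN; have [ye|ye] := leP `|y - x| e; last first.
      rewrite /T /S /V !big1 ?mulr0 ?addr0// => i _.
      + exact: duo.
      + by rewrite dbumpat_out// mulr0.
      + exact: dbo.
    have -> : V y + g x * \sum_i 'D_(ebase i) (u i) y = G y * \sum_i 'D_(ebase i) (u i) y.
      by rewrite /V; ring.
    rewrite /T /S -mulrDr -big_split /=; congr (_ * _); apply: eq_bigr => i _.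
    have d1' : derivable (u i) y (ebase i).
      by apply: derivableM; [exact: du|exact: bumpat_derivable].
    have d2' : derivable (fun z => F x 0 i * bumpat x e z) y (ebase i).
      by apply: derivableM; [exact: derivable_cst|exact: bumpat_derivable].
    rewrite FE (deriveD d1' d2') addrC; congr (_ + _).
    rewrite (deriveM (f := cst (F x 0 i)) (derivable_cst _ _ _) (@bumpat_derivable _ _ x e y (ebase i))).
    by rewrite derive_cst scaler0 addr0.
have tf : test_fun O (bumpat x e).
  by apply: bumpat_test_fun e0 _ => y ye; apply: hO; exact: e2.
have TE : intRn T = - intRn (fun y => Gw y 0 c * bumpat x e y).
  rewrite (weak _ tf c) opprK; congr intRn; apply/funext => y; rewrite /T.
  have [ye|ye] := leP `|y - x| e; first by rewrite /G KgE//; exact: e2.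
  by rewrite !big1 ?mulr0// => i _; exact: dbo.
have [Cb Cb0 hCb] := bumpat_bsupp e0 (lexx (`|x| + e)).
have IG : `|intRn (fun y => Gw y 0 c * bumpat x e y)| <= b * bump_mass (n := n) e.
  rewrite -(intRn_bumpat x e0) /intRn -(iter_intZ b _ A0 (leqnn n) hCb).
  apply: (intRn_ae_bound A0 (fun _ : unit => NG0) _ (bsuppZ b hCb)).
  - apply: measurable_funM; first exact: borel_fun_coord.
    by case: hCb.
  - by move=> y; rewrite mulr_ge0// bumpat_ge0.
  - by move=> y /out_cube_ball ye; rewrite bumpat_out// mulr0.
  - move=> y /(_ tt) nN; have [ye|ye] := leP `|y - x| e; last first.
      by rewrite bumpat_out// !mulr0 normr0.
    rewrite normrM (ger0_norm (bumpat_ge0 _ _ _)); apply: ler_wpM2r; first exact: bumpat_ge0.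
    by rewrite (le_trans (coord_le_enorm _ _))//; apply: GB => //; apply: hO; exact: e2.
have -> : intRn (fun y => g y * \sum_i F x 0 i * 'D_(ebase i) (bumpat x e) y) = intRn S.
  congr intRn; apply/funext => y; rewrite /S.
  have [ye|ye] := leP `|y - x| e; first by rewrite /G KgE//; exact: e2.
  by rewrite !big1 ?mulr0// => i _; rewrite dbumpat_out// mulr0.
have -> : intRn S = - intRn (fun y => Gw y 0 c * bumpat x e y) - intRn V by rewrite -TE IT addrK.
rewrite (le_trans (ler_normB _ _))// normrN mulrDl; apply: lerD => //.
apply: le_trans IV _.
have -> : 2 * e1 * L * (2 * e) ^+ n = e1 * (2 * L * 2 ^+ n) * e ^+ n.
  by rewrite exprMn; ring.
rewrite (le_trans (ler_wpM2r (exprn_ge0 n (ltW e0)) e1Q))//.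
rewrite -mulrA; apply: ler_wpM2l; first exact: ltW.
exact: hc0.
Qed.

End WeakDerivative.

(** * Regularity of the commutators *)

Section Differentiation.
Context {R : realType}.

Lemma is_derive_expandP (V W : normedModType R) (f : V -> W) (x v : V) (l : W) :
  (forall e : R, 0 < e -> exists2 d : R, 0 < d &
     forall h : R, `|h| < d -> `|f (x + h *: v) - f x - h *: l| <= e * `|h|) ->
  is_derive x v f l.
Proof.
move=> hf.
have cv : (fun h : R => h^-1 *: ((f \o shift x) (h *: v) - f x)) @ 0^' --> l.
  apply/cvgrPdist_le => e e0; have [d d0 hd] := hf _ e0; exists d => // h /=.
  rewrite sub0r normrN => hd' h0; have := hd h hd'.
  have E : f (x + h *: v) - f x - h *: l = h *: (h^-1 *: (f (h *: v + x) - f x) - l).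
    by rewrite scalerBr scalerA divff// scale1r [x + _]addrC.
  rewrite E normrZ mulrC ler_pM2r ?normr_gt0//.
  by rewrite distrC.
by apply: DeriveDef; [apply/cvg_ex; exists l|exact: cvg_lim cv].
Qed.

Lemma is_derive_scale (V W : normedModType R) (f : V -> W) (x v : V) (c : R) (l : W) :
  is_derive x v f l -> is_derive x (c *: v) f (c *: l).
Proof.
move=> [df <-]; apply: is_derive_expandP => e e0.
have c0 : 0 < `|c| + 1 by rewrite ltr_wpDl.
have [d d0 hd] := derivable_expand df (divr_gt0 e0 c0).
exists (d / (`|c| + 1)); first exact: divr_gt0.
move=> h hh; rewrite !scalerA.
have hc : `|h * c| <= `|h| * (`|c| + 1) by rewrite normrM ler_wpM2l// lerDl.
have hd' : `|h * c| < d by apply: le_lt_trans hc _; rewrite -ltr_pdivlMr.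
rewrite (le_trans (hd _ hd'))//.
rewrite (le_trans (ler_wpM2l _ hc))//; first by rewrite divr_ge0// ltW.
by rewrite mulrCA divfK ?gt_eqF// mulrC.
Qed.

End Differentiation.

(** * Calculus of functions with uniformly Lipschitz derivatives *)

Section Classes.
Context {R : realType} {n : nat}.
Local Notation pt := 'rV[R]_n.
Variable O : set pt.
Hypothesis oO : open O.
Implicit Types (h g : pt -> R) (B : R).

(* B bounds the size and the local Lipschitz constant of all partial derivatives
   of h of order at most k. *)
Fixpoint Cb (k : nat) (B : R) (h : pt -> R) : Prop :=
  [/\ forall x, O x -> `|h x| <= B, llip O B h &
   if k is k'.+1 then forall i : 'I_n, (forall x, O x -> derivable h x (ebase i)) /\
     Cb k' B (fun x => 'D_(ebase i) h x) else True].

Lemma near_O x : O x -> \forall y \near x, O y.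
Proof. by move=> Ox; apply: open_nbhs_nbhs. Qed.

Lemma near_eq_O (f g : pt -> R) x : (forall x, O x -> f x = g x) -> O x -> \near x, f x = g x.
Proof. by move=> fg /near_O; apply: filterS => y; exact: fg. Qed.

Lemma llip_ext f g B : (forall x, O x -> f x = g x) -> llip O B f -> llip O B g.
Proof.
move=> fg hf x Ox; have [d d0 hd] := hf x Ox.
have /nbhs_ballP[d1 /= d10 hd1] := near_O Ox.
exists (Num.min d d1); first by rewrite lt_min d0.
move=> y z hy hz.
have [y1 y2] : ball x d y /\ ball x d1 y.
  by split; apply: le_ball hy; rewrite ge_min lexx ?orbT.
have [z1 z2] : ball x d z /\ ball x d1 z.
  by split; apply: le_ball hz; rewrite ge_min lexx ?orbT.
by rewrite -!fg; [exact: hd|exact: hd1|exact: hd1].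
Qed.

Lemma Cb_ext k B f g : (forall x, O x -> f x = g x) -> Cb k B f -> Cb k B g.
Proof.
elim: k f g => [|k IH] f g fg /= [h1 h2 h3]; split => //.
- by move=> x Ox; rewrite -fg//; exact: h1.
- exact: llip_ext h2.
- by move=> x Ox; rewrite -fg//; exact: h1.
- exact: llip_ext h2.
- move=> i; have [d1 d2] := h3 i; split.
    by move=> x Ox; apply: (near_eq_derivable (near_eq_O fg Ox)); exact: d1.
  apply: IH d2 => x Ox; apply: near_eq_derive.
  exact: near_eq_O.
Qed.

Lemma llipW B B' h : B <= B' -> llip O B h -> llip O B' h.
Proof.
move=> BB hl x /hl[d d0 hd]; exists d => // y z hy hz; rewrite (le_trans (hd y z hy hz))//.
exact: ler_wpM2r.
Qed.

Lemma CbW k B B' h : B <= B' -> Cb k B h -> Cb k B' h.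
Proof.
move=> BB; elim: k h => [|k IH] h /= [h1 h2 h3]; split => //.
- by move=> x Ox; exact: le_trans (h1 x Ox) BB.
- exact: llipW h2.
- by move=> x Ox; exact: le_trans (h1 x Ox) BB.
- exact: llipW h2.
- by move=> i; have [d1 d2] := h3 i; split => //; exact: IH.
Qed.

Lemma CbS k B h : Cb k.+1 B h -> Cb k B h.
Proof.
elim: k h => [|k IH] h [h1 h2 h3]; split => // i.
by have [d1 d2] := h3 i; split => //; exact: IH.
Qed.

Lemma Cb_le k k' B h : (k' <= k)%N -> Cb k B h -> Cb k' B h.
Proof.
move=> kk; rewrite -(subnK kk); elim: (k - k')%N => [//|m IH] hm.
by apply: IH; exact: CbS.
Qed.

Lemma llipD B B' f g : llip O B f -> llip O B' g -> llip O (B + B') (fun x => f x + g x).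
Proof.
move=> hf hg x Ox; have [d d0 hd] := hf x Ox; have [d1 d10 hd1] := hg x Ox.
exists (Num.min d d1); first by rewrite lt_min d0.
move=> y z hy hz.
have [y1 y2] : ball x d y /\ ball x d1 y.
  by split; apply: le_ball hy; rewrite ge_min lexx ?orbT.
have [z1 z2] : ball x d z /\ ball x d1 z.
  by split; apply: le_ball hz; rewrite ge_min lexx ?orbT.
rewrite opprD addrACA mulrDl (le_trans (ler_normD _ _))//.
by apply: lerD; [exact: hd|exact: hd1].
Qed.

Lemma llipM B B' f g : 0 <= B -> 0 <= B' ->
  (forall x, O x -> `|f x| <= B) -> (forall x, O x -> `|g x| <= B') ->
  llip O B f -> llip O B' g -> llip O (2 * (B * B')) (fun x => f x * g x).
Proof.
move=> B0 B0' bf bg hf hg x Ox; have [d d0 hd] := hf x Ox; have [d1 d10 hd1] := hg x Ox.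
have /nbhs_ballP[d2 /= d20 hd2] := near_O Ox.
exists (Num.min d (Num.min d1 d2)); first by rewrite !lt_min d0 d10.
move=> y z hy hz.
have [y1 y2 y3] : [/\ ball x d y, ball x d1 y & O y].
  by split; [| |apply: hd2]; apply: le_ball hy; rewrite !ge_min lexx ?orbT.
have [z1 z2 z3] : [/\ ball x d z, ball x d1 z & O z].
  by split; [| |apply: hd2]; apply: le_ball hz; rewrite !ge_min lexx ?orbT.
have -> : f y * g y - f z * g z = (f y - f z) * g y + f z * (g y - g z) by ring.
rewrite (le_trans (ler_normD _ _))// !normrM.
have -> : 2 * (B * B') * `|y - z| = (B * `|y - z|) * B' + B * (B' * `|y - z|) by ring.
by apply: lerD; apply: ler_pM => //; [exact: hd|exact: bg|exact: bf|exact: hd1].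
Qed.

Lemma CbD k B B' f g : Cb k B f -> Cb k B' g -> Cb k (B + B') (fun x => f x + g x).
Proof.
elim: k f g => [|k IH] f g [f1 f2 f3] [g1 g2 g3]; split => //.
- by move=> x Ox; rewrite (le_trans (ler_normD _ _))// lerD ?f1 ?g1.
- exact: llipD.
- by move=> x Ox; rewrite (le_trans (ler_normD _ _))// lerD ?f1 ?g1.
- exact: llipD.
- move=> i; have [d1 d2] := f3 i; have [e1 e2] := g3 i; split.
    by move=> x Ox; apply: derivableD; [exact: d1|exact: e1].
  apply: Cb_ext (IH _ _ d2 e2) => x Ox.
  by rewrite -(deriveD (d1 x Ox) (e1 x Ox)).
Qed.

Lemma CbM k B B' f g : 0 <= B -> 0 <= B' -> Cb k B f -> Cb k B' g ->
  Cb k (2 ^+ k.+1 * (B * B')) (fun x => f x * g x).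
Proof.
move=> B0 B0'; have BB : 0 <= B * B' by rewrite mulr_ge0.
elim: k f g => [|k IH] f g hf hg.
  have [f1 f2 _] := hf; have [g1 g2 _] := hg; rewrite expr1; split => //; last exact: llipM.
  move=> x Ox; rewrite normrM (le_trans (ler_pM _ _ (f1 x Ox) (g1 x Ox)))//.
  by rewrite ler_peMl// ler1n.
have [f1 f2 f3] := hf; have [g1 g2 g3] := hg.
have le2 : 2 * (B * B') <= 2 ^+ k.+2 * (B * B').
  apply: ler_wpM2r => //; rewrite exprS ler_peMr// exprn_ege1// ler1n //.
split.
- move=> x Ox; rewrite normrM (le_trans (ler_pM _ _ (f1 x Ox) (g1 x Ox)))//.
  by rewrite (le_trans _ le2)// ler_peMl// ler1n.
- exact: llipW le2 (llipM _ _ _ _ _ _).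
- move=> i; have [d1 d2] := f3 i; have [e1 e2] := g3 i; split.
    by move=> x Ox; apply: derivableM; [exact: d1|exact: e1].
  have h1 := IH _ _ (CbS hf) e2; have h2 := IH _ _ d2 (CbS hg).
  have E : 2 ^+ k.+2 * (B * B') = 2 ^+ k.+1 * (B * B') + 2 ^+ k.+1 * (B * B').
    by rewrite exprS; ring.
  rewrite E; apply: Cb_ext (CbD h1 h2) => x Ox.
  by rewrite (deriveM (d1 x Ox) (e1 x Ox)) /GRing.scale /= [_ * g x]mulrC.
Qed.

Lemma Cb_cst k c : Cb k `|c| (fun=> c).
Proof.
elim: k c => [|k IH] c; split => //.
- by move=> x _; exists 1 => // y z _ _; rewrite subrr normr0 mulr_ge0.
- by move=> x _; exists 1 => // y z _ _; rewrite subrr normr0 mulr_ge0.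
- move=> i; split; first by move=> x _; exact: derivable_cst.
  apply: (@CbW _ `|0|); first by rewrite normr0.
  by apply: Cb_ext (IH 0) => x _; rewrite derive_cst.
Qed.

Lemma CbN k B f : Cb k B f -> Cb k B (fun x => - f x).
Proof.
elim: k f => [|k IH] f [f1 f2 f3]; split => //.
- by move=> x Ox; rewrite normrN; exact: f1.
- by move=> x /f2[d d0 hd]; exists d => // y z hy hz; rewrite opprK addrC distrC; exact: hd.
- by move=> x Ox; rewrite normrN; exact: f1.
- by move=> x /f2[d d0 hd]; exists d => // y z hy hz; rewrite opprK addrC distrC; exact: hd.
- move=> i; have [d1 d2] := f3 i; split.
    by move=> x Ox; apply: derivableN; exact: d1.
  apply: Cb_ext (IH _ d2) => x Ox.
  by rewrite -(deriveN (d1 x Ox)).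
Qed.

Lemma Cb_sum (I : Type) (r : seq I) k B (f : I -> pt -> R) : (forall i, Cb k B (f i)) ->
  Cb k ((size r)%:R * B) (fun x => \sum_(i <- r) f i x).
Proof.
move=> hf; elim: r => [|i r IH].
  apply: (@CbW k `|0|); first by rewrite normr0 mul0r.
  apply: Cb_ext (Cb_cst k 0) => x _.
  by rewrite big_nil.
rewrite /= -add1n natrD mulrDl mul1r; apply: Cb_ext (CbD (hf i) IH) => x _.
by rewrite big_cons.
Qed.

Lemma natrS (m : nat) : m.+1%:R = 1 + m%:R :> R.
Proof. by rewrite -natr1 addrC. Qed.

(** The increment is made one coordinate at a time. The intermediate points leave the segment from
    [z] to [z + w] but stay within [n%:R] times the norm of [w] from [z], hence the room
    required. *)
Lemma path_lip h (x : pt) (d b : R) : 0 <= b ->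
  (forall y i t, `|y - x| < d -> `|y + t *: ebase i - x| < d ->
     `|h (y + t *: ebase i) - h y| <= b * `|t|) ->
  forall z w : pt, `|z - x| + n%:R * `|w| < d -> `|h (z + w) - h z| <= n%:R * b * `|w|.
Proof.
move=> b0 hb z w hzw.
suff main (l : seq 'I_n) : `|z - x| + (size l)%:R * `|w| < d ->
    `|h (z + \sum_(i <- l) w 0 i *: ebase i) - h z| <= (size l)%:R * b * `|w|.
  have := main (index_enum 'I_n); rewrite -(rV_sum_ebase w).
  by rewrite -sum1_size sum1_card card_ord; apply.
elim: l => [|i l IH] hl; first by rewrite big_nil addr0 subrr normr0 mul0r mul0r.
rewrite big_cons /= natrS mulrDl mul1r mulrDl.
rewrite /= natrS mulrDl mul1r in hl.
set p := \sum_(j <- l) _ in IH *.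
have np : `|p| <= (size l)%:R * `|w|.
  rewrite /p; elim: l {IH hl p} => [|j l IHl]; first by rewrite big_nil normr0 mul0r.
  rewrite big_cons (le_trans (ler_normD _ _))// /= natrS mulrDl mul1r lerD//.
  rewrite normrZ -[leRHS]mulr1; apply: ler_pM => //; [exact: coord_le_norm|exact: norm_ebase_le].
have nw : `|w 0 i *: (ebase i : pt)| <= `|w|.
  rewrite normrZ -[leRHS]mulr1; apply: ler_pM => //; [exact: coord_le_norm|exact: norm_ebase_le].
have n0 : 0 <= `|w| by [].
have IH' := IH (_ : `|z - x| + (size l)%:R * `|w| < d).
have {}IH : `|h (z + p) - h z| <= (size l)%:R * b * `|w| by apply: IH'; lra.
rewrite [w 0 i *: _ + p]addrC addrA.
have -> : h (z + p + w 0 i *: ebase i) - h z = (h (z + p + w 0 i *: ebase i) - h (z + p)) + (h (z + p) - h z).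
  by rewrite addrA subrK.
rewrite (le_trans (ler_normD _ _))// lerD//.
have h1 : `|z + p - x| < d.
  by have := ler_normD (z - x) p; rewrite [z - x + p]addrAC; lra.
have h2 : `|z + p + w 0 i *: ebase i - x| < d.
  have := ler_normD (z + p - x) (w 0 i *: ebase i); have := ler_normD (z - x) p.
  by rewrite [z - x + p]addrAC [z + p - x + _]addrAC; lra.
rewrite (le_trans (hb _ _ _ h1 h2))//; apply: ler_wpM2l => //.
exact: coord_le_norm.
Qed.

Lemma llip_of_path h b : 0 <= b ->
  (forall x, O x -> exists2 d : R, 0 < d & forall y i t, `|y - x| < d -> `|y + t *: ebase i - x| < d ->
     `|h (y + t *: ebase i) - h y| <= b * `|t|) -> llip O (n%:R * b) h.
Proof.
move=> b0 hb x Ox; have [d d0 hd] := hb x Ox.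
have N0 : 0 < (n%:R : R) * 2 + 1 by rewrite ltr_wpDl// mulr_ge0.
exists (d / (n%:R * 2 + 1)); first exact: divr_gt0.
set d' := d / _; have dd : d' * (n%:R * 2 + 1) = d by rewrite divfK// gt_eqF.
move=> y z; rewrite -!ball_normE /= => hy hz.
have yz : `|y - z| < 2 * d'.
  by have := ler_distD x y z; rewrite [`|y - x|]distrC; lra.
have := path_lip b0 hd (z := z) (w := y - z); rewrite [z + (y - z)]addrC subrK; apply.
rewrite distrC.
have : n%:R * `|y - z| <= n%:R * (2 * d') by apply: ler_wpM2l => //; exact: ltW.
lra.
Qed.

End Classes.

Section Partials.
Context {R : realType} {n : nat}.
Local Notation pt := 'rV[R]_n.
Variable O : set pt.
Hypothesis oO : open O.
Implicit Types (h g : pt -> R) (B : R).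

Lemma segment_near (x y v : pt) (d s : R) : `|y - x| < d -> `|y + v - x| < d ->
  0 <= s <= 1 -> `|s *: v + y - x| < d.
Proof.
move=> h1 h2 /andP[s0 s1].
have -> : s *: v + y - x = (1 - s) *: (y - x) + s *: (y + v - x).
  by apply/rowP => j; rewrite !mxE; ring.
rewrite (le_lt_trans (ler_normD _ _))// !normrZ !ger0_norm ?subr_ge0//.
have [->|sn0] := eqVneq s 0; first by rewrite subr0 mul1r mul0r addr0.
have sp : 0 < s by rewrite lt_def sn0.
have e1 : (1 - s) * `|y - x| <= (1 - s) * d by rewrite ler_wpM2l ?subr_ge0// ltW.
have e2 : s * `|y + v - x| < s * d by rewrite ltr_pM2l.
lra.
Qed.

Lemma mvt_ebase h (x y : pt) (d t : R) (l : pt -> R) i b : 0 <= b ->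
  (forall z, `|z - x| < d -> is_derive z (ebase i) h (l z) /\ `|l z| <= b) ->
  `|y - x| < d -> `|y + t *: ebase i - x| < d -> `|h (y + t *: ebase i) - h y| <= b * `|t|.
Proof.
move=> b0 hl h1 h2.
have dd s : 0 <= s <= 1 -> is_derive (s *: (t *: ebase i) + y) (t *: ebase i) h (t *: l (s *: (t *: ebase i) + y)).
  by move=> hs; apply: is_derive_scale; apply: (hl _ _).1; exact: segment_near.
have [s hs ->] := mvt_line dd.
rewrite normrM mulrC; apply: ler_wpM2r => //.
by apply: (hl _ _).2; exact: segment_near.
Qed.

Lemma llip_of_partials h b : 0 <= b ->
  (forall x, O x -> forall i, derivable h x (ebase i) /\ `|'D_(ebase i) h x| <= b) ->
  llip O (n%:R * b) h.
Proof.
move=> b0 dh; apply: llip_of_path => // x Ox.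
have /nbhs_ballP[d /= d0 hd] := near_O oO Ox.
exists d => // y i t; apply: (mvt_ebase (l := fun z => 'D_(ebase i) h z)) => // z hz.
have Oz : O z by apply: hd; rewrite -ball_normE /= distrC.
by have [d1 d2] := dh z Oz i; split => //; exact: derivableP.
Qed.

(** On a given axis-parallel segment the partial derivative may exist nowhere. The almost everywhere
    bound is therefore averaged by [lip_wbound] and brought back to the segment by [wbound_path],
    with a single constant field. *)
Lemma llip_of_ae h b : 0 <= b -> loc_lipschitz O h ->
  (forall i, exists2 N, nullRn N & forall x, O x -> ~ N x ->
     derivable h x (ebase i) /\ `|'D_(ebase i) h x| <= b) ->
  llip O (n%:R * b) h.
Proof.
move=> b0 lh dh; apply: llip_of_path => // x Ox.
have /nbhs_ballP[d /= d0 hd] := near_O oO Ox.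
exists d => // y i t h1 h2.
have [N N0 dN] := dh i.
have wb := lip_wbound oO lh N0 b0 dN.
pose gam (s : R) := s *: (t *: ebase i) + y : pt.
have gO s : 0 <= s <= 1 -> O (gam s).
  by move=> hs; apply: hd; rewrite -ball_normE /= distrC; exact: segment_near.
have ns : `|t *: (ebase i : pt)| <= `|t|.
  by rewrite normrZ ler_piMr// norm_ebase_le.
have lip s u : 0 <= s <= 1 -> 0 <= u <= 1 -> `|gam s - gam u| <= `|t| * `|s - u|.
  move=> _ _; rewrite /gam opprD addrACA subrr addr0 -scalerBl normrZ mulrC.
  by apply: ler_wpM2r.
have nul : (@lebesgue_measure R).-negligible set0 by exact: negligible_set0.
have dg s : 0 <= s <= 1 -> ~ set0 s -> derivable gam s 1 /\
    'D_1 gam s = \sum_(j < 1) t *: ebase i.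
  move=> _ _; rewrite big_ord1.
  suff [d1 d2] : is_derive s 1 gam (t *: ebase i) by [].
  apply: is_derive_expandP => e e0; exists 1 => // u _.
  have -> : gam (s + u *: 1) - gam s - u *: (t *: ebase i) = 0.
    by rewrite [u *: (1 : R)]mulr1; apply/rowP => j; rewrite /gam !mxE; ring.
  by rewrite normr0 mulr_ge0// ltW.
have := wbound_path (F := fun (_ : 'I_1) (_ : pt) => ebase i) (c := fun (_ : 'I_1) (_ : R) => t)
  oO (loc_lipschitz_continuous oO lh) (fun _ => wb) b0 (normr_ge0 t) gO (normr_ge0 t) lip nul dg
  (fun _ _ _ => lexx _) (lexx 0) ler01 (lexx 1).
rewrite /gam scale1r scale0r add0r subr0 mulr1 mul1r [t *: _ + y]addrC mulrC.
exact.
Qed.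

Lemma Cb_taylor B h x : 0 <= B -> Cb O 1 B h -> O x ->
  exists d K : R, [/\ 0 < d, 0 <= K & forall w : pt, `|w| < d ->
    `|h (x + w) - h x - \sum_i w 0 i * 'D_(ebase i) h x| <= K * `|w| ^+ 2].
Proof.
move=> B0 [_ _ hD] Ox.
have [dd hdd] := choice (fun i => let: conj p (And3 _ q _) := hD i in
  let: ex_intro2 d a b := q x Ox in ex_intro _ d (conj a b)).
have [d1 d10 hd1] := fin_min_pos (fun i => (hdd i).1).
have /nbhs_ballP[d2 /= d20 hd2] := near_O oO Ox.
pose d := Num.min d1 d2; have d0 : 0 < d by rewrite lt_min d10.
have N0 : 0 < (n%:R : R) + 1 by rewrite ltr_wpDl.
exists (d / (n%:R + 1)), (n%:R * (B * (n%:R + 1))); split.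
- by rewrite divr_gt0.
- by rewrite !mulr_ge0// addr_ge0.
move=> w; rewrite ltr_pdivlMr// => hw.
have [->|w0] := eqVneq w 0.
  by rewrite addr0 subrr big1 ?subr0 ?normr0 ?expr0n ?mulr0// => i _; rewrite mxE mul0r.
have nw : 0 < `|w| by rewrite normr_gt0.
(* The coordinate path from [x] to [x + w] stays within this radius, where the partial derivatives
   of [h] minus its linearization at [x] are at most [B * r]; integrating gives a quadratic
   remainder. *)
pose r := `|w| * (n%:R + 1).
have r0 : 0 < r by rewrite mulr_gt0.
pose k (z : pt) := h z - \sum_i z 0 i * 'D_(ebase i) h x.
have dlin (z : pt) i : is_derive z (ebase i) (fun z : pt => \sum_j z 0 j * 'D_(ebase j) h x) ('D_(ebase i) h x).
  apply: is_derive_expandP => e e0; exists 1 => // u _.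
  rewrite -sumrB (eq_bigr (fun j => u * ((ebase i : pt) 0 j * 'D_(ebase j) h x))); last first.
    by move=> j _; rewrite !mxE -mulrBl addrAC subrr add0r; ring.
  rewrite -mulr_sumr sum_ebase_mul /GRing.scale /= subrr normr0 mulr_ge0// ltW//.
have dk z i : `|z - x| < r -> is_derive z (ebase i) k ('D_(ebase i) h z - 'D_(ebase i) h x) /\
    `|'D_(ebase i) h z - 'D_(ebase i) h x| <= B * r.
  move=> hz.
  have zd : ball x d z by rewrite -ball_normE /= distrC (lt_trans hz).
  have Oz : O z by apply: hd2; apply: le_ball zd; rewrite ge_min lexx orbT.
  split.
    have p1 := derivableP ((hD i).1 z Oz).
    exact: (is_deriveB p1 (dlin z i)).
  have hx : ball x (dd i) x by apply: ballxx; exact: (hdd i).1.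
  have hz' : ball x (dd i) z by apply: le_ball zd; rewrite (le_trans _ (hd1 i))// ge_min lexx.
  rewrite (le_trans ((hdd i).2 z x hz' hx))//; apply: ler_wpM2l => //; exact: ltW.
have Br0 : 0 <= B * r by rewrite mulr_ge0// ltW.
have := @path_lip R n k x r (B * r) Br0 _ x w.
rewrite subrr normr0 add0r => /(_ _ _)/le_trans.
have E : k (x + w) - k x = h (x + w) - h x - \sum_i w 0 i * 'D_(ebase i) h x.
  have S : \sum_i (x + w) 0 i * 'D_(ebase i) h x = \sum_i x 0 i * 'D_(ebase i) h x + \sum_i w 0 i * 'D_(ebase i) h x.
    by rewrite -big_split /=; apply: eq_bigr => i _; rewrite mxE mulrDl.
  by rewrite /k S; ring.
rewrite -E; apply.
- by move=> y i t; apply: mvt_ebase => // z; exact: dk.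
- by rewrite /r mulrC ltr_pM2l// ltrDl.
- rewrite (_ : n%:R * (B * r) * `|w| = n%:R * (B * (n%:R + 1)) * `|w| ^+ 2)//.
  by rewrite /r; ring.
Qed.

End Partials.

(** * Uniform bounds for the fields and the shorter commutators *)

Section Fields.
Context {R : realType} {n m : nat}.
Local Notation pt := 'rV[R]_n.
Variable O : set pt.
Hypothesis oO : open O.
Implicit Types (h g : pt -> R) (B : R).

Lemma derivable_coord (F : pt -> pt) (x v : pt) c : derivable F x v ->
  derivable (fun y => F y 0 c) x v /\ 'D_v F x 0 c = 'D_v (fun y => F y 0 c) x.
Proof.
by move=> dF; split; [exact: (derivable_mxP F x v).1|rewrite derive_mx// mxE].
Qed.

Lemma llip_derive_bound B h x v : 0 <= B -> llip O B h -> O x -> `|'D_v h x| <= B * `|v|.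
Proof.
move=> B0 hl Ox; have [d d0 hd] := hl x Ox.
have v0 : 0 < `|v| + 1 by rewrite ltr_wpDl.
apply: (derive_lip_bound (s0 := d / (`|v| + 1))); rewrite ?divr_gt0 ?mulr_ge0// => s /andP[s0 sd].
rewrite -mulrA; have -> : `|v| * s = `|x + s *: v - x|.
  by rewrite addrAC subrr add0r normrZ gtr0_norm// mulrC.
apply: hd; last exact: ballxx.
rewrite -ball_normE /= opprD addrA subrr add0r normrN normrZ gtr0_norm//.
by rewrite ltr_pdivlMr// in sd; rewrite (le_lt_trans _ sd)// ler_wpM2l ?(ltW s0)// lerDl.
Qed.

Lemma Cb_is_derive B h x v : 0 <= B -> Cb O 1 B h -> O x ->
  is_derive x v h (\sum_i v 0 i * 'D_(ebase i) h x).
Proof.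
move=> B0 hC Ox; have [d [K [d0 K0 hd]]] := Cb_taylor oO B0 hC Ox.
apply: is_derive_expandP => e e0.
have v0 : 0 < `|v| + 1 by rewrite ltr_wpDl.
have Kv0 : 0 < K * `|v| ^+ 2 + 1 by rewrite ltr_wpDl// mulr_ge0// exprn_ge0.
exists (Num.min (d / (`|v| + 1)) (e / (K * `|v| ^+ 2 + 1))).
  by rewrite lt_min !divr_gt0.
move=> u; rewrite lt_min !ltr_pdivlMr// => /andP[u1 u2].
have uv : `|u *: v| < d by rewrite normrZ (le_lt_trans _ u1)// ler_wpM2l// lerDl.
have := hd _ uv.
have -> : \sum_i (u *: v) 0 i * 'D_(ebase i) h x = u *: \sum_i v 0 i * 'D_(ebase i) h x.
  by rewrite scaler_sumr; apply: eq_bigr => i _; rewrite mxE /GRing.scale /= mulrA.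
move=> /le_trans; apply; rewrite normrZ.
have -> : K * (`|u| * `|v|) ^+ 2 = (`|u| * (K * `|v| ^+ 2)) * `|u| by ring.
apply: ler_wpM2r => //; apply: ltW; apply: le_lt_trans u2.
by rewrite ler_wpM2l// lerDl.
Qed.

Variables (f : 'I_m -> pt -> pt) (s : nat) (Lv : R).
Hypothesis s2 : (2 <= s)%N.
Hypothesis cA : classA f s O.
Hypothesis hL : is_L f s O Lv.

Lemma is_L_bounds : [/\ 0 <= Lv,
  forall j (l : seq 'I_n), (size l <= s - 2)%N -> forall x, O x -> enorm (Dop l (f j) x) <= Lv,
  forall j (i : 'I_n) (l : seq 'I_n), size l = (s - 2)%N ->
     ae_on O (fun x => derivable (Dop l (f j)) x (ebase i) /\ enorm (Dop (i :: l) (f j) x) <= Lv) &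
  forall j k (w : seq 'I_m), size w = (s - 1)%N ->
     forall G, weak_deriv_Linf O (f k) (Xder f j (fw f w)) G -> ae_on O (fun x => enorm (G x) <= Lv)].
Proof.
have [a1 [a2 [a3 [[h1 m1] [[h2 m2] [[h3 m3] ->]]]]]] := hL.
(* A negative least bound could only hold vacuously, since norms are nonnegative; then [a1 - 1]
   would be a bound too. The same argument serves for [a2] and [a3]. *)
have a10 : 0 <= a1.
  rewrite leNgt; apply/negP => a0; have := m1 (a1 - 1); rewrite lerBrDl -subr_ge0.
  have h : forall j (l : seq 'I_n), (size l <= s - 2)%N -> forall x, O x -> enorm (Dop l (f j) x) <= a1 - 1.
    by move=> j l hl x Ox; have := h1 j l hl x Ox; have := enorm_ge0 (Dop l (f j) x); lra.
  by move=> /(_ h); lra.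
have a20 : 0 <= a2.
  rewrite leNgt; apply/negP => a0.
  have h : forall j (i : 'I_n) (l : seq 'I_n), size l = (s - 2)%N ->
     ae_on O (fun x => derivable (Dop l (f j)) x (ebase i) /\ enorm (Dop (i :: l) (f j) x) <= a2 - 1).
    move=> j i l hl; have [N [N0 hN]] := h2 j i l hl; exists N; split => // x Ox nN.
    by have [_ hh] := hN x Ox nN; have := enorm_ge0 (Dop (i :: l) (f j) x); lra.
  by have := m2 _ h; lra.
have a30 : 0 <= a3.
  rewrite leNgt; apply/negP => a0.
  have h : forall j k (w : seq 'I_m), size w = (s - 1)%N ->
     forall G, weak_deriv_Linf O (f k) (Xder f j (fw f w)) G -> ae_on O (fun x => enorm (G x) <= a3 - 1).
    move=> j k w hw G hG; have [N [N0 hN]] := h3 j k w hw G hG; exists N; split => // x Ox nN.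
    by have := hN x Ox nN; have := enorm_ge0 (G x); lra.
  by have := m3 _ h; lra.
split; first by rewrite !addr_ge0.
- by move=> j l hl x Ox; have := h1 j l hl x Ox; lra.
- move=> j i l hl; have [N [N0 hN]] := h2 j i l hl; exists N; split => // x Ox nN.
  by have [? hh] := hN x Ox nN; split => //; lra.
- move=> j k w hw G hG; have [N [N0 hN]] := h3 j k w hw G hG; exists N; split => // x Ox nN.
  by have := hN x Ox nN; lra.
Qed.

Let L0 : 0 <= Lv. Proof. by case: is_L_bounds. Qed.

Definition Bfield : R := (n%:R + 1) * Lv.

Lemma Bfield_ge0 : 0 <= Bfield.
Proof. by rewrite mulr_ge0// addr_ge0. Qed.

Let LB : Lv <= Bfield.
Proof. by rewrite /Bfield mulrDl mul1r lerDr mulr_ge0. Qed.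

Let nLB : n%:R * Lv <= Bfield.
Proof. by rewrite /Bfield mulrDl mul1r lerDl. Qed.

Lemma loc_lipschitz_coord (F : pt -> pt) c : loc_lipschitz O F -> loc_lipschitz O (fun y => F y 0 c).
Proof.
move=> hF x Ox; have [d [M [d0 hd]]] := hF x Ox; exists d, M; split => // y z Oy Oz hy hz.
apply: le_trans (hd y z Oy Oz hy hz).
by have := coord_le_norm (F y - F z) c; rewrite !mxE.
Qed.

(** At order [s - 2] the next derivatives exist only almost everywhere, so the Lipschitz constant
    comes from [llip_of_ae]; at lower orders the partial derivatives exist everywhere and
    [llip_of_partials] applies. *)
Lemma Dop_Cb (k : nat) (l : seq 'I_n) j c : (size l + k = s - 2)%N ->
  Cb O k Bfield (fun x => Dop l (f j) x 0 c).
Proof.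
have [_ b1 b2 _] := is_L_bounds.
elim: k l => [|k IH] l hl.
  rewrite addn0 in hl.
  have hl' : (size l <= s - 2)%N by rewrite hl.
  have [l1 _] := cA.1 j l hl'.
  split => //.
    by move=> x Ox; rewrite (le_trans (coord_le_enorm _ _))// (le_trans _ LB)// b1.
  apply: llipW nLB _; apply: (llip_of_ae oO) => //; first exact: loc_lipschitz_coord.
  move=> i; have [N [N0 hN]] := b2 j i l hl; exists N => // x Ox nN.
  have [d1 d2] := hN x Ox nN; have [e1 e2] := derivable_coord c d1; split => //.
  by rewrite -e2 (le_trans (coord_le_enorm _ _)).
have hl' : (size l < s - 2)%N by rewrite -hl addnS ltnS leq_addr.
have [_ /(_ hl') l2] := cA.1 j l (ltnW hl').
split.
- by move=> x Ox; rewrite (le_trans (coord_le_enorm _ _))// (le_trans _ LB)// b1// ltnW.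
- apply: llipW nLB _; apply: (llip_of_partials oO) => // x Ox i.
  have [e1 e2] := derivable_coord c (l2 i x Ox); split => //.
  by rewrite -e2 (le_trans (coord_le_enorm _ _))//; exact: (b1 j (i :: l)).
- move=> i; split; first by move=> x Ox; have [] := derivable_coord c (l2 i x Ox).
  apply: (Cb_ext oO _ (IH (i :: l) _)); last by rewrite /= addSn -addnS.
  by move=> x Ox /=; have [_ ->] := derivable_coord c (l2 i x Ox).
Qed.

Lemma f_Cb j c : Cb O (s - 2) Bfield (fun x => f j x 0 c).
Proof. exact: (@Dop_Cb _ [::] j c). Qed.

(** A bracket has two sums of [n] products, each costing at most [2 ^+ s] in [CbM], and one factor
    of each product is bounded by [Bfield]. The added ones keep the value at least 1, so that [Bw]
    is monotone. *)
Definition Qfield : R := (2 * n%:R * 2 ^+ s + 1) * (Bfield + 1).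
(* Bounds, in the sense of Cb, the coefficients f_w with |w| = l < s; each bracket
   costs a factor Qfield by the Leibniz rule. *)
Definition Bw (l : nat) : R := (Bfield + 1) * Qfield ^+ l.

Lemma Qfield_ge1 : 1 <= Qfield.
Proof.
rewrite /Qfield -[leLHS]mulr1; apply: ler_pM => //.
  by rewrite lerDr !mulr_ge0.
by rewrite lerDr Bfield_ge0.
Qed.

Lemma Bw_ge0 l : 0 <= Bw l.
Proof. by rewrite /Bw mulr_ge0 ?addr_ge0 ?Bfield_ge0// exprn_ge0// (le_trans _ Qfield_ge1). Qed.

Lemma Bw_le l l' : (l <= l')%N -> Bw l <= Bw l'.
Proof.
move=> ll; rewrite /Bw ler_wpM2l ?addr_ge0 ?Bfield_ge0//.
exact: (ler_weXn2l Qfield_ge1).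
Qed.

Lemma BfieldBw l : Bfield <= Bw l.
Proof.
rewrite (le_trans _ (Bw_le (leq0n l)))// /Bw expr0 mulr1 lerDl//.
Qed.

Lemma fw_cons j w x : (0 < size w)%N -> fw f (j :: w) x = Xder f j (fw f w) x - 'D_(fw f w x) (f j) x.
Proof. by case: w. Qed.

Lemma derivable_of_Cb (F : pt -> pt) B x v : 0 <= B -> (forall c, Cb O 1 B (fun y => F y 0 c)) -> O x ->
  derivable F x v /\ forall c, 'D_v F x 0 c = \sum_i v 0 i * 'D_(ebase i) (fun y => F y 0 c) x.
Proof.
move=> B0 hF Ox.
have dF : derivable F x v.
  apply/derivable_mxP => i c; rewrite (ord1 i).
  by have [] := Cb_is_derive v B0 (hF c) Ox.
split => // c; have [_ ->] := derivable_coord c dF.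
by have [] := Cb_is_derive v B0 (hF c) Ox.
Qed.

Lemma fw_Cb (w : seq 'I_m) k c : (0 < size w)%N -> (size w + k <= s - 1)%N ->
  Cb O k (Bw (size w)) (fun x => fw f w x 0 c).
Proof.
elim: w k c => [//|j w IH] k c _ hw.
case: w IH hw => [|j' w] IH hw.
  apply: CbW (BfieldBw _) _; apply: Cb_le (f_Cb j c).
  by move: hw; rewrite /= add1n; move: s2; case: (s) => [|[|s']]//; rewrite !subSS !subn0.
set w' := j' :: w in IH hw *.
have hk : (size w' + k.+1 <= s - 1)%N by rewrite addnS -addSn.
have ks : (k.+1 <= s - 2)%N.
  move: hk; rewrite /w' /=; move: s2; case: (s) => [|[|s']]//; rewrite !subSS !subn0 addSn ltnS.
  by move=> _; rewrite ltnS; apply: leq_trans; rewrite leq_addl.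
have hw' c' := IH k.+1 c' isT hk.
have hj c' : Cb O k.+1 Bfield (fun x => f j x 0 c') := Cb_le ks (f_Cb j c').
have hw1 c' : Cb O 1 (Bw (size w')) (fun x => fw f w' x 0 c') := Cb_le (ltn0Sn k) (hw' c').
have hj1 c' : Cb O 1 Bfield (fun x => f j x 0 c') := Cb_le (ltn0Sn k) (hj c').
have p1 : Cb O k (n%:R * (2 ^+ k.+1 * (Bfield * Bw (size w')))) (fun x => \sum_i f j x 0 i * 'D_(ebase i) (fun y => fw f w' y 0 c) x).
  have := Cb_sum oO (index_enum 'I_n) (fun i : 'I_n =>
    CbM oO Bfield_ge0 (Bw_ge0 _) (CbS (hj i)) ((let: And3 _ _ q := hw' c in q) i).2).
  by rewrite -sum1_size sum1_card card_ord.
have p2 : Cb O k (n%:R * (2 ^+ k.+1 * (Bw (size w') * Bfield))) (fun x => \sum_i fw f w' x 0 i * 'D_(ebase i) (fun y => f j y 0 c) x).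
  have := Cb_sum oO (index_enum 'I_n) (fun i : 'I_n =>
    CbM oO (Bw_ge0 _) Bfield_ge0 (CbS (hw' i)) ((let: And3 _ _ q := hj c in q) i).2).
  by rewrite -sum1_size sum1_card card_ord.
have p3 := CbD oO p1 (CbN oO p2).
have E x : O x -> \sum_i f j x 0 i * 'D_(ebase i) (fun y => fw f w' y 0 c) x
    + - \sum_i fw f w' x 0 i * 'D_(ebase i) (fun y => f j y 0 c) x = fw f (j :: w') x 0 c.
  move=> Ox; rewrite fw_cons// [RHS]mxE [in RHS]mxE /Xder.
  have [_ ->] := derivable_of_Cb (f j x) (Bw_ge0 _) hw1 Ox.
  by have [_ ->] := derivable_of_Cb (fw f w' x) Bfield_ge0 hj1 Ox.
apply: CbW (Cb_ext oO E p3).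
have B0 := Bfield_ge0; have W0 := Bw_ge0 (size w').
have k2 : 2 ^+ k.+1 <= (2 : R) ^+ s.
  by apply: ler_weXn2l; [rewrite ler1n|rewrite (leq_trans ks)// leq_subr].
have -> : Bw (size [:: j, j' & w]) = Qfield * Bw (size w') by rewrite /Bw exprS; ring.
have -> : n%:R * (2 ^+ k.+1 * (Bfield * Bw (size w'))) + n%:R * (2 ^+ k.+1 * (Bw (size w') * Bfield)) =
    (2 * n%:R * 2 ^+ k.+1) * Bfield * Bw (size w') by ring.
apply: ler_wpM2r => //; rewrite /Qfield; apply: ler_pM => //.
- have c0 : 0 <= 2 * n%:R :> R by rewrite mulr_ge0.
  by apply: le_trans (ler_wpM2l c0 k2) _; rewrite lerDl.
- by rewrite lerDl.
Qed.

End Fields.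

(** * Determinants *)

Section DetTaylor.
Context {R : realType}.
Implicit Types (K t : R).

Lemma prod_taylor n K : 0 <= K -> exists2 C : R, 0 <= C & forall (a b : 'I_n -> R) t, 0 <= t <= 1 ->
  (forall i, `|a i| <= K) -> (forall i, `|b i| <= K) ->
  `|\prod_i (a i + t * b i) - \prod_i a i - t * \sum_j \prod_i (if i == j then b i else a i)| <= C * t ^+ 2.
Proof.
move=> K0; elim: n => [|n [C C0 IH]].
  by exists 0 => // a b t _ _ _; rewrite !big_ord0 mulr0 subrr subr0 normr0 mul0r.
exists (2 * K * C + K * (n%:R * K ^+ n)) => [|a b t t01 ha hb].
  by rewrite addr_ge0 ?mulr_ge0// exprn_ge0.
have {IH} := IH (fun i => a (lift ord0 i)) (fun i => b (lift ord0 i)) t t01 (fun i => ha _) (fun i => hb _).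
rewrite 3!big_ord_recl.
set X := \prod_(i < n) (_ + _); set A := \prod_(i < n) a _.
rewrite (_ : \prod_(i < n.+1) (if i == ord0 then b i else a i) = b ord0 * A); last first.
  by rewrite big_ord_recl eqxx; congr (_ * _).
rewrite (_ : \sum_(i < n) \prod_(i0 < n.+1) _ = a ord0 *
    \sum_(j < n) \prod_(i < n) (if i == j then b (lift ord0 i) else a (lift ord0 i))); last first.
  rewrite mulr_sumr; apply: eq_bigr => j _; rewrite big_ord_recl (negbTE (neq_lift _ _)); congr (_ * _).
set S := \sum_(j < n) _ => IH.
have hS : `|S| <= n%:R * K ^+ n.
  rewrite (le_trans (ler_norm_sum _ _ _))//.
  apply: le_trans (ler_sum (G := fun=> K ^+ n) _ _) _ => [j _|].
    rewrite normr_prod; apply: le_trans (ler_prod (E2 := fun=> K) _ _) _ => [i _|].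
      by rewrite normr_ge0 /=; case: ifP.
    by rewrite prodr_const card_ord.
  by rewrite sumr_const card_ord mulr_natl.
have -> : (a ord0 + t * b ord0) * X - a ord0 * A - t * (b ord0 * A + a ord0 * S) =
  (a ord0 + t * b ord0) * (X - A - t * S) + t ^+ 2 * (b ord0 * S) by ring.
have /andP[t0 t1] := t01.
have t20 : 0 <= t ^+ 2 by rewrite exprn_ge0.
rewrite (le_trans (ler_normD _ _))// normrM [`|t ^+ 2 * _|]normrM [`|b ord0 * _|]normrM (ger0_norm t20).
rewrite [X in _ <= X]mulrDl; apply: lerD.
  rewrite -mulrA; apply: ler_pM => //.
  rewrite (le_trans (ler_normD _ _))// normrM (ger0_norm t0).
  have : t * `|b ord0| <= 1 * K by apply: ler_pM.
  by have := ha ord0; lra.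
by rewrite mulrC; apply: ler_wpM2r => //; apply: ler_pM.
Qed.

Lemma det_bound n K (A : 'M[R]_n) : (forall i j, `|A i j| <= K) -> `|\det A| <= n`!%:R * K ^+ n.
Proof.
move=> hA; rewrite (le_trans (ler_norm_sum _ _ _))//.
apply: le_trans (ler_sum (G := fun=> K ^+ n) _ _) _ => [j _|].
  rewrite normrM normrX normrN1 expr1n mul1r normr_prod.
  apply: le_trans (ler_prod (E2 := fun=> K) _ _) _ => [i _|]; first by rewrite normr_ge0 hA.
  by rewrite prodr_const card_ord.
by rewrite sumr_const card_Sn mulr_natl.
Qed.

Lemma adj_bound n K (A : 'M[R]_n) a i : (forall i j, `|A i j| <= K) ->
  `|(\adj A) a i| <= n.-1`!%:R * K ^+ n.-1.
Proof.
move=> hA; rewrite mxE /cofactor normrM normrX normrN1 expr1n mul1r.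
by apply: det_bound => j k; rewrite !mxE.
Qed.

(** Cramer's rule without division, hence valid for degenerate frames as well. *)
Lemma mul_adj_det n p (M : 'M[R]_n) (V : 'M[R]_(n, p)) b j :
  (\adj M *m V) b j = \det (\matrix_(i, k) if k == b then V i j else M i k).
Proof.
rewrite (expand_det_col _ b) mxE; apply: eq_bigr => i _; rewrite !mxE eqxx mulrC; congr (_ * _).
rewrite /cofactor; congr (_ * \det _); apply/matrixP => k l; rewrite !mxE.
by rewrite eq_sym (negbTE (neq_lift _ _)).
Qed.

Lemma mulmx_adj_det n (M B : 'M[R]_n) j :
  (B *m \adj M) j j = \det (\matrix_(i, k) if i == j then B i k else M i k).
Proof.
rewrite (expand_det_row _ j) mxE; apply: eq_bigr => i _; rewrite !mxE eqxx; congr (_ * _).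
rewrite /cofactor; congr (_ * \det _); apply/matrixP => k l; rewrite !mxE.
by rewrite eq_sym (negbTE (neq_lift _ _)).
Qed.

(** Jacobi's formula with a remainder uniform in [A] and [B]. Uniformity matters because [B] will be
    a difference quotient that varies with [t] and need not converge. *)
Lemma det_taylor n K : 0 <= K -> exists2 C : R, 0 <= C & forall (A B : 'M[R]_n) t, 0 <= t <= 1 ->
  (forall i j, `|A i j| <= K) -> (forall i j, `|B i j| <= K) ->
  `|\det (A + t *: B) - \det A - t * \tr (B *m \adj A)| <= C * t ^+ 2.
Proof.
move=> K0; have [C C0 hC] := prod_taylor n K0; exists (n`!%:R * C) => [|A B t t01 hA hB].
  by rewrite mulr_ge0.
have -> : \tr (B *m \adj A) = \sum_(p : 'S_n) (-1) ^+ p * \sum_j \prod_i (if i == j then B i (p i) else A i (p i)).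
  rewrite /mxtrace; under eq_bigr do rewrite mulmx_adj_det.
  under [RHS]eq_bigr do rewrite mulr_sumr.
  rewrite exchange_big /=; apply: eq_bigr => j _; apply: eq_bigr => p _; congr (_ * _).
  by apply: eq_bigr => i _; rewrite mxE.
rewrite mulr_sumr -!sumrB (le_trans (ler_norm_sum _ _ _))//.
apply: le_trans (ler_sum (G := fun=> C * t ^+ 2) _ _) _ => [p _|]; last first.
  by rewrite sumr_const card_Sn -mulrA mulr_natl.
rewrite mulrCA -!mulrBr normrM normrX normrN1 expr1n mul1r.
have := hC (fun i => A i (p i)) (fun i => B i (p i)) t t01 (fun i => hA _ _) (fun i => hB _ _).
rewrite [\prod_i (A + t *: B) i (p i)](eq_bigr (fun i => A i (p i) + t * B i (p i))) // => i _.
by rewrite !mxE.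
Qed.

End DetTaylor.

(** * Commutators along a path *)

Section Speed.
Context {R : realType} {n : nat}.
Local Notation pt := 'rV[R]_n.

(** Local estimates with a common constant but uncontrolled radii chain along an interval; the Dini
    argument replaces a finite subdivision. *)
Lemma local_lip_path (h : R -> R) (a b C : R) : a <= b -> 0 <= C ->
  (forall t, a <= t <= b -> exists2 d : R, 0 < d &
     forall u, a <= u <= b -> `|u - t| < d -> `|h u - h t| <= C * `|u - t|) ->
  `|h b - h a| <= C * (b - a).
Proof.
move=> ab C0 hh.
suff main (g : R -> R) : (forall t, a <= t <= b -> exists2 d : R, 0 < d &
     forall u, a <= u <= b -> `|u - t| < d -> `|g u - g t| <= C * `|u - t|) -> g b - g a <= C * (b - a).
  rewrite ler_norml main // andbT.
  have : - h b - - h a <= C * (b - a); last by lra.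
  apply: (main (fun t => - h t)) => t ht; have [d d0 hd] := hh t ht; exists d => // u hu ud.
  by rewrite -opprD normrN hd.
move=> hg; apply: (@dini_le_ae R g set0 a b C C ab C0 (negligible_set0 _)).
- move=> t /andP[t1 t2] e e0.
  have tI : a <= t <= b by rewrite (ltW t1).
  have [d d0 hd] := hg t tI.
  have C1 : 0 < C + 1 by rewrite ltr_wpDl.
  exists (Num.min d (e / (C + 1))); first by rewrite lt_min d0 divr_gt0.
  move=> u au /andP[]; rewrite ltrBlDl -ltrBlDr lt_min ltr_pdivlMr// => /andP[ud ue] ut.
  have uI : a <= u <= b by rewrite au (le_trans (ltW ut)).
  have utn : `|u - t| = t - u by rewrite distrC gtr0_norm// subr_gt0.
  have := hd u uI; rewrite utn => /(_ ud); rewrite distrC.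
  have := ler_norm (g t - g u); have : 0 <= t - u by rewrite subr_ge0 ltW.
  by nra.
- move=> t /andP[t1 t2].
  have tI : a <= t <= b by rewrite t1 ltW.
  have [d d0 hd] := hg t tI; exists d => // u /andP[tu ud] ub.
  have uI : a <= u <= b by rewrite ub (le_trans t1 (ltW tu)).
  have utn : `|u - t| = u - t by rewrite gtr0_norm// subr_gt0.
  have := hd u uI; rewrite utn ltrBlDl => /(_ ud); exact: le_trans (ler_norm _).
- move=> t /andP[t1 t2] _ e e0.
  have tI : a <= t <= b by rewrite t1 ltW.
  have [d d0 hd] := hg t tI; exists d => // u /andP[tu ud] ub.
  have uI : a <= u <= b by rewrite ub (le_trans t1 (ltW tu)).
  have ut0 : 0 < u - t by rewrite subr_gt0.
  have utn : `|u - t| = u - t by rewrite gtr0_norm.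
  have := hd u uI; rewrite utn ltrBlDl => /(_ ud).
  have := ler_norm (g u - g t); nra.
Qed.

Lemma min_sub_le (a b D : R) : Num.min a D - Num.min b D <= `|a - b|.
Proof.
have h1 := ler_norm (a - b); have h2 := normr_ge0 (a - b).
by rewrite /Num.min; case: ltP => h3; case: ltP => h4; lra.
Qed.

Variables (gamma : R -> pt) (N : set R) (M : R).
Hypothesis M0 : 0 <= M.
Hypothesis lip : forall t u, 0 <= t <= 1 -> 0 <= u <= 1 ->
  `|gamma t - gamma u| <= M * `|t - u|.
Hypothesis N0 : (@lebesgue_measure R).-negligible N.

Lemma path_expand t (l : pt) (e : R) : derivable gamma t 1 -> 'D_1 gamma t = l -> 0 < e ->
  exists2 d : R, 0 < d & forall u, t < u < t + d -> `|gamma u - gamma t - (u - t) *: l| <= e * (u - t).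
Proof.
move=> dg <- e0; have [d d0 hd] := derivable_expand dg e0; exists d => // u /andP[tu ud].
have ut0 : 0 < u - t by rewrite subr_gt0.
have := hd (u - t); rewrite (gtr0_norm ut0) ltrBlDl => /(_ ud).
by rewrite [(u - t) *: (1 : R)]mulr1 [t + _]addrC subrK.
Qed.

(* Capping the distance to z at D makes the differential inequality trivial
   wherever gamma is at distance at least D from z. *)
Lemma path_speed (z : pt) (D c t u : R) : 0 <= c ->
  (forall t, 0 <= t <= 1 -> ~ N t -> `|gamma t - z| < D ->
     derivable gamma t 1 /\ `|'D_1 gamma t| <= c) ->
  0 <= t -> t <= u -> u <= 1 ->
  Num.min `|gamma u - z| D - Num.min `|gamma t - z| D <= c * (u - t).
Proof.
move=> c0 dg t0 tu u1.
pose h v := Num.min `|gamma v - z| D.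
have hlip v w : 0 <= v <= 1 -> 0 <= w <= 1 -> h v - h w <= M * `|v - w|.
  move=> hv hw; apply: le_trans (min_sub_le _ _ _) _.
  apply: le_trans (lip hv hw); apply: le_trans (ler_dist_dist _ _) _.
  by rewrite opprB addrA subrK.
have I v : t <= v -> v <= u -> 0 <= v <= 1.
  by move=> tv vu; rewrite (le_trans t0 tv) (le_trans vu u1).
apply: (@dini_le_ae R h N t u M c tu M0 N0).
- move=> v /andP[v1 v2] e e0; have M1 : 0 < M + 1 by rewrite ltr_wpDl.
  exists (e / (M + 1)); first by rewrite divr_gt0.
  move=> w tw /andP[]; rewrite ltrBlDl -ltrBlDr ltr_pdivlMr// => h1 wv.
  have vw : 0 < v - w by rewrite subr_gt0.
  have := hlip v w (I v (ltW v1) v2) (I w tw (le_trans (ltW wv) v2)).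
  by rewrite gtr0_norm//; nra.
- move=> v /andP[v1 v2]; exists 1 => // w /andP[vw _] wu.
  have := hlip w v (I w (le_trans v1 (ltW vw)) wu) (I v v1 (ltW v2)).
  by rewrite gtr0_norm// subr_gt0.
- move=> v /andP[v1 v2] nv e e0.
  have vI := I v v1 (ltW v2).
  have [zD|zD] := ltP `|gamma v - z| D; last first.
    exists 1 => // w /andP[vw _] wu.
    have -> : h v = D by rewrite /h; apply/min_idPr.
    have : h w <= D by rewrite /h ge_min lexx orbT.
    have : 0 <= (c + e) * (w - v) by rewrite mulr_ge0 ?subr_ge0 ?(ltW vw)// addr_ge0// ltW.
    by lra.
  have [d1 d2] := dg v vI nv zD.
  have [d d0 hd] := path_expand d1 erefl e0; exists d => // w hw wu.
  have /andP[vw _] := hw.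
  have vw0 : 0 < w - v by rewrite subr_gt0.
  have -> : h v = `|gamma v - z| by rewrite /h; apply/min_idPl/ltW.
  have h1 : h w <= `|gamma w - z| by rewrite /h ge_min lexx.
  have h2 := hd w hw.
  have h3 : `|gamma w - z| <= `|gamma w - gamma v - (w - v) *: 'D_1 gamma v| +
      (`|(w - v) *: 'D_1 gamma v| + `|gamma v - z|).
    have -> : gamma w - z = (gamma w - gamma v - (w - v) *: 'D_1 gamma v) +
        ((w - v) *: 'D_1 gamma v + (gamma v - z)) by rewrite addrA subrK addrA subrK.
    by rewrite (le_trans (ler_normD _ _))// lerD2l ler_normD.
  rewrite normrZ (gtr0_norm vw0) in h3.
  have h4 : (w - v) * `|'D_1 gamma v| <= (w - v) * c by rewrite ler_pM2l.
  by lra.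
Qed.

Lemma path_speed_full (c t u : R) : 0 <= c ->
  (forall t, 0 <= t <= 1 -> ~ N t -> derivable gamma t 1 /\ `|'D_1 gamma t| <= c) ->
  0 <= t -> t <= u -> u <= 1 -> `|gamma u - gamma t| <= c * (u - t).
Proof.
move=> c0 dg t0 tu u1.
have := path_speed (z := gamma t) (D := `|gamma u - gamma t| + 1) c0
  (fun v hv nv _ => dg v hv nv) t0 tu u1.
by rewrite subrr normr0 (min_idPl _) ?lerDl// (min_idPl _) ?subr0//.
Qed.

(** The speed is known only inside the ball that [gamma] is to remain in. The distance capped at [d]
    grows by at most [c < d] in unit time, so the cap is never reached. *)
Lemma path_stays (x : pt) (d c : R) : gamma 0 = x -> 0 <= c -> c < d ->
  (forall t, 0 <= t <= 1 -> ~ N t -> `|gamma t - x| < d ->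
     derivable gamma t 1 /\ `|'D_1 gamma t| <= c) ->
  forall t, 0 <= t <= 1 -> `|gamma t - x| < d.
Proof.
move=> g0 c0 cd dg t /andP[t0 t1].
have := path_speed c0 dg (lexx 0) t0 t1.
have dd : 0 <= d by lra.
rewrite g0 subrr normr0 (min_idPl dd) subr0 subr0 => h.
have : Num.min `|gamma t - x| d < d.
  by apply: le_lt_trans h _; apply: le_lt_trans cd; rewrite ler_piMr.
by rewrite gt_min ltxx orbF.
Qed.

End Speed.

(** * All commutators up to length s, in size and along a path *)

Section WordBounds.
Context {R : realType} {n m : nat}.
Local Notation pt := 'rV[R]_n.
Variables (O : set pt) (f : 'I_m -> pt -> pt) (s : nat) (Lv : R).
Hypotheses (oO : open O) (s2 : (2 <= s)%N) (cA : classA f s O) (hL : is_L f s O Lv).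

Local Notation Bf := (Bfield (n := n) Lv).
Local Notation Bs := (Bw (n := n) s Lv).

(** One constant for all lengths: [Bs s] covers words shorter than [s]; for length [s] each half of
    the bracket contributes at most [Bs s * Lv], or the product term for the second half. In
    [word_lip], the summand 2 likewise allows both halves to be weakly differentiated, as happens
    when [s] is 2. *)
Definition word_bound : R := Bs s * (1 + 2 * Lv) + n%:R * (2 * (Bs s * Bf)).
Definition word_lip : R := (Bs s + n%:R * (2 * (Bs s * Bf)) + 2) * Lv.

Let L0 : 0 <= Lv. Proof. by case: (is_L_bounds hL). Qed.
Let Bf0 : 0 <= Bf. Proof. exact: Bfield_ge0 hL. Qed.
Let Bs0 l : 0 <= Bs l. Proof. exact: Bw_ge0 hL l. Qed.
Let Bn0 : 0 <= n%:R * (2 * (Bs s * Bf)).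
Proof. exact: mulr_ge0 (ler0n _ _) (mulr_ge0 (ler0n _ 2) (mulr_ge0 (Bs0 s) Bf0)). Qed.
Let BL : 0 <= Bs s * Lv. Proof. exact: mulr_ge0 (Bs0 s) L0. Qed.

Lemma field_norm j x : O x -> `|f j x| <= Lv.
Proof.
by move=> Ox; have [_ b1 _ _] := is_L_bounds hL; apply: le_trans (norm_le_enorm _) (b1 j [::] isT x Ox).
Qed.

(** For [s = 2] the fields are merely locally Lipschitz, and the almost everywhere derivative comes
    from the second part of [is_L]; for larger [s] they are derivable everywhere. *)
Lemma field_derivable_ae k i : exists2 N, nullRn N & forall x, O x -> ~ N x ->
  derivable (fun y => f k y 0 i) x (ebase i).
Proof.
have [s3|s3] := ltnP 2 s.
  exists set0 => [|x Ox _].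
    (* Degenerate boxes have volume zero because the index [i] makes the dimension positive; in
       dimension 0 the empty product would be 1. *)
    move=> e e0; exists (fun=> 0), (fun=> 0); split=> [//|]; split=> [//|P].
    by rewrite big1 ?ltW// => p _; rewrite (bigD1 i)//= !mxE subrr mul0r.
  have h := cA.1 k [::] isT; have [_ /(_ _)] := h.
  by rewrite subn_gt0 => /(_ s3 i x Ox) /(derivable_coord i)[].
have E : s = 2%N by apply/eqP; rewrite eqn_leq s3.
have [_ _ b2 _] := is_L_bounds hL.
have [N [N0 hN]] := b2 k i [::] (esym (f_equal (fun x => x - 2)%N E)).
by exists N => // x Ox nN; have [/(derivable_coord i)[]] := hN x Ox nN.
Qed.

Lemma Dword_Cb (w : seq 'I_m) k j c : (k.+1 <= s - 2)%N -> (0 < size w)%N -> (size w + k <= s - 1)%N ->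
  Cb O k (n%:R * (2 ^+ k.+1 * (Bs (size w) * Bf))) (fun x => 'D_(fw f w x) (f j) x 0 c).
Proof.
move=> ks w0 wk.
have hj c' : Cb O k.+1 Bf (fun x => f j x 0 c') := Cb_le ks (f_Cb oO cA hL j c').
have hj1 c' : Cb O 1 Bf (fun x => f j x 0 c') := Cb_le (ltn0Sn k) (hj c').
have hw i := fw_Cb oO s2 cA hL i w0 wk.
have := Cb_sum oO (index_enum 'I_n) (fun i : 'I_n =>
    CbM oO (Bs0 _) Bf0 (hw i) ((let: And3 _ _ q := hj c in q) i).2).
rewrite -sum1_size sum1_card card_ord; apply: (Cb_ext oO) => x Ox.
by have [_ ->] := derivable_of_Cb oO (fw f w x) Bf0 hj1 Ox.
Qed.

Lemma Xder_bound (w : seq 'I_m) j x c : size w = (s - 1)%N -> O x -> `|Xder f j (fw f w) x 0 c| <= Bs s * Lv.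
Proof.
move=> ws Ox.
have [h1 _] := cA.2 w ws j.
have [_ ->] := derivable_coord c (h1 x Ox).
have w0 : (0 < size w)%N by rewrite ws subn_gt0.
have wk : (size w + 0 <= s - 1)%N by rewrite addn0 ws.
have [_ hl _] := fw_Cb oO s2 cA hL c w0 wk.
apply: le_trans (llip_derive_bound _ (Bs0 _) hl Ox) _; apply: ler_pM => //; last exact: field_norm.
by apply: (Bw_le hL); rewrite ws leq_subr.
Qed.

Lemma Xder_wbound (w : seq 'I_m) j k c : size w = (s - 1)%N ->
  wbound O (f k) (fun x => Xder f j (fw f w) x 0 c) Lv.
Proof.
move=> ws; have [h1 [h2 h3]] := cA.2 w ws j.
have [_ _ _ b3] := is_L_bounds hL.
apply: (weak_wbound oO) => //.
- by move=> i; apply: loc_lipschitz_coord; have [] := cA.1 k [::] isT.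
- by move=> i; exact: field_derivable_ae.
- move=> x Ox; rewrite continuous_open_subspace// in h2.
  have := h2 x; rewrite inE => /(_ Ox) hx.
  exact: (continuous_comp hx (@coord_continuous _ _ _ _ _ _)).
- have [G hG] := h3 k; exists G; split => //; exact: b3 hG.
Qed.

Variables (gamma : R -> pt) (b : 'I_m -> R -> R) (rho M : R) (N : set R).
Hypotheses (gO : forall t, 0 <= t <= 1 -> O (gamma t)) (M0 : 0 <= M) (rho0 : 0 <= rho).
Hypothesis lip : forall t u, 0 <= t <= 1 -> 0 <= u <= 1 -> `|gamma t - gamma u| <= M * `|t - u|.
Hypothesis N0 : (@lebesgue_measure R).-negligible N.
Hypothesis dgamma : forall t, 0 <= t <= 1 -> ~ N t ->
  derivable gamma t 1 /\ 'D_1 gamma t = \sum_j b j t *: f j (gamma t).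
Hypothesis cb : forall j t, 0 <= t <= 1 -> `|b j t| <= rho.

Lemma speed_le t u : 0 <= t -> t <= u -> u <= 1 ->
  `|gamma u - gamma t| <= m%:R * rho * Lv * (u - t).
Proof.
apply: (path_speed_full M0 lip N0); first by rewrite !mulr_ge0.
move=> v hv nv; have [d1 ->] := dgamma hv nv; split => //.
rewrite (le_trans (ler_norm_sum _ _ _))//.
apply: le_trans (ler_sum (G := fun=> rho * Lv) _ _) _ => [j _|].
  by rewrite normrZ; apply: ler_pM => //; [exact: cb|apply/field_norm/gO].
by rewrite sumr_const card_ord -mulrA mulr_natl.
Qed.

Lemma llip_path B h t u : 0 <= B -> llip O B h -> 0 <= t -> t <= u -> u <= 1 ->
  `|h (gamma u) - h (gamma t)| <= B * (m%:R * rho * Lv) * (u - t).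
Proof.
move=> B0 hl t0 tu u1.
have V0 : 0 <= m%:R * rho * Lv by rewrite !mulr_ge0.
apply: (local_lip_path (h := h \o gamma)) => //; first by rewrite mulr_ge0.
move=> v /andP[v1 v2].
have vI : 0 <= v <= 1 by rewrite (le_trans t0 v1) (le_trans v2 u1).
have [d d0 hd] := hl (gamma v) (gO vI).
exists (d / (M + 1)); first by rewrite divr_gt0// ltr_wpDl.
move=> w /andP[w1 w2]; rewrite ltr_pdivlMr ?ltr_wpDl// => wv.
have wI : 0 <= w <= 1 by rewrite (le_trans t0 w1) (le_trans w2 u1).
have near : ball (gamma v) d (gamma w).
  rewrite -ball_normE /= distrC (le_lt_trans (lip wI vI))//.
  by have := normr_ge0 (w - v); lra.
apply: le_trans (hd _ _ near (ballxx _ d0)) _; rewrite -[leRHS]mulrA; apply: ler_wpM2l => //.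
have /andP[v0 v1'] := vI; have /andP[w0 w1'] := wI.
have [vw|wv'] := leP v w.
  by rewrite (ger0_norm (x := w - v)) ?subr_ge0//; exact: speed_le.
rewrite distrC [`|w - v|]distrC (gtr0_norm (x := v - w)) ?subr_gt0//.
by apply: speed_le => //; exact: ltW.
Qed.

Lemma Xder_path (w : seq 'I_m) j c t u : size w = (s - 1)%N -> 0 <= t -> t <= u -> u <= 1 ->
  `|Xder f j (fw f w) (gamma u) 0 c - Xder f j (fw f w) (gamma t) 0 c| <= m%:R * rho * Lv * (u - t).
Proof.
move=> ws t0 tu u1; have [h1 [h2 h3]] := cA.2 w ws j.
apply: (wbound_path (F := f) (c := b) oO _ (fun k => Xder_wbound j k c ws) L0 rho0 gO M0 lip N0 dgamma cb t0 tu u1).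
move=> x Ox; rewrite continuous_open_subspace// in h2.
have := h2 x; rewrite inE => /(_ Ox) hx.
exact: (continuous_comp hx (@coord_continuous _ _ _ _ _ _)).
Qed.

Lemma word_bound_ge0 : 0 <= word_bound.
Proof.
have h : 0 <= 1 + 2 * Lv by rewrite addr_ge0// mulr_ge0.
exact: addr_ge0 (mulr_ge0 (Bs0 s) h) Bn0.
Qed.

Lemma word_lip_ge0 : 0 <= word_lip.
Proof. exact: mulr_ge0 (addr_ge0 (addr_ge0 (Bs0 s) Bn0) (ler0n _ 2)) L0. Qed.

Lemma word_control (w : seq 'I_m) c : (0 < size w <= s)%N ->
  (forall x, O x -> `|fw f w x 0 c| <= word_bound) /\
  forall t u, 0 <= t -> t <= u -> u <= 1 ->
    `|fw f w (gamma u) 0 c - fw f w (gamma t) 0 c| <= word_lip * (m%:R * rho) * (u - t).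
Proof.
move=> /andP[w0 ws].
have E t u : word_lip * (m%:R * rho) * (u - t) =
  Bs s * (m%:R * rho * Lv) * (u - t) +
  (n%:R * (2 * (Bs s * Bf)) * (m%:R * rho * Lv) * (u - t) + 2 * (m%:R * rho * Lv * (u - t))).
  by rewrite /word_lip; ring.
have V0 : 0 <= m%:R * rho * Lv by rewrite !mulr_ge0.
have n0 := Bn0.
have BL' := BL.
have [ws1|ws1] := leqP (size w) (s - 1).
  have wk : (size w + 0 <= s - 1)%N by rewrite addn0.
  have [h1 h2 _] := fw_Cb oO s2 cA hL c w0 wk.
  have BB := Bw_le hL ws.
  split => [x Ox|t u t0 tu u1].
    by have := h1 x Ox; rewrite /word_bound; lra.
  have := llip_path (Bs0 _) h2 t0 tu u1.
  have : Bs (size w) * (m%:R * rho * Lv) * (u - t) <= Bs s * (m%:R * rho * Lv) * (u - t).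
    by apply: ler_wpM2r; [rewrite subr_ge0|apply: ler_wpM2r].
  have : 0 <= n%:R * (2 * (Bs s * Bf)) * (m%:R * rho * Lv) * (u - t).
    by rewrite mulr_ge0 ?subr_ge0// mulr_ge0.
  have : 0 <= m%:R * rho * Lv * (u - t) by rewrite mulr_ge0 ?subr_ge0.
  by rewrite E; lra.
have {ws1}ws1 : size w = s.
  by apply/eqP; rewrite eqn_leq ws -(subnK (ltnW s2)) addn1.
case: w w0 ws ws1 => [//|j w] _ _ /= ws1.
have w1 : size w = (s - 1)%N by rewrite -ws1 subn1.
have w0 : (0 < size w)%N by rewrite w1 subn_gt0.
have Fx x : fw f (j :: w) x 0 c = Xder f j (fw f w) x 0 c - 'D_(fw f w x) (f j) x 0 c.
  by rewrite fw_cons// mxE [in X in _ + X]mxE.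
suff [D1 D2] : (forall x, O x -> `|'D_(fw f w x) (f j) x 0 c| <= Bs s * Lv + n%:R * (2 * (Bs s * Bf))) /\
  forall t u, 0 <= t -> t <= u -> u <= 1 ->
    `|'D_(fw f w (gamma u)) (f j) (gamma u) 0 c - 'D_(fw f w (gamma t)) (f j) (gamma t) 0 c| <=
    m%:R * rho * Lv * (u - t) + n%:R * (2 * (Bs s * Bf)) * (m%:R * rho * Lv) * (u - t).
  split => [x Ox|t u t0 tu u1]; rewrite !Fx.
    have := ler_normB (Xder f j (fw f w) x 0 c) ('D_(fw f w x) (f j) x 0 c).
    by have := Xder_bound j c w1 Ox; have := D1 x Ox; have := Bs0 s; rewrite /word_bound; lra.
  have := Xder_path j c w1 t0 tu u1; have := D2 t u t0 tu u1.
  set p := Xder _ _ _ (gamma u) _ _; set q := Xder _ _ _ (gamma t) _ _.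
  set p' := 'D_(fw f w (gamma u)) (f j) (gamma u) 0 c.
  set q' := 'D_(fw f w (gamma t)) (f j) (gamma t) 0 c => h1 h2.
  have := ler_normB (p - q) (p' - q').
  have -> : p - q - (p' - q') = p - p' - (q - q') by ring.
  have : 0 <= Bs s * (m%:R * rho * Lv) * (u - t) by rewrite mulr_ge0 ?subr_ge0// mulr_ge0.
  by rewrite E; lra.
have [s3|s3] := ltnP 2 s.
  have k1 : (1 <= s - 2)%N by rewrite subn_gt0.
  have wk : (size w + 0 <= s - 1)%N by rewrite addn0 w1.
  have BB : Bs (size w) <= Bs s by apply: (Bw_le hL); rewrite w1 leq_subr.
  have BB' : n%:R * (2 ^+ 1 * (Bs (size w) * Bf)) <= n%:R * (2 * (Bs s * Bf)).
    by rewrite expr1 !ler_wpM2l// ler_wpM2r.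
  have [h1 h2 _] := CbW BB' (Dword_Cb j c k1 w0 wk).
  split => [x Ox|t u t0 tu u1].
    by have := h1 x Ox; lra.
  have := llip_path n0 h2 t0 tu u1.
  have : 0 <= m%:R * rho * Lv * (u - t) by rewrite mulr_ge0 ?subr_ge0.
  by lra.
(* For [s = 2] the second half of the bracket has no Lipschitz bound of its own, but [w] is a single
   letter [k], so it is the derivative of [f j] along [f k]: again an [Xder] term of a word of
   length [s - 1]. *)
have Es : s = 2%N by apply/eqP; rewrite eqn_leq s3.
case: w w1 w0 {ws1 Fx} => [//|k w] w1 _.
have wnil : w = [::].
  by apply: size0nil; move: w1; rewrite Es /= => -[].
rewrite wnil in w1 *.
have sj : size [:: j] = (s - 1)%N by rewrite Es.
split => [x Ox|t u t0 tu u1].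
  by have := Xder_bound k c sj Ox; rewrite /Xder /=; lra.
have := Xder_path k c sj t0 tu u1; rewrite /Xder /=.
have : 0 <= n%:R * (2 * (Bs s * Bf)) * (m%:R * rho * Lv) * (u - t).
  by rewrite mulr_ge0 ?subr_ge0// mulr_ge0.
by lra.
Qed.

End WordBounds.

(** * Frames along a path *)

Section Frames.
Context {R : realType} {n m s : nat}.
Local Notation pt := 'rV[R]_n.
Variable f : 'I_m -> pt -> pt.
Local Notation Idx := (Sidx (n := n) (m := m) s).
Implicit Types (J : Idx) (p : wordT (m := m) s).

Lemma size_word (p : wordT (m := m) s) : size (word p) = p.1.+1.
Proof. by rewrite /word size_takel// size_tuple. Qed.

Lemma word_surj (w : seq 'I_m) : (0 < size w <= s)%N -> exists p : wordT s, word p = w.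
Proof.
case: w => [//|j w] /andP[_ ws].
have sz : size ((j :: w) ++ nseq (s - size (j :: w)) j) == s.
  by rewrite size_cat size_nseq subnKC.
exists (Ordinal ws, Tuple sz); rewrite /word /=.
by rewrite take_size_cat.
Qed.

Definition frame J (x : pt) : 'M[R]_n :=
  \matrix_(a, b) fw f (word (J b)) x 0 a.

Definition Jset J b p : Sidx s := [ffun k => if k == b then p else J k].

Lemma adj_frame J b p x :
  (\adj (frame J x) *m (fw f (word p) x)^T) b 0 = lambdaI f (Jset J b p) x.
Proof.
rewrite mul_adj_det; congr (\det _); apply/matrixP => i k; rewrite !mxE ffunE.
by case: ifP.
Qed.

Lemma ellI_Jset J b p : (ellI (Jset J b p) + size (word (J b)) = ellI J + size (word p))%N.
Proof.
rewrite /ellI (bigD1 b)//= [in RHS](bigD1 b)//= ffunE eqxx.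
rewrite (eq_bigr (fun k => size (word (J k)))); first by rewrite addnC addnA addnAC.
by move=> k /negbTE kb; rewrite ffunE kb.
Qed.

Variables (x : pt) (r : R).
Hypothesis r01 : 0 < r <= 1.

Lemma LambdaF_ge J : `|lambdaI f J x| * r ^+ ellI J <= LambdaF f s x r.
Proof. exact: (le_bigmax _ (fun J : Idx => `|lambdaI f J x| * r ^+ ellI J)). Qed.

(** Cramer's rule identifies the entry with the determinant of a frame whose total length has grown
    by at most one; as [r <= 1], a shorter frame only helps. *)
Lemma adj_frame_bound J b p : (size (word p) <= (size (word (J b))).+1)%N ->
  `|(\adj (frame J x) *m (fw f (word p) x)^T) b 0| * r ^+ ellI J <= LambdaF f s x r / r.
Proof.
move=> hp; have /andP[r0 r1] := r01; rewrite adj_frame ler_pdivlMr//.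
apply: le_trans (LambdaF_ge (Jset J b p)); rewrite -mulrA -exprSr ler_wpM2l//.
apply: ler_wiXn2l => //; first exact: ltW.
rewrite -(leq_add2r (size (word (J b)))) ellI_Jset addSn -addnS leq_add2l//.
Qed.

Variables (B nuv : R).
Hypothesis hB : forall w c, (0 < size w <= s)%N -> `|fw f w x 0 c| <= B.
Hypotheses (nu0 : 0 < nuv) (hnu : nuv <= LambdaF f s x 1).

Lemma frame_bound J i j : `|frame J x i j| <= B.
Proof. by rewrite mxE hB// size_word/= ltn_ord. Qed.

Lemma frame_nondeg : exists J : Idx, nuv <= `|lambdaI f J x|.
Proof.
apply/not_existsP => h; have : LambdaF f s x 1 < nuv.
  by apply: bigmax_lt => // J _; rewrite expr1n mulr1 ltNge; apply/negP/h.
by rewrite ltNge hnu.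
Qed.

Let D : R := n.-1`!%:R * B ^+ n.-1.

(* Cramer's rule in a frame J0 that realizes Lambda(x, 1) >= nu expands v with
   coefficients O(k / nu); replacing a column of length >= s - 1 by a column of
   J0 raises the length by at most one. *)
Lemma adj_long_bound J b (v : 'cV[R]_n) k : (s <= (size (word (J b))).+1)%N ->
  (forall a, `|v a 0| <= k) ->
  `|(\adj (frame J x) *m v) b 0| * r ^+ ellI J <= n%:R * (nuv^-1 * (n%:R * (D * k))) * (LambdaF f s x r / r).
Proof.
move=> hJ hv; have /andP[r0 r1] := r01.
have [J0 hJ0] := frame_nondeg.
set l0 := lambdaI f J0 x in hJ0.
have l00 : l0 != 0 by rewrite -normr_gt0 (lt_le_trans nu0).
pose z := l0^-1 *: (\adj (frame J0 x) *m v).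
have vE : v = \sum_a z a 0 *: (fw f (word (J0 a)) x)^T.
  have : v = frame J0 x *m z.
    rewrite /z -scalemxAr mulmxA mul_mx_adj mul_scalar_mx scalerA.
    by rewrite (_ : \det (frame J0 x) = l0)// mulVf// scale1r.
  move=> {1}->; apply/colP => i; rewrite mxE summxE; apply: eq_bigr => a _.
  by rewrite !mxE mulrC.
have hz a : `|z a 0| <= nuv^-1 * (n%:R * (D * k)).
  rewrite mxE normrM; apply: ler_pM => //.
    by rewrite normfV lef_pV2// posrE ?normr_gt0//.
  rewrite mxE (le_trans (ler_norm_sum _ _ _))//.
  apply: le_trans (ler_sum (G := fun=> D * k) _ _) _ => [i _|].
    by rewrite normrM; apply: ler_pM => //; apply: adj_bound; exact: frame_bound.
  by rewrite sumr_const card_ord mulr_natl.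
rewrite {1}vE mulmx_sumr summxE.
have rl : 0 <= r ^+ ellI J by rewrite exprn_ge0// ltW.
apply: le_trans (ler_wpM2r rl (ler_norm_sum _ _ _)) _; rewrite mulr_suml.
apply: le_trans (ler_sum (G := fun=> nuv^-1 * (n%:R * (D * k)) * (LambdaF f s x r / r)) _ _) _ => [a _|].
  rewrite -scalemxAr mxE normrM -mulrA; apply: ler_pM => //; first by rewrite mulr_ge0.
  by apply: adj_frame_bound; apply: leq_trans hJ; rewrite size_word.
by rewrite sumr_const card_ord -[leRHS]mulrA [leRHS]mulr_natl.
Qed.

End Frames.

(** * Variation of the determinants along a path *)

Section FrameAlongPath.
Context {R : realType} {n m : nat}.
Local Notation pt := 'rV[R]_n.
Variables (O : set pt) (f : 'I_m -> pt -> pt) (s : nat) (Lv : R).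
Hypotheses (oO : open O) (s2 : (2 <= s)%N) (cA : classA f s O) (hL : is_L f s O Lv).
Variables (gamma : R -> pt) (b : 'I_m -> R -> R) (rho M : R) (N : set R).
Hypotheses (gO : forall t, 0 <= t <= 1 -> O (gamma t)) (M0 : 0 <= M) (rho0 : 0 <= rho).
Hypothesis lip : forall t u, 0 <= t <= 1 -> 0 <= u <= 1 -> `|gamma t - gamma u| <= M * `|t - u|.
Hypothesis N0 : (@lebesgue_measure R).-negligible N.
Hypothesis dgamma : forall t, 0 <= t <= 1 -> ~ N t ->
  derivable gamma t 1 /\ 'D_1 gamma t = \sum_j b j t *: f j (gamma t).
Hypothesis cb : forall j t, 0 <= t <= 1 -> `|b j t| <= rho.

Local Notation Bf := (Bfield (n := n) Lv).
Local Notation Bs := (Bw (n := n) s Lv).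
Local Notation WB := (word_bound (n := n) s Lv).
Local Notation WL := (word_lip (n := n) s Lv).

Let L0 : 0 <= Lv. Proof. by case: (is_L_bounds hL). Qed.
Let Bf0 : 0 <= Bf. Proof. exact: Bfield_ge0 hL. Qed.
Let Bs0 l : 0 <= Bs l. Proof. exact: Bw_ge0 hL l. Qed.
Let wctl (w : seq 'I_m) c (hw : (0 < size w <= s)%N) :=
  word_control oO s2 cA hL gO M0 rho0 lip N0 dgamma cb c hw.

Definition drift t : 'M[R]_n := \matrix_(a, i) \sum_k b k t * 'D_(ebase i) (fun y => f k y 0 a) (gamma t).

Lemma drift_bound t a i : 0 <= t <= 1 -> `|drift t a i| <= m%:R * (rho * Bf).
Proof.
move=> tI; rewrite mxE (le_trans (ler_norm_sum _ _ _))//.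
apply: le_trans (ler_sum (G := fun=> rho * Bf) _ _) _ => [k _|].
  rewrite normrM; apply: ler_pM => //; first exact: cb.
  have [_ hl _] := Cb_le (leq0n _) (f_Cb oO cA hL k a).
  (* When [s = 2] this partial derivative may fail to exist at [gamma t]; its default value 0
     satisfies the bound too. *)
  apply: le_trans (llip_derive_bound _ Bf0 hl (gO tI)) _.
  by rewrite ler_piMr// norm_ebase_le.
by rewrite sumr_const card_ord mulr_natl.
Qed.

(** At this length both [fw f w] and the fields have Lipschitz first derivatives, hence a Taylor
    expansion at the point [gamma t] itself. The identity X_k f_w = f_(kw) + Df_k f_w then separates
    the bracket from the drift. *)
Lemma word_expand t (w : seq 'I_m) c (e : R) : 0 <= t < 1 -> ~ N t -> (0 < size w <= s - 2)%N -> 0 < e ->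
  exists2 d : R, 0 < d & forall u, t < u < t + d -> u <= 1 ->
    `|fw f w (gamma u) 0 c - fw f w (gamma t) 0 c -
      (u - t) * (\sum_i drift t c i * fw f w (gamma t) 0 i + \sum_k b k t * fw f (k :: w) (gamma t) 0 c)|
    <= e * (u - t).
Proof.
move=> /andP[t0 t1] nt /andP[w0 ws] e0.
have tI : 0 <= t <= 1 by rewrite t0 ltW.
have k1 : (1 <= s - 2)%N by apply: leq_trans w0 ws.
have wk : (size w + 1 <= s - 1)%N.
  by rewrite addn1 (leq_trans (n := (s - 2).+1))// subn1 subn2 -ltnS !prednK// ?(leq_trans _ s2)// -ltnS prednK// (leq_trans _ s2).
have hw c' := fw_Cb oO s2 cA hL c' w0 wk.
have hf k c' : Cb O 1 Bf (fun x => f k x 0 c') := Cb_le k1 (f_Cb oO cA hL k c').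
have Ot := gO tI.
have [d1 [K [d10 K0 hd1]]] := Cb_taylor oO (Bs0 _) (hw c) Ot.
have [dg gE] := dgamma tI nt.
pose V := m%:R * rho * Lv; have V0 : 0 <= V by rewrite !mulr_ge0.
pose H i := 'D_(ebase i) (fun y => fw f w y 0 c) (gamma t).
pose Q := n%:R * Bs (size w); have Q0 : 0 <= Q := mulr_ge0 (ler0n _ _) (Bs0 _).
have hH i : `|H i| <= Bs (size w).
  have [_ hl _] := hw c.
  apply: le_trans (llip_derive_bound _ (Bs0 _) hl Ot) _.
  by rewrite ler_piMr// norm_ebase_le.
have E : \sum_i drift t c i * fw f w (gamma t) 0 i + \sum_k b k t * fw f (k :: w) (gamma t) 0 c =
    \sum_i (\sum_j b j t *: f j (gamma t)) 0 i * H i.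
  under eq_bigr do rewrite mxE mulr_suml.
  under [RHS]eq_bigr do rewrite summxE mulr_suml.
  rewrite exchange_big [RHS]exchange_big -big_split /=; apply: eq_bigr => k _.
  have [_ D1] := derivable_of_Cb oO (f k (gamma t)) (Bs0 _) hw Ot.
  have [_ D2] := derivable_of_Cb oO (fw f w (gamma t)) Bf0 (hf k) Ot.
  have -> : fw f (k :: w) (gamma t) 0 c = \sum_i f k (gamma t) 0 i * H i -
      \sum_i fw f w (gamma t) 0 i * 'D_(ebase i) (fun y => f k y 0 c) (gamma t).
    by rewrite fw_cons// mxE [in X in _ + X]mxE /Xder D1 D2.
  rewrite mulrBr !mulr_sumr -sumrB -big_split /=; apply: eq_bigr => i _.
  by rewrite mxE; ring.
pose e1 := e / (2 * (Q + 1)).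
have e10 : 0 < e1 by rewrite divr_gt0// mulr_gt0// ltr_wpDl.
have [d2 d20 hd2] := path_expand dg gE e10.
pose d3 := d1 / (V + 1).
have d30 : 0 < d3 by rewrite divr_gt0// ltr_wpDl.
pose d4 := e / (2 * (K * V ^+ 2 + 1)).
have KV : 0 <= K * V ^+ 2 by rewrite mulr_ge0// exprn_ge0.
have d40 : 0 < d4 by rewrite divr_gt0// mulr_gt0// ltr_wpDl.
exists (Num.min d2 (Num.min d3 d4)); first by rewrite !lt_min d20 d30.
move=> u /andP[tu]; rewrite -ltrBlDl !lt_min => /andP[u2 /andP[u3 u4]] u1.
have ut0 : 0 < u - t by rewrite subr_gt0.
have sp := speed_le hL gO M0 rho0 lip N0 dgamma cb t0 (ltW tu) u1.
rewrite -/V in sp.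
have near : `|gamma u - gamma t| < d1.
  apply: le_lt_trans sp _; move: u3; rewrite ltr_pdivlMr ?ltr_wpDl//; lra.
have := hd1 _ near; rewrite [gamma t + _]addrC subrK.
have tu2 : t < u < t + d2 by rewrite tu -ltrBlDl.
have := hd2 u tu2; set l := \sum_j _ => h2 h1.
rewrite E -/l.
have S : \sum_i (gamma u - gamma t) 0 i * H i =
  \sum_i (gamma u - gamma t - (u - t) *: l) 0 i * H i + (u - t) * \sum_i l 0 i * H i.
  by rewrite mulr_sumr -big_split /=; apply: eq_bigr => i _; rewrite !mxE; ring.
have h3 : `|\sum_i (gamma u - gamma t - (u - t) *: l) 0 i * H i| <= Q * (e1 * (u - t)).
  rewrite (le_trans (ler_norm_sum _ _ _))//.
  apply: le_trans (ler_sum (G := fun=> e1 * (u - t) * Bs (size w)) _ _) _ => [i _|].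
    rewrite normrM; apply: ler_pM => //; exact: le_trans (coord_le_norm _ _) h2.
  by rewrite sumr_const card_ord -[_ *+ n]mulr_natl (_ : n%:R * _ = Q * (e1 * (u - t)))// /Q; ring.
have h4 : K * `|gamma u - gamma t| ^+ 2 <= e / 2 * (u - t).
  apply: (@le_trans _ _ (K * (V * (u - t)) ^+ 2)).
    by rewrite ler_wpM2l// lerXn2r// nnegrE// (le_trans _ sp).
  rewrite exprMn mulrA (expr2 (u - t)) mulrA ler_wpM2r ?(ltW ut0)//.
  move: u4; rewrite ltr_pdivlMr ?mulr_gt0 ?ltr_wpDl//; lra.
have h5 : Q * e1 <= e / 2.
  have : e1 * (2 * (Q + 1)) = e by rewrite divfK// gt_eqF// mulr_gt0// ltr_wpDl.
  lra.
have h6 : Q * (e1 * (u - t)) <= e / 2 * (u - t) by rewrite mulrA ler_wpM2r// ltW.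
rewrite S in h1.
set P := \sum_i _ in h1 h3; set T := (u - t) * _ in h1 *.
set W := _ - fw f w (gamma t) 0 c in h1 *.
have -> : W - T = (W - (P + T)) + P by ring.
by rewrite (le_trans (ler_normD _ _))//; lra.
Qed.

Local Notation Idx := (Sidx (n := n) (m := m) s).
Implicit Types (J : Idx).

Let WB0 : 0 <= WB. Proof. exact: word_bound_ge0 hL. Qed.
Let WL0 : 0 <= WL. Proof. exact: word_lip_ge0 hL. Qed.
Let D : R := n.-1`!%:R * WB ^+ n.-1.
Let D0 : 0 <= D. Proof. by rewrite mulr_ge0// exprn_ge0. Qed.

Let frame_gamma_bound J t i j : 0 <= t <= 1 -> `|frame f J (gamma t) i j| <= WB.
Proof.
move=> tI; apply: (frame_bound (s := s)) => w c hw.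
by have [h _] := wctl c hw; apply/h/gO.
Qed.

Let frame_gamma_lip J t u i j : 0 <= t -> t <= u -> u <= 1 ->
  `|frame f J (gamma u) i j - frame f J (gamma t) i j| <= WL * (m%:R * rho) * (u - t).
Proof.
move=> t0 tu u1; rewrite !mxE.
have hw : (0 < size (word (J j)) <= s)%N by rewrite size_word /= ltn_ord.
by have [_ h] := wctl i hw; exact: h.
Qed.

Let adj_gamma J t i j : 0 <= t <= 1 -> `|(\adj (frame f J (gamma t))) i j| <= D.
Proof. by move=> tI; apply: adj_bound => k l; exact: frame_gamma_bound. Qed.

(** A difference quotient rather than a derivative, as the columns of length at least [s - 1] are
    only known to be Lipschitz along [gamma]. *)
Let slope J t u : 'M[R]_n := (u - t)^-1 *: (frame f J (gamma u) - frame f J (gamma t)).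

Let lambda_taylor J : exists2 C : R, 0 <= C & forall t u, 0 <= t -> t < u -> u <= 1 ->
  `|lambdaI f J (gamma u) - lambdaI f J (gamma t) -
    (u - t) * \tr (slope J t u *m \adj (frame f J (gamma t)))| <= C * (u - t) ^+ 2.
Proof.
have wl0 : 0 <= WL * (m%:R * rho) := mulr_ge0 WL0 (mulr_ge0 (ler0n _ m) rho0).
have K0 : 0 <= WB + WL * (m%:R * rho) by rewrite addr_ge0.
have [C C0 hC] := det_taylor n K0; exists C => // t u t0 tu u1.
have tI : 0 <= t <= 1 by rewrite t0 (le_trans (ltW tu)).
have ut0 : 0 < u - t by rewrite subr_gt0.
have := hC (frame f J (gamma t)) (slope J t u) (u - t).
rewrite scalerA divff ?gt_eqF// scale1r [frame f J (gamma t) + _]addrC subrK; apply.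
- by rewrite ltW//=; lra.
- by move=> i j; apply: le_trans (frame_gamma_bound _ _ _ tI) _; rewrite lerDl.
- move=> i j; rewrite !mxE normrM normfV (gtr0_norm ut0) mulrC ler_pdivrMr//.
  have := frame_gamma_lip J i j t0 (ltW tu) u1; rewrite !mxE => /le_trans; apply.
  by rewrite ler_wpM2r ?(ltW ut0)// lerDr.
Qed.

(** Only the existence of [C] matters: it provides the bound at exceptional times and the finiteness
    of the supremum of [LambdaF] along [gamma]. *)
Lemma lambda_lip J : exists2 C : R, 0 <= C & forall t u, 0 <= t -> t <= u -> u <= 1 ->
  `|lambdaI f J (gamma u) - lambdaI f J (gamma t)| <= C * (u - t).
Proof.
have [C C0 hC] := lambda_taylor J.
have wl0 : 0 <= WL * (m%:R * rho) := mulr_ge0 WL0 (mulr_ge0 (ler0n _ m) rho0).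
exists (n%:R * (n%:R * (WL * (m%:R * rho) * D)) + C) => [|t u t0].
  by apply: addr_ge0 => //; do 2 apply: mulr_ge0 => //; exact: mulr_ge0.
rewrite le_eqVlt => /orP[/eqP<- _|tu u1]; first by rewrite !subrr normr0 mulr0.
have tI : 0 <= t <= 1 by rewrite t0 (le_trans (ltW tu)).
have ut0 : 0 < u - t by rewrite subr_gt0.
have := hC t u t0 tu u1.
set W := lambdaI f J _ - _; set T := \tr _ => h1.
have h2 : `|T| <= n%:R * (n%:R * (WL * (m%:R * rho) * D)).
  rewrite (le_trans (ler_norm_sum _ _ _))//.
  apply: le_trans (ler_sum (G := fun=> n%:R * (WL * (m%:R * rho) * D)) _ _) _ => [i _|]; last first.
    by rewrite sumr_const card_ord [leRHS]mulr_natl.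
  rewrite mxE (le_trans (ler_norm_sum _ _ _))//.
  apply: le_trans (ler_sum (G := fun=> WL * (m%:R * rho) * D) _ _) _ => [j _|]; last first.
    by rewrite sumr_const card_ord [leRHS]mulr_natl.
  rewrite normrM; apply: ler_pM => //; last exact: adj_gamma.
  rewrite !mxE normrM normfV (gtr0_norm ut0) mulrC ler_pdivrMr//.
  by have := frame_gamma_lip J i j t0 (ltW tu) u1; rewrite !mxE.
have h3 : `|(u - t) * T| <= n%:R * (n%:R * (WL * (m%:R * rho) * D)) * (u - t).
  by rewrite normrM (gtr0_norm ut0) mulrC ler_wpM2r// ltW.
have h4 : C * (u - t) ^+ 2 <= C * (u - t).
  by apply: ler_wpM2l => //; rewrite expr2; nra.
have := ler_normD (W - (u - t) * T) ((u - t) * T); rewrite subrK; lra.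
Qed.

Variables (r nuv : R).
Hypotheses (r01 : 0 < r <= 1) (nu0 : 0 < nuv) (hnu : forall x, O x -> nuv <= LambdaF f s x 1).

(** Per unit of [rho], the speed of a long column plus the size of the drift applied to it: the
    drift is removed from every column, including those for which no bracket appears. *)
Definition long_speed : R := WL * m%:R + n%:R * (m%:R * Bf * WB).
(** The first summand bounds the trace of the drift. In the second, each of the [n] columns may be
    short, giving [m] brackets, or long, giving the Cramer bound. Apart from the dimensions and [s],
    the result depends only on [Lv] and [nuv]. *)
Definition lambda_rate : R := n%:R * (m%:R * Bf) +
  n%:R * (m%:R + n%:R * (nuv^-1 * (n%:R * (D * long_speed)))).

Let mulmx_small J t (E : 'cV[R]_n) e i : 0 <= t <= 1 -> (forall a, `|E a 0| <= e) ->
  `|(\adj (frame f J (gamma t)) *m E) i 0| <= n%:R * (D * e).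
Proof.
move=> tI hE; rewrite mxE (le_trans (ler_norm_sum _ _ _))//.
apply: le_trans (ler_sum (G := fun=> D * e) _ _) _ => [j _|].
  by rewrite normrM; apply: ler_pM => //; exact: adj_gamma.
by rewrite sumr_const card_ord mulr_natl.
Qed.

Let residual J t u : 'M[R]_n := slope J t u - drift t *m frame f J (gamma t).

(* tr(A M adj M) = tr A det M: the common drift A only enters through its trace. *)
Let trace_split J t u : \tr (slope J t u *m \adj (frame f J (gamma t))) =
  lambdaI f J (gamma t) * \tr (drift t) + \sum_k (\adj (frame f J (gamma t)) *m col k (residual J t u)) k 0.
Proof.
have -> : slope J t u = drift t *m frame f J (gamma t) + residual J t u by rewrite /residual addrC subrK.
rewrite mulmxDl mxtraceD -mulmxA mul_mx_adj mul_mx_scalar mxtraceZ; congr (_ + _).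
rewrite mxtrace_mulC; apply: eq_bigr => k _.
by rewrite mxE [RHS]mxE; apply: eq_bigr => j _; rewrite [col _ _ _ _]mxE.
Qed.

Let long_bound J t u k : 0 <= t -> t < u -> u <= 1 -> (s <= (size (word (J k))).+1)%N ->
  `|(\adj (frame f J (gamma t)) *m col k (residual J t u)) k 0| * r ^+ ellI J <=
  n%:R * (nuv^-1 * (n%:R * (D * long_speed))) * rho * (LambdaF f s (gamma t) r / r).
Proof.
move=> t0 tu u1 hk.
have tI : 0 <= t <= 1 by rewrite t0 (le_trans (ltW tu)).
have ut0 : 0 < u - t by rewrite subr_gt0.
have hB w c : (0 < size w <= s)%N -> `|fw f w (gamma t) 0 c| <= WB.
  by move=> hw; have [h _] := wctl c hw; apply/h/gO.
rewrite (_ : _ * rho * _ = n%:R * (nuv^-1 * (n%:R * (D * (long_speed * rho)))) *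
   (LambdaF f s (gamma t) r / r)); last by ring.
apply: (adj_long_bound r01 hB nu0 (hnu (gO tI)) hk) => a.
rewrite mxE [residual _ _ _ _ _]mxE [X in _ + X]mxE (le_trans (ler_normB _ _))//.
rewrite (_ : long_speed * rho = WL * (m%:R * rho) + n%:R * (m%:R * (rho * Bf) * WB)); last first.
  by rewrite /long_speed; ring.
apply: lerD.
  rewrite mxE normrM normfV (gtr0_norm ut0) mulrC ler_pdivrMr//.
  by have := frame_gamma_lip J a k t0 (ltW tu) u1; rewrite !mxE.
rewrite mxE (le_trans (ler_norm_sum _ _ _))//.
apply: le_trans (ler_sum (G := fun=> m%:R * (rho * Bf) * WB) _ _) _ => [i _|].
  by rewrite normrM; apply: ler_pM => //; [exact: drift_bound|exact: frame_gamma_bound].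
by rewrite sumr_const card_ord [leRHS]mulr_natl.
Qed.

Let short_bound J t k e : 0 <= t < 1 -> ~ N t -> (size (word (J k)) <= s - 2)%N -> 0 < e ->
  exists2 d : R, 0 < d & forall u, t < u < t + d -> u <= 1 ->
  `|(\adj (frame f J (gamma t)) *m col k (residual J t u)) k 0| * r ^+ ellI J <=
  m%:R * rho * (LambdaF f s (gamma t) r / r) + n%:R * (D * e).
Proof.
move=> tI nt ks e0; have /andP[t0 t1] := tI.
have tI' : 0 <= t <= 1 by rewrite t0 ltW.
have w0 : (0 < size (word (J k)))%N by rewrite size_word.
have kss : (0 < size (word (J k)) <= s - 2)%N by rewrite w0.
have [d hd] := choice (fun c => let: ex_intro2 d p q := word_expand c tI nt kss e0 in ex_intro _ d (conj p q)).
have [d' d'0 hd'] := fin_min_pos (fun c => (hd c).1).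
exists d' => // u /andP[tu ud] u1.
have ut0 : 0 < u - t by rewrite subr_gt0.
have rl0 : 0 <= r ^+ ellI J by rewrite exprn_ge0//; case/andP: r01 => /ltW.
have rl1 : r ^+ ellI J <= 1 by rewrite exprn_ile1//; case/andP: r01 => /ltW.
have sur j : exists p : wordT s, word p = j :: word (J k).
  by apply: word_surj => /=; rewrite (leq_ltn_trans ks)// -[X in (_ < X)%N](subnK s2) addn2 ltnS leqnSn.
have [p hp] := choice sur.
(* By [word_expand] the residual column is [Y], made of brackets one letter longer, up to an error
   of size [e]. *)
pose Y := \sum_j b j t *: (fw f (word (p j)) (gamma t))^T : 'cV[R]_n.
rewrite -[col k _](subrK Y) mulmxDr mxE addrC.
apply: le_trans (ler_wpM2r rl0 (ler_normD _ _)) _; rewrite mulrDl; apply: lerD.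
  rewrite mulmx_sumr summxE.
  apply: le_trans (ler_wpM2r rl0 (ler_norm_sum _ _ _)) _; rewrite mulr_suml.
  apply: le_trans (ler_sum (G := fun=> rho * (LambdaF f s (gamma t) r / r)) _ _) _ => [j _|].
    rewrite -scalemxAr mxE normrM -mulrA; apply: ler_pM => //; first by rewrite mulr_ge0.
      exact: cb.
    by apply: adj_frame_bound => //; rewrite hp.
  by rewrite sumr_const card_ord -mulrA [leRHS]mulr_natl.
apply: le_trans (ler_wpM2l _ rl1) _ => //; rewrite mulr1.
apply: mulmx_small => // c.
have u2 : t < u < t + d c by rewrite tu (lt_le_trans ud)// lerD2l.
have := (hd c).2 u u2 u1.
rewrite -ler_pdivrMr// -[(u - t)^-1]gtr0_norm ?invr_gt0// -normrM; apply: le_trans.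
rewrite le_eqVlt; apply/orP; left; apply/eqP; congr `|_|.
rewrite !mxE summxE.
under [X in _ - X = _]eq_bigr do rewrite !mxE hp.
rewrite [RHS]mulrBl [(u - t) * _]mulrC mulfK ?lt0r_neq0// [(u - t)^-1 * _]mulrC opprD addrA.
by congr (_ - _ - _); apply: eq_bigr => j _; rewrite !mxE.
Qed.

Lemma lambda_dini J t e : 0 <= t < 1 -> ~ N t -> 0 < e ->
  exists2 d : R, 0 < d & forall u, t < u < t + d -> u <= 1 ->
  `|lambdaI f J (gamma u) - lambdaI f J (gamma t)| * r ^+ ellI J <=
  (lambda_rate * (rho * (LambdaF f s (gamma t) r / r)) + e) * (u - t).
Proof.
move=> tI nt e0; have /andP[t0 t1] := tI.
have tI' : 0 <= t <= 1 by rewrite t0 ltW.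
have [C C0 hC] := lambda_taylor J.
have /andP[r0 r1] := r01.
have rl0 : 0 <= r ^+ ellI J by rewrite exprn_ge0// ltW.
have rl1 : r ^+ ellI J <= 1 by rewrite exprn_ile1// ltW.
have Ln0 : 0 <= LambdaF f s (gamma t) r.
  by apply: le_trans (LambdaF_ge f (gamma t) r J); rewrite mulr_ge0.
set Lr := LambdaF f s (gamma t) r / r.
have Lr0 : 0 <= Lr by rewrite divr_ge0// ltW.
have LLr : LambdaF f s (gamma t) r <= Lr by rewrite ler_pdivlMr// ler_piMr.
pose G := n%:R * (nuv^-1 * (n%:R * (D * long_speed))).
have G0 : 0 <= G.
  apply: mulr_ge0 => //; apply: mulr_ge0; first by rewrite invr_ge0 ltW.
  apply: mulr_ge0 => //; apply: mulr_ge0 => //; apply: addr_ge0; first exact: mulr_ge0.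
  by apply: mulr_ge0 => //; apply: mulr_ge0 => //; apply: mulr_ge0.
have nD : 0 <= n%:R * (n%:R * D) by apply: mulr_ge0 => //; apply: mulr_ge0.
(* It pays twice: for the errors of the [n] columns, each at most [n%:R * (D * e1)], and for the
   quadratic Taylor remainder, since [u - t] will be below [e1]. *)
pose e1 := e / (n%:R * (n%:R * D) + C + 1).
have P0 : 0 < n%:R * (n%:R * D) + C + 1 by lra.
have e10 : 0 < e1 by rewrite divr_gt0.
have e1E : e1 * (n%:R * (n%:R * D) + C + 1) = e by rewrite divfK// gt_eqF.
have col_bound k : exists2 d : R, 0 < d & forall u, t < u < t + d -> u <= 1 ->
  `|(\adj (frame f J (gamma t)) *m col k (residual J t u)) k 0| * r ^+ ellI J <=
  (m%:R + G) * (rho * Lr) + n%:R * (D * e1).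
  have De : 0 <= n%:R * (D * e1) by apply: mulr_ge0 => //; apply: mulr_ge0 => //; exact: ltW.
  have rL : 0 <= rho * Lr by rewrite mulr_ge0.
  have GrL : 0 <= G * (rho * Lr) by rewrite mulr_ge0.
  have mrL : 0 <= m%:R * (rho * Lr) by rewrite mulr_ge0.
  have [ks|ks] := leqP (size (word (J k))) (s - 2).
    have [d d0 hd] := short_bound tI nt ks e10; exists d => // u hu u1.
    by have := hd u hu u1; rewrite -/Lr; lra.
  exists 1 => // u /andP[tu _] u1.
  have ks' : (s <= (size (word (J k))).+1)%N by rewrite -[X in (X <= _)%N](subnK s2) addn2 ltnS.
  by have := long_bound t0 tu u1 ks'; rewrite -/Lr -/G; lra.
have [d hd] := choice (fun k => let: ex_intro2 d p q := col_bound k in ex_intro _ d (conj p q)).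
have [d' d'0 hd'] := fin_min_pos (fun k => (hd k).1).
exists (Num.min d' e1); first by rewrite lt_min d'0.
move=> u /andP[tu]; rewrite -ltrBlDl lt_min => /andP[ud ue] u1.
have ut0 : 0 < u - t by rewrite subr_gt0.
have h1 := hC t u t0 tu u1.
set T := \tr _ in h1.
have hT : `|T| * r ^+ ellI J <= lambda_rate * (rho * Lr) + n%:R * (n%:R * D) * e1.
  rewrite /T trace_split.
  apply: le_trans (ler_wpM2r rl0 (ler_normD _ _)) _; rewrite mulrDl.
  rewrite (_ : lambda_rate * (rho * Lr) + _ = n%:R * (m%:R * (rho * Bf)) * Lr +
      n%:R * ((m%:R + G) * (rho * Lr) + n%:R * (D * e1))); last by rewrite /lambda_rate -/G; ring.
  apply: lerD.
    rewrite normrM mulrAC mulrC; apply: ler_pM; rewrite ?mulr_ge0//.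
      rewrite (le_trans (ler_norm_sum _ _ _))//.
      apply: le_trans (ler_sum (G := fun=> m%:R * (rho * Bf)) _ _) _ => [i _|]; first exact: drift_bound.
      by rewrite sumr_const card_ord [leRHS]mulr_natl.
    exact: le_trans (LambdaF_ge _ _ _ _) LLr.
  apply: le_trans (ler_wpM2r rl0 (ler_norm_sum _ _ _)) _; rewrite mulr_suml.
  apply: le_trans (ler_sum (G := fun=> (m%:R + G) * (rho * Lr) + n%:R * (D * e1)) _ _) _ => [k _|].
    by apply: (hd k).2 => //; rewrite tu -ltrBlDl (lt_le_trans ud).
  by rewrite sumr_const card_ord [leRHS]mulr_natl.
set W := lambdaI f J _ - _ in h1 *.
have h2 : `|W| <= (u - t) * `|T| + C * (u - t) ^+ 2.
  have := ler_normD (W - (u - t) * T) ((u - t) * T); rewrite subrK normrM (gtr0_norm ut0); lra.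
have h3 : C * (u - t) ^+ 2 * r ^+ ellI J <= C * e1 * (u - t).
  apply: (@le_trans _ _ (C * (u - t) ^+ 2)).
    by rewrite ler_piMr// mulr_ge0// exprn_ge0// ltW.
  by rewrite expr2 mulrA; apply: ler_wpM2r; [exact: ltW|apply: ler_wpM2l => //; exact: ltW].
have h4 : (u - t) * `|T| * r ^+ ellI J <= (u - t) * (lambda_rate * (rho * Lr) + n%:R * (n%:R * D) * e1).
  by rewrite -mulrA ler_wpM2l// ltW.
have h5 := ler_wpM2r rl0 h2; rewrite mulrDl in h5.
have h6 : (n%:R * (n%:R * D) * e1 + C * e1) * (u - t) <= e * (u - t).
  by apply: ler_wpM2r; [exact: ltW|lra].
lra.
Qed.

Lemma lambda_rate_ge0 : 0 <= lambda_rate.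
Proof.
apply: addr_ge0; first by apply: mulr_ge0 => //; exact: mulr_ge0.
apply: mulr_ge0 => //; apply: addr_ge0 => //.
apply: mulr_ge0 => //; apply: mulr_ge0; first by rewrite invr_ge0 ltW.
apply: mulr_ge0 => //; apply: mulr_ge0 => //; apply: addr_ge0; first exact: mulr_ge0.
by apply: mulr_ge0 => //; apply: mulr_ge0 => //; apply: mulr_ge0.
Qed.

End FrameAlongPath.

(** * Choice of the constants and conclusion *)

Lemma dini_abs {R : realType} (h : R -> R) (N : set R) (C c T : R) : 0 <= C ->
  (@lebesgue_measure R).-negligible N ->
  (forall t u, 0 <= t -> t <= u -> u <= 1 -> `|h u - h t| <= C * (u - t)) ->
  (forall t, 0 <= t < 1 -> ~ N t -> forall e : R, 0 < e -> exists2 d : R, 0 < d &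
     forall u, t < u < t + d -> u <= 1 -> `|h u - h t| <= (c + e) * (u - t)) ->
  0 <= T -> T <= 1 -> `|h T - h 0| <= c * T.
Proof.
move=> C0 N0 hlip hd T0 T1.
suff main (g : R -> R) : (forall t u, 0 <= t -> t <= u -> u <= 1 -> `|g u - g t| <= C * (u - t)) ->
  (forall t, 0 <= t < 1 -> ~ N t -> forall e : R, 0 < e -> exists2 d : R, 0 < d &
     forall u, t < u < t + d -> u <= 1 -> `|g u - g t| <= (c + e) * (u - t)) -> g T - g 0 <= c * (T - 0).
  have E u t : `|- h u - - h t| = `|h u - h t| by rewrite -opprD normrN.
  have := main h hlip hd; have := main (fun t => - h t); rewrite subr0 => m1 m2.
  rewrite ler_norml m2 andbT.
  have : - h T - - h 0 <= c * T; last by lra.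
  apply: m1 => [t u *|t ht nt e e0]; first by rewrite E hlip.
  by have [d d0 hd'] := hd t ht nt e e0; exists d => // u hu u1; rewrite E hd'.
move=> gl gd; apply: (@dini_le_ae R g N 0 T C c T0 C0 N0).
- move=> t /andP[t0 tT] e e0; have C1 : 0 < C + 1 by rewrite ltr_wpDl.
  exists (e / (C + 1)); first by rewrite divr_gt0.
  move=> u u0 /andP[]; rewrite ltrBlDl -ltrBlDr ltr_pdivlMr// => tu ut.
  have := gl u t u0 (ltW ut) (le_trans tT T1); have := ler_norm (g t - g u).
  have : 0 <= t - u by rewrite subr_ge0 ltW.
  lra.
- move=> t /andP[t0 tT]; exists 1 => // u /andP[tu _] uT.
  exact: le_trans (ler_norm _) (gl t u t0 (ltW tu) (le_trans uT T1)).
- move=> t /andP[t0 tT] nt e e0.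
  have tI : 0 <= t < 1 by rewrite t0 (lt_le_trans tT).
  have [d d0 hd'] := gd t tI nt e e0; exists d => // u hu uT.
  exact: le_trans (ler_norm _) (hd' u hu (le_trans uT T1)).
Qed.

Lemma compact_ball_radius {R : realType} {n : nat} (K O : set 'rV[R]_n) :
  compact K -> open O -> K `<=` O -> exists2 d : R, 0 < d & forall x y, K x -> `|y - x| < d -> O y.
Proof.
move=> cK oO KO.
have := (@compact_near_coveringP _ K).1 cK _ (0^'+ : set_system R) (fun d x => forall y, `|y - x| < d -> O y) _.
have P : forall x, K x -> \forall x' \near x & d \near 0^'+, forall y, `|y - x'| < d -> O y.
  move=> x Kx; have /nbhs_ballP[e /= e0 he] : \near x, O x by exact: (oO x (KO x Kx)).
  exists (ball x (e / 2), [set d | d < e / 2]).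
    split => /=; first by apply: nbhsx_ballx; rewrite divr_gt0.
    by near=> d; near: d; apply: nbhs_right_lt; rewrite divr_gt0.
  move=> [x' d] [/= hx hd] y yx; apply: he; move: hx; rewrite -!ball_normE /= => hx.
  by have := ler_distD x' x y; rewrite [`|x' - y|]distrC; lra.
move=> /(_ _ P) h; have [d [/= dd hd]] := filter_ex (filterI (nbhs_right_gt 0) h).
by exists d => // x y Kx; exact: hd.
Unshelve. all: by end_near.
Qed.

Theorem theorem4p1 (R : realType) (n m s : nat) (Om Om' : set 'rV[R]_n) :
  (2 <= s)%N -> open Om ->
  open Om' -> connected Om' -> bounded_set Om' ->
  compact (closure Om') -> closure Om' `<=` Om ->
  exists r0 eps0 : R -> R -> R,
    (forall Lv nuv : R, 0 < r0 Lv nuv /\ 0 < eps0 Lv nuv) /\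
    forall f : 'I_m -> 'rV[R]_n -> 'rV[R]_n,
      classA f s Om -> hormander f s Om ->
      forall Lv nuv : R, is_L f s Om Lv -> is_nu f s Om nuv -> 0 < nuv ->
      exists C : R, 0 < C /\
        forall (eta : R) (I : Sidx s) (x : 'rV[R]_n) (r : R),
          0 < eta < 1 -> closure Om' x -> 0 < r -> r < r0 Lv nuv ->
          eta_maximal f eta I x r ->
          forall y, cc_ball f x (eta * eps0 Lv nuv * r) y ->
            `|lambdaI f I y - lambdaI f I x| <= 2^-1 * `|lambdaI f I x| /\
            `|lambdaI f I y| * r ^+ ellI I > C^-1 * eta * LambdaF f s y r.
Proof.
move=> s2 oO _ _ _ cK KO.
have [d0 d00 hd0] := compact_ball_radius cK oO KO.
pose rate (Lv nuv : R) := `|lambda_rate (n := n) (m := m) s Lv nuv|.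
(* The cap 1 lets powers of [r] decrease with length; the other bound keeps paths, whose length is
   at most [m%:R * rho * Lv], within [d0] of their start, hence in [Om]. The second function makes
   rate times eps0 at most 1/4. Absolute values ensure positivity at all real arguments. *)
exists (fun Lv _ => Num.min 1 (d0 / (m%:R * `|Lv| + 1))), (fun Lv nuv => (4 * (rate Lv nuv + 1))^-1).
split=> [Lv nuv|f cA _ Lv nuv hL [hnu _] nu0].
  have h1 : 0 < m%:R * `|Lv| + 1 by rewrite ltr_wpDl// mulr_ge0.
  have h2 : 0 < rate Lv nuv + 1 by rewrite ltr_wpDl// normr_ge0.
  by rewrite lt_min ltr01 divr_gt0// invr_gt0 mulr_gt0.
set eps := (4 * _)^-1.
have rt0 : 0 <= rate Lv nuv by exact: normr_ge0.
have rtE : lambda_rate (n := n) (m := m) s Lv nuv = rate Lv nuv.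
  by rewrite /rate ger0_norm//; apply: (lambda_rate_ge0 hL nu0).
move: (rate Lv nuv) rt0 rtE @eps => K K0 rtE eps.
have epsE : eps * (4 * (K + 1)) = 1 by rewrite /eps mulVf// gt_eqF// mulr_gt0// ltr_wpDl.
have eps0 : 0 < eps by rewrite /eps invr_gt0 mulr_gt0// ltr_wpDl.
have Keps : K * eps <= 4^-1 by lra.
have L0 : 0 <= Lv by case: (is_L_bounds hL).
(* At [y] half of the determinant at [x] survives, and [LambdaF] has grown by a factor of at most
   4/3; this leaves 3/8 of [eta], more than 1/4. *)
exists 4; split => // eta I x r /andP[eta0 eta1] Kx r0; rewrite lt_min => /andP[r1 rd] hmax y.
move=> [rho [rho0 [rho1 [gamma [b [g0 [g1 [[M lipM] [bb ae]]]]]]]]].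
have r01 : 0 < r <= 1 by rewrite r0 ltW.
rewrite (ger0_norm L0) ltr_pdivlMr ?ltr_wpDl ?mulr_ge0// in rd.
pose N := ~` [set t | unitI t -> derivable gamma t 1 /\ 'D_1 gamma t = \sum_(j < m) b j t *: f j (gamma t)].
have N0 : (@lebesgue_measure R).-negligible N := ae.
have dgamma t : 0 <= t <= 1 -> ~ N t ->
    derivable gamma t 1 /\ 'D_1 gamma t = \sum_j b j t *: f j (gamma t).
  by move=> tI /contrapT; apply.
have cb j t : 0 <= t <= 1 -> `|b j t| <= rho by move=> tI; exact: (bb j).2.
have M0 : 0 <= `|M| by [].
have lip t u : 0 <= t <= 1 -> 0 <= u <= 1 -> `|gamma t - gamma u| <= `|M| * `|t - u|.
  by move=> tI uI; rewrite (le_trans (lipM _ _ tI uI))// ler_wpM2r// ler_norm.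
have rho0' := ltW rho0.
have rho_r : rho <= r.
  apply: ltW; apply: lt_le_trans rho1 _; rewrite ler_piMl ?ltW//.
  have : eta * eps < 1 by nra.
  by [].
have gO t : 0 <= t <= 1 -> Om (gamma t).
  have c0 : 0 <= m%:R * (rho * Lv) by rewrite !mulr_ge0.
  have cd : m%:R * (rho * Lv) < d0.
    have : rho * (m%:R * Lv + 1) <= r * (m%:R * Lv + 1) by rewrite ler_wpM2r// addr_ge0// mulr_ge0.
    by lra.
  move=> tI; apply: (hd0 x) => //.
  apply: (path_stays M0 lip N0 g0 c0 cd _ tI) => v vI nv vx.
  have [d1 ->] := dgamma v vI nv; split => //.
  rewrite (le_trans (ler_norm_sum _ _ _))//.
  apply: le_trans (ler_sum (G := fun=> rho * Lv) _ _) _ => [j _|].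
    by rewrite normrZ; apply: ler_pM => //; [exact: cb|apply/(field_norm hL)/(hd0 x)].
  by rewrite sumr_const card_ord mulr_natl.
pose V t := LambdaF f s (gamma t) r.
have [C hC] := choice (fun J : Sidx s => let: ex_intro2 c p q :=
  lambda_lip oO s2 cA hL gO M0 rho0' lip N0 dgamma cb J in ex_intro _ c (conj p q)).
have rl0 (J : Sidx (n := n) (m := m) s) : 0 < r ^+ ellI J by rewrite exprn_gt0.
have rl1 (J : Sidx (n := n) (m := m) s) : r ^+ ellI J <= 1 by rewrite exprn_ile1// ltW.
have V0 t : 0 <= V t.
  by apply: le_trans (LambdaF_ge f (gamma t) r I); rewrite mulr_ge0// ltW.
pose S : set R := [set v | exists2 t, 0 <= t <= 1 & v = V t].
(* Finiteness must come first: otherwise the supremum could not be absorbed in [Ssup]. *)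
have ubS : has_ubound S.
  exists (\sum_J (`|lambdaI f J (gamma 0)| + C J)) => _ [t /andP[t0 t1] ->].
  have p0 J : 0 <= `|lambdaI f J (gamma 0)| + C J by rewrite addr_ge0//; exact: (hC J).1.
  apply: bigmax_le => [|J _]; first by rewrite sumr_ge0.
  rewrite (bigD1 J)//= -[leLHS]addr0; apply: lerD; last by rewrite sumr_ge0.
  have h1 := (hC J).2 0 t (lexx 0) t0 t1.
  have h2 : C J * (t - 0) <= C J by rewrite subr0 ler_piMr// (hC J).1.
  have h3 := ler_normD (lambdaI f J (gamma t) - lambdaI f J (gamma 0)) (lambdaI f J (gamma 0)).
  rewrite subrK in h3.
  apply: (@le_trans _ _ `|lambdaI f J (gamma t)|); first by rewrite ler_piMr.
  lra.
have VS t : 0 <= t <= 1 -> V t <= sup S by move=> tI; apply: ub_le_sup => //; exists t.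
have I0 : 0 <= (0 : R) <= 1 by rewrite lexx ler01.
have I1 : 0 <= (1 : R) <= 1 by rewrite lexx ler01.
have S0 : 0 <= sup S := le_trans (V0 0) (VS 0 I0).
have var (J : Sidx s) T : 0 <= T <= 1 ->
    `|lambdaI f J (gamma T) - lambdaI f J (gamma 0)| * r ^+ ellI J <= eta / 4 * sup S.
  move=> /andP[T0 T1].
  pose h t := lambdaI f J (gamma t) * r ^+ ellI J.
  have hE t u : `|h u - h t| = `|lambdaI f J (gamma u) - lambdaI f J (gamma t)| * r ^+ ellI J.
    by rewrite /h -mulrBl normrM [`|r ^+ _|](gtr0_norm (rl0 J)).
  have := @dini_abs R h N (C J) (K * (rho * (sup S / r))) T (hC J).1 N0.
  rewrite hE => /(_ _ _ T0 T1) /le_trans; apply.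
  - move=> t u t0 tu u1; rewrite hE; apply: le_trans ((hC J).2 t u t0 tu u1).
    by rewrite ler_piMr.
  - move=> t tI nt e e0.
    have [d dd hd] := lambda_dini oO s2 cA hL gO M0 rho0' lip N0 dgamma cb r01 nu0 hnu J tI nt e0.
    exists d => // u hu u1; rewrite hE; apply: le_trans (hd u hu u1) _.
    have /andP[t0 t1] := tI; have /andP[tu _] := hu.
    apply: ler_wpM2r; first by rewrite subr_ge0 ltW.
    rewrite lerD2r rtE !ler_wpM2l// ler_wpM2r ?invr_ge0 ?(ltW r0)//.
    by apply: VS; rewrite t0 ltW.
  - have k0 : K * (rho / r) <= eta / 4.
      have h1 : rho / r <= eta * eps by rewrite ler_pdivrMr// ltW.
      have h2 := ler_wpM2l K0 h1.
      have h3 : eta * (K * eps) <= eta * 4^-1 by rewrite ler_wpM2l// ltW.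
      by lra.
    rewrite (_ : K * _ * T = K * (rho / r) * (sup S * T)); last by ring.
    by apply: ler_pM => //; rewrite ?mulr_ge0 ?divr_ge0 ?invr_ge0 ?(ltW r0)// ler_piMr.
have Ssup : sup S <= V 0 + eta / 4 * sup S.
  apply: ge_sup; first by exists (V 0), 0.
  move=> _ [t tI ->]; apply: bigmax_le => [|J _].
    by rewrite addr_ge0// mulr_ge0// divr_ge0// ltW.
  have h1 := var J t tI.
  have h2 := ler_normD (lambdaI f J (gamma t) - lambdaI f J (gamma 0)) (lambdaI f J (gamma 0)).
  rewrite subrK in h2.
  have h3 := ler_wpM2r (ltW (rl0 J)) h2; rewrite mulrDl in h3.
  have h4 : `|lambdaI f J (gamma 0)| * r ^+ ellI J <= V 0 := LambdaF_ge f (gamma 0) r J.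
  by lra.
have S43 : sup S <= 4 / 3 * V 0.
  have : eta / 4 * sup S <= 4^-1 * sup S by rewrite ler_wpM2r//; lra.
  by lra.
have vI := var I 1 I1; rewrite g0 g1 in vI.
have V0x : V 0 = LambdaF f s x r by rewrite /V g0.
have V1y : V 1 = LambdaF f s y r by rewrite /V g1.
have hm : eta * V 0 < `|lambdaI f I x| * r ^+ ellI I by rewrite V0x.
have e3 : eta / 4 * sup S <= eta / 4 * (4 / 3 * V 0) by rewrite ler_wpM2l// divr_ge0// ltW.
(* Here maximality enters: the variation is a third of [eta * V 0], which is below the weighted
   determinant of [I] at [x]. *)
have half : `|lambdaI f I y - lambdaI f I x| <= 2^-1 * `|lambdaI f I x|.
  rewrite -(ler_pM2r (rl0 I)); have : 0 <= eta * V 0 by rewrite mulr_ge0// ltW.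
  by lra.
split => //; rewrite -V1y.
have h1 : `|lambdaI f I x| <= `|lambdaI f I y| + `|lambdaI f I y - lambdaI f I x|.
  have := ler_normB (lambdaI f I y) (lambdaI f I y - lambdaI f I x).
  by rewrite opprB addrC subrK.
have h2 : 2^-1 * `|lambdaI f I x| <= `|lambdaI f I y| by lra.
have h3 := ler_wpM2r (ltW (rl0 I)) h2.
have h4 : eta * V 1 <= eta * (4 / 3 * V 0).
  by rewrite ler_wpM2l ?(ltW eta0)//; exact: le_trans (VS 1 I1) S43.
have h5 : 0 <= eta * V 1 by rewrite mulr_ge0 ?V0 ?(ltW eta0).
by lra.
Qed.
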